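(* Let $\lambda\in\mathbb{C}\setminus\mathbb{Z}$ and $t\in\mathbb{C}\setminus\{0\}$. In the Lie superalgebra (with supercommutator) of polynomial differential operators on $\mathbb{C}[x,\theta]$ with $x$ even and $\theta$ odd, consider the odd operators $X=x\partial_\theta+x\theta\partial_x-\lambda\theta$, $Z=t(\partial_x\partial_\theta-\theta\partial_x^2)$, $U=\partial_\theta-\theta\partial_x$ and the even operator $Y=\partial_x$, and let $\mathfrak{sl}(\lambda|\lambda+1)$ be the Lie subsuperalgebra they generate. Let $\mathfrak F$ be the free Lie superalgebra on odd generators $X,Z,U$ and an even generator $Y$; put $Y_i=(\operatorname{ad}X)^iY$, $Z_i=(\operatorname{ad}X)^iZ$. Then the natural homomorphism $\mathfrak F\to\mathfrak{sl}(\lambda|\lambda+1)$ is surjective and its kernel is the ideal generated by: (0.1) $[Y,Y_1]=0$; (0.2) $[Y_2,Y]=2Y$; (0.3) $[Y_2,X]=-X$; (0.4) $[Y,U]=0$; (0.5) $[U,U]=-2Y$; (0.6) $[U,Y_1]=0$; (0.7) $[[X,X],[X,U]]=0$; (0.8) $[Y_2,U]=U$; (1.1) $[Y,Z]=0$; (1.2) $[[X,Y],Z]=0$; (1.3) $(\operatorname{ad}X)^7Z=0$; (1.4) $[Y_2,Z]=3Z$; (1.5) $3[Z,[X,U]]-[U,Z_1]=0$; (1.6) $[[X,U],Z_1]=0$; (2.1) $3[Z,Z_3]+2[Z_1,Z_2]=6t(2\lambda+1)\,Z$; (2.2) $[Z_1,Z_3]=2t^2(\lambda-1)(\lambda+2)\,Y+2t(2\lambda+1)\,Z_1$;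 (2.3) $[Z,[U,Z]]=0$; (2.4) $[Z_1,[U,Z]]=0$; (3.1) $[Z_1,[Z,Z]]=0$.
   Context: All brackets are supercommutators $[a,b]=ab-(-1)^{p(a)p(b)}ba$ (so for odd $a$, $[a,a]=2a^2$), and $\operatorname{ad}X(w)=[X,w]$. $X$ is the image of the odd generator $\nabla^+$ of a superprincipally embedded $\mathfrak{osp}(1|2)$; $Z$ is a lowest weight vector of weight $-3$ of a 7-dimensional irreducible $\mathfrak{osp}(1|2)$-submodule and $U$ is a lowest weight vector of weight $-1$ of a 3-dimensional irreducible $\mathfrak{osp}(1|2)$-submodule. The Lie superalgebra $\mathfrak{sl}(\lambda|\lambda+1)$ is the superanalog of the Lie algebra of traceless matrices of complex size, and the subsuperalgebra generated by $X,Y,Z$ alone is $\mathfrak{osp}(\lambda+1|\lambda)$. *)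

(* Defs.v *)
From HB Require Import structures.
From mathcomp Require Import all_boot all_order all_algebra.
From mathcomp Require Import complex.
From mathcomp Require Import Rstruct.
From Stdlib Require Import List.
Set Implicit Arguments.
Unset Strict Implicit.
Unset Printing Implicit Defensive.
Import Order.TTheory GRing.Theory Num.Theory.
Local Open Scope ring_scope.

Definition C : numClosedFieldType := (Rdefinitions.R)[i].

(* The superspace C[x, theta]: an element f0(x) + theta * f1(x) is the  *)
(* pair (f0, f1).  Polynomial differential operators act on it; an     *)
(* operator is represented by its action (the action is faithful).     *)
Definition V := ({poly C} * {poly C})%type.
Definition op := V -> V.

Definition mkV (f0 f1 : {poly C}) : V := (f0, f1).

Definition op0 : op := fun _ => mkV 0 0.
Definition opadd (A B : op) : op := fun v => mkV ((A v).1 + (B v).1) ((A v).2 + (B v).2).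
Definition opscale (c : C) (A : op) : op := fun v => mkV (c *: (A v).1) (c *: (A v).2).
Definition opcomp (A B : op) : op := fun v => A (B v).

Definition op_x : op := fun v => mkV ('X * v.1) ('X * v.2).
Definition op_dx : op := fun v => mkV (v.1^`()) (v.2^`()).
Definition op_th : op := fun v => mkV 0 v.1.
Definition op_dth : op := fun v => mkV v.2 0.

Definition ev (A : op) : op := fun v => mkV (A (mkV v.1 0)).1 (A (mkV 0 v.2)).2.
Definition od (A : op) : op := fun v => mkV (A (mkV 0 v.2)).1 (A (mkV v.1 0)).2.

(* supercommutator [A,B] = AB - sum_{p,q} (-1)^{pq} B_q A_p *)
Definition sbr (A B : op) : op :=
  fun v =>
    let w1 := ev B (ev A v) in
    let w2 := od B (ev A v) in
    let w3 := ev B (od A v) in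
    let w4 := od B (od A v) in
    mkV ((A (B v)).1 - (w1.1 + w2.1 + w3.1 - w4.1))
        ((A (B v)).2 - (w1.2 + w2.2 + w3.2 - w4.2)).

Definition opX (lam : C) : op :=
  opadd (opadd (opcomp op_x op_dth) (opcomp op_x (opcomp op_th op_dx)))
        (opscale (- lam) op_th).
Definition opY : op := op_dx.
Definition opZ (t : C) : op :=
  opscale t (opadd (opcomp op_dx op_dth) (opscale (-1) (opcomp op_th (opcomp op_dx op_dx)))).
Definition opU : op :=
  opadd op_dth (opscale (-1) (opcomp op_th op_dx)).

Inductive in_sl (lam t : C) : op -> Prop :=
| sl_X : in_sl lam t (opX lam)
| sl_Y : in_sl lam t opY
| sl_Z : in_sl lam t (opZ t)
| sl_U : in_sl lam t opU
| sl_0 : in_sl lam t op0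
| sl_add A B : in_sl lam t A -> in_sl lam t B -> in_sl lam t (opadd A B)
| sl_scale c A : in_sl lam t A -> in_sl lam t (opscale c A)
| sl_br A B : in_sl lam t A -> in_sl lam t B -> in_sl lam t (sbr A B).

(* The free Lie superalgebra F on odd X, Z, U and even Y over C:       *)
(* formal terms modulo the congruence generated by the axioms of a     *)
(* Lie superalgebra (vector space axioms, bilinearity, and super-      *)
(* antisymmetry / super-Jacobi on homogeneous bracket monomials).      *)
Inductive gen := gX | gY | gZ | gU.

(* parity: true = odd *)
Definition gpar (g : gen) : bool :=
  match g with gX => true | gY => false | gZ => true | gU => true end.

Inductive LT :=
| Gen of gen
| Zero
| Add of LT & LT
| Scale of C & LT
| Br of LT & LT.

Fixpoint mpar (a : LT) : option bool :=
  match a with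
  | Gen g => Some (gpar g)
  | Br a b => match mpar a, mpar b with
              | Some p, Some q => Some (addb p q)
              | _, _ => None end
  | _ => None
  end.

Definition ssign (p q : bool) : C := if p && q then -1 else 1.

(* Congruence generated by the Lie superalgebra axioms together with the
   extra relations [rel] (each pair (l, r) imposes l = r).  The class of
   Zero for [lcong rel] is the preimage of the ideal of F generated by the
   elements l - r. *)
Inductive lcong (rel : LT -> LT -> Prop) : LT -> LT -> Prop :=
| lc_refl a : lcong rel a a
| lc_sym a b : lcong rel a b -> lcong rel b a
| lc_trans a b c : lcong rel a b -> lcong rel b c -> lcong rel a c
| lc_Add a a' b b' : lcong rel a a' -> lcong rel b b' -> lcong rel (Add a b) (Add a' b')
| lc_Scale k a a' : lcong rel a a' -> lcong rel (Scale k a) (Scale k a')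
| lc_Br a a' b b' : lcong rel a a' -> lcong rel b b' -> lcong rel (Br a b) (Br a' b')
| lc_addA a b c : lcong rel (Add a (Add b c)) (Add (Add a b) c)
| lc_addC a b : lcong rel (Add a b) (Add b a)
| lc_add0 a : lcong rel (Add Zero a) a
| lc_addN a : lcong rel (Add a (Scale (-1) a)) Zero
| lc_scale1 a : lcong rel (Scale 1 a) a
| lc_scaleA k l a : lcong rel (Scale k (Scale l a)) (Scale (k * l) a)
| lc_scaleDl k l a : lcong rel (Scale (k + l) a) (Add (Scale k a) (Scale l a))
| lc_scaleDr k a b : lcong rel (Scale k (Add a b)) (Add (Scale k a) (Scale k b))
| lc_brDl a b c : lcong rel (Br (Add a b) c) (Add (Br a c) (Br b c))
| lc_brDr a b c : lcong rel (Br a (Add b c)) (Add (Br a b) (Br a c))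
| lc_brZl k a b : lcong rel (Br (Scale k a) b) (Scale k (Br a b))
| lc_brZr k a b : lcong rel (Br a (Scale k b)) (Scale k (Br a b))
| lc_anti a b p q : mpar a = Some p -> mpar b = Some q ->
    lcong rel (Br a b) (Scale (- ssign p q) (Br b a))
| lc_jacobi a b c p q r : mpar a = Some p -> mpar b = Some q -> mpar c = Some r ->
    lcong rel (Br a (Br b c)) (Add (Br (Br a b) c) (Scale (ssign p q) (Br b (Br a c))))
| lc_rel l r : rel l r -> lcong rel l r.

Definition norel : LT -> LT -> Prop := fun _ _ => False.

Fixpoint eval (lam t : C) (a : LT) : op :=
  match a with
  | Gen gX => opX lam
  | Gen gY => opY
  | Gen gZ => opZ t
  | Gen gU => opU
  | Zero => op0
  | Add a b => opadd (eval lam t a) (eval lam t b)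
  | Scale k a => opscale k (eval lam t a)
  | Br a b => sbr (eval lam t a) (eval lam t b)
  end.

Definition tX := Gen gX.
Definition tY := Gen gY.
Definition tZ := Gen gZ.
Definition tU := Gen gU.
Definition adX (i : nat) (a : LT) : LT := iter i (Br tX) a.
Definition tYi (i : nat) := adX i tY.
Definition tZi (i : nat) := adX i tZ.
Definition tn (n : nat) : C := n%:R.

Definition relations (lam t : C) : list (LT * LT) :=
  [:: (* 0.1 *) (Br tY (tYi 1), Zero);
      (* 0.2 *) (Br (tYi 2) tY, Scale (tn 2) tY);
      (* 0.3 *) (Br (tYi 2) tX, Scale (-1) tX);
      (* 0.4 *) (Br tY tU, Zero);
      (* 0.5 *) (Br tU tU, Scale (- tn 2) tY);
      (* 0.6 *) (Br tU (tYi 1), Zero);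
      (* 0.7 *) (Br (Br tX tX) (Br tX tU), Zero);
      (* 0.8 *) (Br (tYi 2) tU, tU);
      (* 1.1 *) (Br tY tZ, Zero);
      (* 1.2 *) (Br (Br tX tY) tZ, Zero);
      (* 1.3 *) (adX 7 tZ, Zero);
      (* 1.4 *) (Br (tYi 2) tZ, Scale (tn 3) tZ);
      (* 1.5 *) (Add (Scale (tn 3) (Br tZ (Br tX tU))) (Scale (-1) (Br tU (tZi 1))), Zero);
      (* 1.6 *) (Br (Br tX tU) (tZi 1), Zero);
      (* 2.1 *) (Add (Scale (tn 3) (Br tZ (tZi 3))) (Scale (tn 2) (Br (tZi 1) (tZi 2))),
                 Scale (tn 6 * t * (tn 2 * lam + 1)) tZ);
      (* 2.2 *) (Br (tZi 1) (tZi 3),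
                 Add (Scale (tn 2 * t ^+ 2 * (lam - 1) * (lam + tn 2)) tY)
                     (Scale (tn 2 * t * (tn 2 * lam + 1)) (tZi 1)));
      (* 2.3 *) (Br tZ (Br tU tZ), Zero);
      (* 2.4 *) (Br (tZi 1) (Br tU tZ), Zero);
      (* 3.1 *) (Br (tZi 1) (Br tZ tZ), Zero) ].

Definition rels (lam t : C) : LT -> LT -> Prop :=
  fun l r => List.In (l, r) (relations lam t).

(* Main.v *)
(* Let G be the Lie superalgebra presented by the relations.  The elements
   E1, E2 = (X -+ [[X,U],X])/2, F1 = (U - [X,Y])/2, F2 = -(U + [X,Y])/2 of G
   satisfy the relations of sl(1|2); on C[x,theta] they act as
   theta (x d_x - lam), x d_theta, d_theta, theta d_x, and [E1,F1] + [E2,F2] is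
   the weight operator.  The degree-one elements [Z] and [[X,U],Z] give even
   elements r, q of weight 0 that act diagonally on monomials; ad r multiplies
   E1 by "n" and kills E2, ad q multiplies E2 by "n" and kills E1.  The only
   consequences of the relations quadratic in Z that are needed are [r,q] = 0 and
   [d,[d,Y]] = [d,Y] with d = q - r.

   An induction on k then shows that [(ad r)^i E1, (ad (-r))^j F1] depends only on
   i + j, and likewise for q, E2, F2.  Hence the span of the elements of weight
   1, 0, -1 obtained in this way is closed under the local brackets, so that
   G = n_- + A0 + n_+, where the weight-0 part A0 is spanned by
   [E1, (ad (-r))^k F1] and [E2, (ad (-q))^k F2].  No Serre-type relations are
   needed for n_- and n_+: ad e and ad Y, with e = [E1,E2], are locally nilpotent
   on G, so by sl(2)-theory every nonzero ideal contains a nonzero element of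
   weight 0.  Finally A0 acts faithfully on C[x,theta], so the kernel of the
   action of G is zero. *)
From HB Require Import structures.
Require Import Defs.
From mathcomp Require Import all_boot all_order all_algebra ring.
From mathcomp Require Import boolp.
Set Implicit Arguments.
Unset Strict Implicit.
Unset Printing Implicit Defensive.
Import Order.TTheory GRing.Theory Num.Theory.
Local Open Scope ring_scope.
Local Open Scope quotient_scope.

(** * Linear combinations and Lie superalgebras *)

(** The elements [E1], [E2] and [F1], [F2] come from splitting [X] and [U] into eigenvectors of [ad
    {[X, U]}]; on C[x,theta], [{[X, U]}] acts as [- lam] minus the degree in theta. The relation for
    d reflects that d acts on x^n by a constant and on x^n theta by the same constant minus n, so
    [ad d] kills one block of d_x and fixes the other; this allows [ad q] to be traded for [ad r] on
    [Y]. The obstacle in the induction is that brackets of total degree k + 1 are a priori unequal: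
    they differ by multiples of one element [D = {[r, cartan E1 F1 r k]}]. No single relation kills
    [D]. Evaluating one bracket in two ways ties [D] to its mirror image under the exchange of the
    indices 1 and 2, and the exchanged argument gives a second, independent equation. This is why
    the data are axiomatised with parameters on which the exchange acts, and why sl(2)-theory enters
    already here: it identifies vectors of weight 1 by their brackets with [F1] and [F2]. *)

Section LinearExpressions.
Variables (K : numFieldType) (L : lmodType K).

Inductive lexp := LVar of nat | LZero | LAdd of lexp & lexp | LOpp of lexp
  | LScale of K & lexp.

Fixpoint leval (s : seq L) (e : lexp) : L :=
  match e with
  | LVar i => nth 0 s i
  | LZero => 0
  | LAdd e1 e2 => leval s e1 + leval s e2
  | LOpp e1 => - leval s e1
  | LScale c e1 => c *: leval s e1
  end.

(** Atoms are compared with [eqn], so that the coefficients of a concrete expression compute under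
    [cbn] in the tactic [lmod_over]. *)
Fixpoint lcoef (i : nat) (e : lexp) : K :=
  match e with
  | LVar j => if eqn i j then 1 else 0
  | LZero => 0
  | LAdd e1 e2 => lcoef i e1 + lcoef i e2
  | LOpp e1 => - lcoef i e1
  | LScale c e1 => c * lcoef i e1
  end.

Fixpoint lagree (e1 e2 : lexp) (i n : nat) : Prop :=
  if n is m.+1 then lcoef i e1 = lcoef i e2 /\ lagree e1 e2 i.+1 m else True.

Lemma levalE s e : leval s e = \sum_(i < size s) lcoef i e *: nth 0 s i.
Proof.
elim: e => /= [j||e1 -> e2 ->|e ->|c e ->].
(* An index out of range evaluates to the default 0 of [nth], in agreement with a sum that never
   meets it. *)
- have [lt_js|le_sj] := ltnP j (size s); last first.
    rewrite nth_default // big1 // => i _.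
    case: eqnP => [eij|_]; last by rewrite scale0r.
    by move: (ltn_ord i); rewrite eij ltnNge le_sj.
  rewrite (bigD1 (Ordinal lt_js)) //= (introT eqnP erefl) scale1r big1 ?addr0 // => i ne.
  case: eqnP => [eij|_]; last by rewrite scale0r.
  by case/eqP: ne; apply: val_inj.
- by rewrite big1 // => i _; rewrite scale0r.
- by rewrite -big_split; apply: eq_bigr => i _; rewrite scalerDl.
- by rewrite -sumrN; apply: eq_bigr => i _; rewrite scaleNr.
- by rewrite scaler_sumr; apply: eq_bigr => i _; rewrite scalerA.
Qed.

(** Soundness of the tactic [lmod]: an identity between linear combinations is reduced to one scalar
    identity per atom, each left to [field]. *)
Lemma leval_eq s e1 e2 : lagree e1 e2 0 (size s) -> leval s e1 = leval s e2.
Proof.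
move=> agr; rewrite !levalE; apply: eq_bigr => i _; congr (_ *: _).
have : forall n j, lagree e1 e2 j n -> forall k, (k < n)%N ->
  lcoef (j + k)%N e1 = lcoef (j + k)%N e2.
  elim=> [//|n IH] j /= [e12 /IH {}IH] [|k]; first by rewrite addn0.
  by rewrite ltnS -addSnnS => /IH.
by move=> /(_ _ _ agr i (ltn_ord i)).
Qed.

End LinearExpressions.

(* Atoms are compared up to conversion, as instances inferred along different
   paths make convertible atoms syntactically distinct. *)
Ltac lmod_index s x :=
  lazymatch s with
  | ?y :: ?s' =>
    match constr:(Set) with
    | _ => let _ := constr:(erefl x : x = y) in constr:(0%N)
    | _ => let n := lmod_index s' x in constr:(S n)
    end
  end.

Ltac lmod_insert s x :=
  match constr:(Set) with
  | _ => let _ := lmod_index s x in s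
  | _ => constr:(x :: s)
  end.

Ltac lmod_atoms s e :=
  lazymatch e with
  | ?a + ?b => let s' := lmod_atoms s a in lmod_atoms s' b
  | - ?a => lmod_atoms s a
  | _ *: ?a => lmod_atoms s a
  | 0 => s
  | _ => lmod_insert s e
  end.

Ltac lmod_reify K s e :=
  lazymatch e with
  | ?a + ?b => let a' := lmod_reify K s a in let b' := lmod_reify K s b in
               constr:(@LAdd K a' b')
  | - ?a => let a' := lmod_reify K s a in constr:(@LOpp K a')
  | ?c *: ?a => let a' := lmod_reify K s a in constr:(@LScale K c a')
  | 0 => constr:(@LZero K)
  | _ => let n := lmod_index s e in constr:(@LVar K n)
  end.

Ltac lmod_over K :=
  lazymatch goal with
  | |- @eq ?T ?e1 ?e2 =>
    let s0 := lmod_atoms (@nil T) e1 in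
    let s := lmod_atoms s0 e2 in
    let e1' := lmod_reify K s e1 in
    let e2' := lmod_reify K s e2 in
    refine (@leval_eq K _ s e1' e2' _);
    cbn [size lagree lcoef eqn Nat.eqb]; repeat first [exact I | apply: conj]; by field
  end.

Ltac lmod := lazymatch goal with K : numFieldType |- _ => lmod_over K end.

(** Parity is encoded by two subspaces that together span, which is what a quotient of formal terms
    provides without knowing that they intersect trivially. *)
HB.mixin Record isLieSuper (K : numFieldType) L of GRing.Lmodule K L := {
  lbr : L -> L -> L;
  lpar : bool -> L -> Prop;
  lbrDl : forall a b c, lbr (a + b) c = lbr a c + lbr b c;
  lbrDr : forall a b c, lbr a (b + c) = lbr a b + lbr a c;
  lbrZl : forall k a b, lbr (k *: a) b = k *: lbr a b;
  lbrZr : forall k a b, lbr a (k *: b) = k *: lbr a b;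
  lpar0 : forall p, lpar p 0;
  lparD : forall p a b, lpar p a -> lpar p b -> lpar p (a + b);
  lparZ : forall p k a, lpar p a -> lpar p (k *: a);
  lpar_br : forall p q a b, lpar p a -> lpar q b -> lpar (addb p q) (lbr a b);
  lbr_anti : forall p q a b, lpar p a -> lpar q b ->
    lbr a b = - ((-1) ^+ (p && q) *: lbr b a);
  lbr_jacobi : forall p q r a b c, lpar p a -> lpar q b -> lpar r c ->
    lbr a (lbr b c) = lbr (lbr a b) c + (-1) ^+ (p && q) *: lbr b (lbr a c);
  lpar_split : forall a, exists a0 a1, [/\ lpar false a0, lpar true a1 & a = a0 + a1]
}.

#[short(type="lieSuperType")]
HB.structure Definition LieSuper (K : numFieldType) :=
  {L of GRing.Lmodule K L & isLieSuper K L}.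

Notation "{[ a , b ]}" := (lbr a b) (at level 0, a at level 99, b at level 99,
  format "{[ a ,  b ]}") : ring_scope.

Section LieSuperTheory.
Variables (K : numFieldType) (L : lieSuperType K).
Implicit Types (a b c : L) (p q : bool).

Lemma lbr0l b : {[0, b]} = 0 :> L.
Proof. by have := lbrZl 0 (0 : L) b; rewrite !scale0r. Qed.

Lemma lbr0r b : {[b, 0]} = 0 :> L.
Proof. by have := lbrZr 0 b (0 : L); rewrite !scale0r. Qed.

Lemma lbrNl a b : {[- a, b]} = - {[a, b]}.
Proof. by rewrite -scaleN1r lbrZl scaleN1r. Qed.

Lemma lbrNr a b : {[a, - b]} = - {[a, b]}.
Proof. by rewrite -scaleN1r lbrZr scaleN1r. Qed.

Definition lbrE :=
  (@lbrDl K L, @lbrDr K L, @lbrZl K L, @lbrZr K L, lbrNl, lbrNr, lbr0l, lbr0r).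

Lemma lparN p a : lpar p a -> lpar p (- a).
Proof. by rewrite -scaleN1r; apply: lparZ. Qed.

Lemma lpar_br' p q r a b :
  lpar p a -> lpar q b -> r = addb p q -> lpar r {[a, b]}.
Proof. by move=> pa qb ->; apply: lpar_br. Qed.

(** The identity is additive in [c], which can therefore be split into homogeneous parts; later
    rewriting only has to know the parities of [a] and [b]. *)
Lemma jac p q a b c : lpar p a -> lpar q b ->
  {[a, {[b, c]}]} = {[{[a, b]}, c]} + (-1) ^+ (p && q) *: {[b, {[a, c]}]}.
Proof.
move=> pa qb; have [c0 [c1 [p0 p1 ->]]] := lpar_split c.
rewrite !lbrDr (lbr_jacobi _ _ _ _ _ _ pa qb p0) (lbr_jacobi _ _ _ _ _ _ pa qb p1) scalerDr.
by rewrite -!addrA; congr (_ + _); rewrite addrCA.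
Qed.

Lemma jacoo a b c : lpar true a -> lpar true b ->
  {[a, {[b, c]}]} = {[{[a, b]}, c]} - {[b, {[a, c]}]}.
Proof. by move=> pa pb; rewrite (jac _ pa pb) expr1 scaleN1r. Qed.

Lemma jace q a b c : lpar false a -> lpar q b ->
  {[a, {[b, c]}]} = {[{[a, b]}, c]} + {[b, {[a, c]}]}.
Proof. by move=> pa pb; rewrite (jac _ pa pb) scale1r. Qed.

Lemma jacoe a b c : lpar true a -> lpar false b ->
  {[a, {[b, c]}]} = {[{[a, b]}, c]} + {[b, {[a, c]}]}.
Proof. by move=> pa pb; rewrite (jac _ pa pb) scale1r. Qed.

Lemma brCo a b : lpar true a -> lpar true b -> {[a, b]} = {[b, a]}.
Proof. by move=> pa pb; rewrite (lbr_anti _ _ _ _ pa pb) expr1 scaleN1r opprK. Qed.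

Lemma brCe q a b : lpar false a -> lpar q b -> {[a, b]} = - {[b, a]}.
Proof. by move=> pa pb; rewrite (lbr_anti _ _ _ _ pa pb) scale1r. Qed.

Lemma brCe' q a b : lpar q a -> lpar false b -> {[a, b]} = - {[b, a]}.
Proof. by move=> pa pb; rewrite (lbr_anti _ _ _ _ pa pb) andbF scale1r. Qed.

End LieSuperTheory.

Section LinearCombinations.
Variables (K : numFieldType) (L : lmodType K).
Implicit Types (u v l r : L).

(** Pattern for deriving an equation from known ones: the scalars name the combination that yields
    [u - v], and [lmod] verifies it. *)
Lemma lincomb1 (c : K) l r u v : l = r -> u - v = c *: (l - r) -> u = v.
Proof. by move=> ->; rewrite subrr scaler0 => /eqP; rewrite subr_eq0 => /eqP. Qed.

Lemma lincomb2 (c c' : K) l r l' r' u v : l = r -> l' = r' ->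
  u - v = c *: (l - r) + c' *: (l' - r') -> u = v.
Proof.
by move=> -> ->; rewrite !subrr !scaler0 addr0 => /eqP; rewrite subr_eq0 => /eqP.
Qed.
End LinearCombinations.

Section Span.
Variables (K : numFieldType) (L : lmodType K).

Inductive span (P : L -> Prop) : L -> Prop :=
| span_gen x : P x -> span P x
| span0 : span P 0
| spanD x y : span P x -> span P y -> span P (x + y)
| spanZ c x : span P x -> span P (c *: x).

Lemma spanN P x : span P x -> span P (- x).
Proof. by rewrite -scaleN1r; apply: spanZ. Qed.

End Span.

Ltac par :=
  lazymatch goal with
  | |- lpar _ {[ _, _ ]} => eapply lpar_br'; [par | par | reflexivity]
  | |- lpar _ (_ + _) => apply: lparD; par
  | |- lpar _ (- _) => apply: lparN; par
  | |- lpar _ (_ *: _) => apply: lparZ; par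
  | |- lpar _ 0 => apply: lpar0
  | |- _ => eassumption
  end.

(** * sl(1|2) and the module generated by Z *)

Section Presentation.
Variables (K : numFieldType) (L : lieSuperType K).

(** Chevalley relations of sl(1|2) for the simple system with two odd isotropic roots: the Cartan
    matrix has zero diagonal, whose relations follow from [E1E1] to [F2F2], and off-diagonal entries
    1. *)
Record sl12 (E1 E2 F1 F2 : L) : Prop := Sl12 {
  oE1 : lpar true E1; oE2 : lpar true E2; oF1 : lpar true F1; oF2 : lpar true F2;
  E1E1 : {[E1, E1]} = 0; E2E2 : {[E2, E2]} = 0;
  F1F1 : {[F1, F1]} = 0; F2F2 : {[F2, F2]} = 0;
  E1F2 : {[E1, F2]} = 0; E2F1 : {[E2, F1]} = 0;
  QE2 : {[{[E1, F1]}, E2]} = E2; QF2 : {[{[E1, F1]}, F2]} = - F2;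
  RE1 : {[{[E2, F2]}, E1]} = E1; RF1 : {[{[E2, F2]}, F1]} = - F1
}.

(** This diagram symmetry provides the second half of most arguments below. *)
Lemma sl12_swap E1 E2 F1 F2 : sl12 E1 E2 F1 F2 -> sl12 E2 E1 F2 F1.
Proof. by case=> *; split. Qed.

(* [a] and [b] act as [d_x d_theta] and [theta d_x^2]; in the intended case
   [mu = 2 lam + 1] and [kap = 2 (lam - 1) (lam + 2)]. *)
Record level1 (mu kap : K) (E1 E2 F1 F2 a b : L) : Prop := Level1 {
  oa : lpar true a; ob : lpar true b;
  F1a : {[F1, a]} = 0; F2b : {[F2, b]} = 0; F2a : {[F2, a]} = {[F1, b]};
  E2a : {[E2, a]} = 0; E1b : {[E1, b]} = 0;
  Qa : {[{[E1, F1]}, a]} = - a; Ra : {[{[E2, F2]}, a]} = - (2%:R *: a);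
  Qb : {[{[E1, F1]}, b]} = - (2%:R *: b); Rb : {[{[E2, F2]}, b]} = - b;
  aw : {[a, {[F1, b]}]} = 0; bw : {[b, {[F1, b]}]} = 0;
  e3g : iter 3 (lbr {[E1, E2]}) ({[E1, a]} - {[E2, b]}) = 0;
  A1 : 3%:R *: {[a, {[{[E1, E2]}, {[E1, a]} - {[E2, b]}]}]}
       + 2%:R *: {[{[E1, a]} - {[E2, b]}, {[{[E1, E2]}, a]}]} = (6%:R * mu) *: a;
  A2 : 3%:R *: {[b, {[{[E1, E2]}, {[E1, a]} - {[E2, b]}]}]}
       + 2%:R *: {[{[E1, a]} - {[E2, b]}, {[{[E1, E2]}, b]}]} = (6%:R * mu) *: b;
  A3 : {[{[E1, a]} - {[E2, b]}, {[{[E1, E2]}, {[E1, a]} - {[E2, b]}]}]}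
       = kap *: {[F1, F2]} + (2%:R * mu) *: ({[E1, a]} - {[E2, b]})
}.

(** * From the defining relations to [sl12] and [level1] *)

Section FromRelations.
Variables (lam t : K) (X Y Z U : L).
Hypothesis t0 : t != 0.
Hypotheses (pX : lpar true X) (pY : lpar false Y) (pZ : lpar true Z) (pU : lpar true U).
Let Y1 := {[X, Y]}.
Let Y2 := {[X, Y1]}.
Let Zi i := iter i (lbr X) Z.
Hypotheses (h01 : {[Y, Y1]} = 0) (h02 : {[Y2, Y]} = 2%:R *: Y)
  (h03 : {[Y2, X]} = -1 *: X) (h05 : {[U, U]} = (- 2%:R) *: Y)
  (h06 : {[U, Y1]} = 0) (h07 : {[{[X, X]}, {[X, U]}]} = 0) (h08 : {[Y2, U]} = U)
  (h11 : {[Y, Z]} = 0) (h12 : {[{[X, Y]}, Z]} = 0) (h13 : Zi 7 = 0)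
  (h14 : {[Y2, Z]} = 3%:R *: Z)
  (h15 : 3%:R *: {[Z, {[X, U]}]} + -1 *: {[U, Zi 1]} = 0)
  (h16 : {[{[X, U]}, Zi 1]} = 0)
  (h21 : 3%:R *: {[Z, Zi 3]} + 2%:R *: {[Zi 1, Zi 2]}
         = (6%:R * t * (2%:R * lam + 1)) *: Z)
  (h22 : {[Zi 1, Zi 3]} = (2%:R * t ^+ 2 * (lam - 1) * (lam + 2%:R)) *: Y
         + (2%:R * t * (2%:R * lam + 1)) *: Zi 1)
  (h23 : {[Z, {[U, Z]}]} = 0).

(** The original generators are recovered as [X = gE1 + gE2] and [U = gF1 - gF2]; [BF1] to [BE2]
    give the eigenvalues 1 and -1 under [ad {[X, U]}]. *)
Definition gF1 := 2%:R^-1 *: (U - {[X, Y]}).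
Definition gF2 := - (2%:R^-1 *: (U + {[X, Y]})).
Definition gE1 := 2%:R^-1 *: (X - {[{[X, U]}, X]}).
Definition gE2 := 2%:R^-1 *: (X + {[{[X, U]}, X]}).

Let B := {[X, U]}.
Let J := {[B, X]}.

Let pY1 : lpar true Y1. Proof. by rewrite /Y1; par. Qed.
Let pY2 : lpar false Y2. Proof. by rewrite /Y2; par. Qed.
Let pB : lpar false B. Proof. by rewrite /B; par. Qed.
Let pJ : lpar true J. Proof. by rewrite /J; par. Qed.

Let XY : {[X, Y]} = Y1. Proof. by []. Qed.
Let XY1 : {[X, Y1]} = Y2. Proof. by []. Qed.
Let XU : {[X, U]} = B. Proof. by []. Qed.
Let BX : {[B, X]} = J. Proof. by []. Qed.

(** Here and in the next two identities, a given relation is bracketed with [X] and expanded by the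
    Jacobi identity. *)
Let Y1Y1 : {[Y1, Y1]} = 2%:R *: Y.
Proof.
have := congr1 (lbr X) h01; rewrite lbr0r (jacoe _ pX pY) XY XY1.
by rewrite (brCe pY pY2) h02 => h; apply: (lincomb1 (c := 1) h); lmod.
Qed.

Let BY1 : {[B, Y1]} = - U.
Proof.
have := congr1 (lbr X) h06; rewrite lbr0r (jacoo _ pX pU) XU XY1.
by rewrite (brCe' pU pY2) h08 => h; apply: (lincomb1 (c := 1) h); lmod.
Qed.

Let BU : {[B, U]} = - Y1.
Proof.
have := congr1 (lbr X) h05; rewrite (jacoo _ pX pU) XU lbrZr XY.
by rewrite (brCe' pU pB) => h; apply: (lincomb1 (c := 2%:R^-1) h); lmod.
Qed.

Let UB : {[U, B]} = Y1. Proof. by rewrite (brCe' pU pB) BU opprK. Qed.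

Let pA : lpar false {[X, X]}. Proof. by par. Qed.

(** Since [ad {[X, X]}] is twice the square of [ad X], hypothesis [h07] says that this square kills
    [B]. *)
Let XJ : {[X, J]} = 0.
Proof.
have XB : {[X, J]} = - {[X, {[X, B]}]} by rewrite /J (brCe pB pX) lbrNr.
have := h07; rewrite XU.
have := jacoo B pX pX; rewrite -XB => h1 h2.
rewrite h2 in h1.
have h3 : {[X, {[X, B]}]} = - {[X, J]} by rewrite XB opprK.
by rewrite h3 in h1; apply: (lincomb1 (c := - 2%:R^-1) h1); lmod.
Qed.

Let BY2 : {[B, Y2]} = 0.
Proof.
rewrite (brCe pB pY2) /B (jace _ pY2 pX) h03 h08 lbrZl.
by lmod.
Qed.

Let Y2X : {[X, Y2]} = X.
Proof. by rewrite (brCe' pX pY2) h03; lmod. Qed.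

(** [ad B] commutes with [ad {[X, X]}] by [h07]. Applied to [{[{[X, X]}, U]} = - (2%:R *: J)], it
    turns the left side into [- {[{[X, X]}, Y1]}], which is [- (2%:R *: X)]. *)
Let BJ : {[B, J]} = X.
Proof.
have e1 : {[{[X, X]}, Y1]} = 2%:R *: X.
  have := jacoo Y1 pX pX; rewrite XY1 Y2X => h.
  by apply: (lincomb1 (c := -1) h); lmod.
have BX' : J = - {[X, B]} by rewrite /J (brCe pB pX).
have e2 : {[{[X, X]}, U]} = - (2%:R *: J).
  have := jacoo U pX pX; rewrite XU BX' => h.
  by apply: (lincomb1 (c := -1) h); lmod.
have e3 := jace U pB pA; move: e3; rewrite e2 lbrNr lbrZr.
rewrite (brCe pB pA) -/B h07 oppr0 lbr0l add0r BU lbrNr e1 => e3.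
by apply: (lincomb1 (c := - 2%:R^-1) e3); lmod.
Qed.

Let JJ : {[J, J]} = - {[X, X]}.
Proof.
have := jace J pB pX; rewrite XJ lbr0r BJ -/J => h.
by apply: (lincomb1 (c := -1) h); lmod.
Qed.

Let JU : {[J, U]} = Y2.
Proof.
have := jace U pB pX; rewrite XU BU lbrNr XY1 -/J.
have -> : {[B, B]} = 0.
  have := brCe pB pB => h; apply: (lincomb1 (c := 2%:R^-1) h); lmod.
by move=> h; apply: (lincomb1 (c := -1) h); lmod.
Qed.

Let JY1 : {[J, Y1]} = B.
Proof.
have := jace Y1 pB pX; rewrite XY1 BY1 lbrNr XU BY2 -/J => h.
by apply: (lincomb1 (c := -1) h); lmod.
Qed.

Let gF1E : gF1 = 2%:R^-1 *: (U - Y1). Proof. by []. Qed.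
Let gF2E : gF2 = - (2%:R^-1 *: (U + Y1)). Proof. by []. Qed.
Let gE1E : gE1 = 2%:R^-1 *: (X - J). Proof. by []. Qed.
Let gE2E : gE2 = 2%:R^-1 *: (X + J). Proof. by []. Qed.

Let BF1 : {[B, gF1]} = gF1.
Proof. by rewrite gF1E lbrZr lbrDr lbrNr BU BY1; lmod. Qed.
Let BF2 : {[B, gF2]} = - gF2.
Proof. by rewrite gF2E lbrNr lbrZr lbrDr BU BY1; lmod. Qed.
Let BE1 : {[B, gE1]} = - gE1.
Proof. by rewrite gE1E lbrZr lbrDr lbrNr BJ BX; lmod. Qed.
Let BE2 : {[B, gE2]} = gE2.
Proof. by rewrite gE2E lbrZr lbrDr BJ BX; lmod. Qed.

Let Y2Y1 : {[Y2, Y1]} = Y1.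
Proof. by rewrite /Y1 (jace _ pY2 pX) h03 h02 !lbrZl !lbrZr; lmod. Qed.

Let Y2B : {[Y2, B]} = 0.
Proof. by rewrite (brCe pY2 pB) BY2 oppr0. Qed.

Let Y2J : {[Y2, J]} = - J.
Proof. by rewrite /J (jace _ pY2 pB) Y2B h03 !lbrE; lmod. Qed.

Let Y2F1 : {[Y2, gF1]} = gF1.
Proof. by rewrite gF1E lbrZr lbrDr lbrNr h08 Y2Y1. Qed.
Let Y2F2 : {[Y2, gF2]} = gF2.
Proof. by rewrite gF2E lbrNr lbrZr lbrDr h08 Y2Y1. Qed.
Let Y2E1 : {[Y2, gE1]} = - gE1.
Proof. by rewrite gE1E lbrZr lbrDr lbrNr h03 Y2J; lmod. Qed.
Let Y2E2 : {[Y2, gE2]} = - gE2.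
Proof. by rewrite gE2E lbrZr lbrDr h03 Y2J; lmod. Qed.

Let Y1U : {[Y1, U]} = 0. Proof. by rewrite (brCo pY1 pU). Qed.
Let JX : {[J, X]} = 0. Proof. by rewrite (brCo pJ pX). Qed.

Let EF1 : {[gE1, gF1]} = 2%:R^-1 *: (B - Y2).
Proof.
by rewrite gE1E gF1E !lbrE XU XY1 -/B -/J JU JY1; lmod.
Qed.

Let EF2 : {[gE2, gF2]} = - (2%:R^-1 *: (B + Y2)).
Proof. by rewrite gE2E gF2E !lbrE XU XY1 -/B -/J JU JY1; lmod. Qed.

Lemma gFF : {[gF1, gF2]} = Y.
Proof. by rewrite gF1E gF2E !lbrE h05 Y1Y1 h06 Y1U; lmod. Qed.

Lemma sl12_of_relations : sl12 gE1 gE2 gF1 gF2.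
Proof.
split; rewrite ?EF1 ?EF2.
- by rewrite gE1E ; par.
- by rewrite gE2E ; par.
- by rewrite gF1E ; par.
- by rewrite gF2E ; par.
- by rewrite gE1E !lbrE -/B -/J XJ JX JJ; lmod.
- by rewrite gE2E !lbrE -/B -/J XJ JX JJ; lmod.
- by rewrite gF1E !lbrE h05 Y1Y1 h06 Y1U; lmod.
- by rewrite gF2E !lbrE h05 Y1Y1 h06 Y1U; lmod.
- by rewrite gE1E gF2E !lbrE XU XY1 -/B -/J JU JY1; lmod.
- by rewrite gE2E gF1E !lbrE XU XY1 -/B -/J JU JY1; lmod.
- by rewrite ?lbrNl lbrZl lbrDl ?lbrNl BE2 Y2E2; lmod.
- by rewrite ?lbrNl lbrZl lbrDl ?lbrNl BF2 Y2F2; lmod.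
- by rewrite ?lbrNl lbrZl lbrDl ?lbrNl BE1 Y2E1; lmod.
- by rewrite ?lbrNl lbrZl lbrDl ?lbrNl BF1 Y2F1; lmod.
Qed.

(** The eigencomponents of [Z] under [ad {[X, U]}], normalised so that [Z = t *: (ga - gb)]; this
    removes [t] from the relations quadratic in [Z]. *)
Definition ga := (2%:R * t)^-1 *: (Z + {[{[X, U]}, Z]}).
Definition gb := (2%:R * t)^-1 *: ({[{[X, U]}, Z]} - Z).

Let T := {[B, Z]}.
Let W := {[U, Z]}.
Let Z1 := {[X, Z]}.

Let pT : lpar true T. Proof. by rewrite /T; par. Qed.
Let pZ1 : lpar false Z1. Proof. by rewrite /Z1; par. Qed.
Let UZ : {[U, Z]} = W. Proof. by []. Qed.
Let BZ : {[B, Z]} = T. Proof. by []. Qed.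
Let XZ : {[X, Z]} = Z1. Proof. by []. Qed.
Let Y1Z : {[Y1, Z]} = 0. Proof. exact: h12. Qed.
Let BZ1 : {[B, Z1]} = 0. Proof. exact: h16. Qed.
Let UX : {[U, X]} = B. Proof. by rewrite (brCo pU pX). Qed.

Let XW : {[X, W]} = 4%:R *: T.
Proof.
have h := h15; rewrite /= XZ XU (brCe' pZ pB) BZ (jacoo _ pU pX) UX BZ UZ in h.
by apply: (lincomb1 (c := 1) h); lmod.
Qed.

Let UW : {[U, W]} = 0.
Proof.
have h := jacoo Z pU pU; rewrite h05 lbrZl h11 UZ in h.
by apply: (lincomb1 (c := 2%:R^-1) h); lmod.
Qed.

Let UT_BW : {[U, T]} = {[B, W]}.
Proof. by rewrite /T (jacoe _ pU pB) UB Y1Z add0r. Qed.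

(** Bracketing [XW] with [U] expresses [{[B, W]}] as four times itself. *)
Let BW : {[B, W]} = 0.
Proof.
have h := jacoo W pU pX; rewrite XW UX UW lbr0r lbrZr UT_BW in h.
by apply: (lincomb1 (c := 3%:R^-1) h); lmod.
Qed.

Let UT : {[U, T]} = 0. Proof. by rewrite UT_BW BW. Qed.

Let JZ : {[J, Z]} = - {[X, T]}.
Proof.
have h := jace Z pB pX; rewrite XZ BZ1 BX BZ in h.
by apply: (lincomb1 (c := -1) h); lmod.
Qed.

(** [{[J, W]}] is computed twice: [ad B] applied to [XW] gives [4%:R *: {[B, T]}], while [W =
    {[U, Z]}] gives [3%:R *: Z + {[B, T]}]. *)
Let BT : {[B, T]} = Z.
Proof.
have h1 := jace W pB pX; rewrite XW BW BX lbrZr lbr0r in h1.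
have h2 := jacoo Z pJ pU; rewrite JU h14 JZ UZ lbrNr (jacoo _ pU pX) UX UT lbr0r in h2.
by apply: (lincomb2 (c := 3%:R^-1) (c' := 3%:R^-1) h1 h2); lmod.
Qed.

Let Y1T : {[Y1, T]} = W.
Proof. by rewrite /T (jacoe _ pY1 pB) Y1Z (brCe' pY1 pB) BY1 opprK lbr0r addr0. Qed.

Let JT : {[J, T]} = - Z1.
Proof.
have h1 := jace Z pB pJ; rewrite JZ BJ BZ lbrNr XZ in h1.
have h2 := jace T pB pX; rewrite BT BX XZ in h2.
by apply: (lincomb2 (c := - 2%:R^-1) (c' := - 2%:R^-1) h1 h2); lmod.
Qed.

Let Y2T : {[Y2, T]} = 3%:R *: T.
Proof. by rewrite /T (jace _ pY2 pB) Y2B h14 lbr0l lbrZr add0r. Qed.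

Let gaE : ga = (2%:R * t)^-1 *: (Z + T). Proof. by []. Qed.
Let gbE : gb = (2%:R * t)^-1 *: (T - Z). Proof. by []. Qed.

Let F1bE : {[gF1, gb]} = - ((2%:R * t)^-1 *: W).
Proof. by rewrite gF1E gbE !lbrE UZ UT Y1Z Y1T; lmod. Qed.

Let E1aE : {[gE1, ga]} = (2%:R * t)^-1 *: (Z1 + {[X, T]}).
Proof. by rewrite gE1E gaE !lbrE XZ JZ JT; lmod. Qed.

Let E2bE : {[gE2, gb]} = (2%:R * t)^-1 *: ({[X, T]} - Z1).
Proof. by rewrite gE2E gbE !lbrE XZ JZ JT; lmod. Qed.

Let gammaE : {[gE1, ga]} - {[gE2, gb]} = t^-1 *: Z1.
Proof. by rewrite E1aE E2bE; lmod. Qed.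

Let eE : {[gE1, gE2]} = 2%:R^-1 *: {[X, X]}.
Proof. by rewrite gE1E gE2E !lbrE XJ JX JJ; lmod. Qed.

Let ead c : {[{[gE1, gE2]}, c]} = {[X, {[X, c]}]}.
Proof.
have h := jacoo c pX pX; rewrite eE lbrZl.
by apply: (lincomb1 (c := - 2%:R^-1) h); lmod.
Qed.

Let Be c : {[B, {[X, {[X, c]}]}]} = {[X, {[X, {[B, c]}]}]}.
Proof.
rewrite -!ead eE !lbrZl !lbrZr (jace c pB pA).
by rewrite (brCe pB pA) h07 oppr0 lbr0l add0r.
Qed.

Let h21' : 3%:R *: {[Z, {[X, {[X, Z1]}]}]} + 2%:R *: {[Z1, {[X, {[X, Z]}]}]}
  = (6%:R * t * (2%:R * lam + 1)) *: Z.
Proof. exact: h21. Qed.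

(** [ad B] kills [Z1], sends [Z] to [T] and commutes with the square of [ad X]. The sum and the
    difference of this relation and [h21'] become [A1] and [A2]. *)
Let h21B : 3%:R *: {[T, {[X, {[X, Z1]}]}]} + 2%:R *: {[Z1, {[X, {[X, T]}]}]}
  = (6%:R * t * (2%:R * lam + 1)) *: T.
Proof.
have := congr1 (lbr B) h21'; rewrite lbrDr !lbrZr (jace _ pB pZ) (jace _ pB pZ1).
by rewrite BZ BZ1 !Be BZ1 BZ !lbr0r !lbr0l addr0 add0r.
Qed.

Let h22' : {[Z1, {[X, {[X, Z1]}]}]} = (2%:R * t ^+ 2 * (lam - 1) * (lam + 2%:R)) *: Y
  + (2%:R * t * (2%:R * lam + 1)) *: Z1.
Proof. exact: h22. Qed.

Let ZW : {[Z, W]} = 0. Proof. exact: h23. Qed.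
Let TW : {[T, W]} = 0.
Proof.
have := congr1 (lbr B) ZW; rewrite (jace _ pB pZ) BZ BW !lbr0r addr0.
by [].
Qed.

Lemma level1_of_relations :
  level1 (2%:R * lam + 1) (2%:R * (lam - 1) * (lam + 2%:R)) gE1 gE2 gF1 gF2 ga gb.
Proof.
split; rewrite ?F1bE ?gammaE ?gFF ?ead ?EF1 ?EF2.
- by rewrite gaE; par.
- by rewrite gbE; par.
- by rewrite gF1E gaE !lbrE UZ UT Y1Z Y1T; lmod.
- by rewrite gF2E gbE !lbrE UZ UT Y1Z Y1T; lmod.
- by rewrite gF2E gaE !lbrE UZ UT Y1Z Y1T; lmod.
- by rewrite gE2E gaE !lbrE XZ JZ JT; lmod.
- by rewrite gE1E gbE !lbrE XZ JZ JT; lmod.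
- by rewrite gaE !lbrE BZ BT Y2T h14; lmod.
- by rewrite gaE !lbrE BZ BT Y2T h14; lmod.
- by rewrite gbE !lbrE BZ BT Y2T h14; lmod.
- by rewrite gbE !lbrE BZ BT Y2T h14; lmod.
- by rewrite gaE !lbrE ZW TW; lmod.
- by rewrite gbE !lbrE ZW TW; lmod.
- rewrite /= !ead !lbrZr; have : {[X, {[X, {[X, {[X, {[X, {[X, Z1]}]}]}]}]}]} = 0 := h13.
  by move=> ->; rewrite scaler0.
- rewrite gaE !lbrE; apply: (lincomb2 (c := (2%:R * t ^+ 2)^-1)
    (c' := (2%:R * t ^+ 2)^-1) h21' h21B).
  by lmod.
- rewrite gbE !lbrE; apply: (lincomb2 (c := - (2%:R * t ^+ 2)^-1)
    (c' := (2%:R * t ^+ 2)^-1) h21' h21B).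
  by lmod.
- by rewrite !lbrE; apply: (lincomb1 (c := t ^- 2) h22'); lmod.
Qed.

End FromRelations.
End Presentation.

(** * Consequences of the relations quadratic in Z *)

Section Sl12Theory.
Variables (K : numFieldType) (L : lieSuperType K).

Lemma odd_sq_ad (x y : L) : lpar true x -> {[x, x]} = 0 -> {[x, {[x, y]}]} = 0.
Proof.
move=> px xx; have h := jacoo y px px; rewrite xx lbr0l in h.
by apply: (lincomb1 (c := 2%:R^-1) h); lmod.
Qed.

Variables (E1 E2 F1 F2 : L).
Hypothesis S : sl12 E1 E2 F1 F2.
Let pE1 := oE1 S. Let pE2 := oE2 S. Let pF1 := oF1 S. Let pF2 := oF2 S.

Local Notation Q := {[E1, F1]}.
Local Notation R := {[E2, F2]}.
Local Notation e := {[E1, E2]}.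
Local Notation Y := {[F1, F2]}.

Lemma F1E1 : {[F1, E1]} = Q. Proof. exact: brCo pF1 pE1. Qed.
Lemma F2E2 : {[F2, E2]} = R. Proof. exact: brCo pF2 pE2. Qed.
Lemma F2E1 : {[F2, E1]} = 0. Proof. by rewrite (brCo pF2 pE1) (E1F2 S). Qed.
Lemma F1E2 : {[F1, E2]} = 0. Proof. by rewrite (brCo pF1 pE2) (E2F1 S). Qed.
Lemma pQ : lpar false Q. Proof. by par. Qed.
Lemma pe : lpar false e. Proof. by par. Qed.
Lemma pYF : lpar false Y. Proof. by par. Qed.

Lemma QE1 : {[Q, E1]} = 0.
Proof. by rewrite (brCe pQ pE1) odd_sq_ad ?oppr0 // (E1E1 S). Qed.
Lemma QF1 : {[Q, F1]} = 0.
Proof. by rewrite -F1E1 (@brCe _ _ true) -?F1E1 ?odd_sq_ad ?oppr0 ?(F1F1 S) //; par. Qed.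

Lemma adE1e x : {[E1, {[e, x]}]} = {[e, {[E1, x]}]}.
Proof. by rewrite (jacoe _ pE1 pe) odd_sq_ad ?(E1E1 S) ?lbr0l ?add0r. Qed.

Lemma adF1e x : {[F1, {[e, x]}]} = {[E2, x]} + {[e, {[F1, x]}]}.
Proof.
by rewrite (jacoe _ pF1 pe) (jacoo _ pF1 pE1) F1E1 F1E2 (QE2 S) lbr0r subr0.
Qed.

Lemma ade x : {[e, x]} = {[E1, {[E2, x]}]} + {[E2, {[E1, x]}]}.
Proof. by have h := jacoo x pE1 pE2; apply: (lincomb1 (c := -1) h); lmod. Qed.

Let pR : lpar false R. Proof. by par. Qed.

Lemma adY x : {[Y, x]} = {[F1, {[F2, x]}]} + {[F2, {[F1, x]}]}.
Proof. by have h := jacoo x pF1 pF2; apply: (lincomb1 (c := -1) h); lmod. Qed.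

Lemma YE1 : {[Y, E1]} = F2.
Proof. by rewrite adY F2E1 F1E1 lbr0r add0r (brCe' pF2 pQ) (QF2 S) opprK. Qed.

Lemma YE2 : {[Y, E2]} = F1.
Proof. by rewrite adY F1E2 F2E2 lbr0r addr0 (brCe' pF1 pR) (RF1 S) opprK. Qed.

Lemma YF1 : {[Y, F1]} = 0.
Proof. by rewrite adY (F1F1 S) (brCo pF2 pF1) (odd_sq_ad F2 pF1 (F1F1 S)) lbr0r addr0. Qed.

Lemma YF2 : {[Y, F2]} = 0.
Proof.
by rewrite adY (F2F2 S) lbr0r add0r (brCo pF1 pF2) (odd_sq_ad F1 pF2 (F2F2 S)).
Qed.

Lemma Ye : {[Y, e]} = Q + R.
Proof. by rewrite (jace _ pYF pE1) YE1 YE2 F2E2 addrC. Qed.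

Lemma eE1 : {[e, E1]} = 0.
Proof. by rewrite (brCe pe pE1) (odd_sq_ad E2 pE1 (E1E1 S)) oppr0. Qed.

Lemma eE2 : {[e, E2]} = 0.
Proof. by rewrite (brCe pe pE2) (brCo pE1 pE2) (odd_sq_ad E1 pE2 (E2E2 S)) oppr0. Qed.

Lemma eF1 : {[e, F1]} = - E2.
Proof. by rewrite (brCe pe pF1) (jacoo _ pF1 pE1) F1E1 F1E2 (QE2 S) lbr0r subr0. Qed.

Lemma eF2 : {[e, F2]} = - E1.
Proof.
by rewrite (brCe pe pF2) (jacoo _ pF2 pE1) F2E1 F2E2 lbr0l sub0r opprK (brCe' pE1 pR) (RE1 S).
Qed.
End Sl12Theory.

Section Level1Theory.
Variables (K : numFieldType) (L : lieSuperType K).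

(** The element [{[E1, a]} - {[E2, b]}] changes sign under the exchange. It occurs linearly in [A1]
    and [A2] and quadratically on the left of [A3], hence [mu] changes sign and [kap] does not. *)
Lemma level1_swap mu kap (E1 E2 F1 F2 a b : L) : sl12 E1 E2 F1 F2 ->
  level1 mu kap E1 E2 F1 F2 a b -> level1 (- mu) kap E2 E1 F2 F1 b a.
Proof.
move=> S V; have Ee : {[E2, E1]} = {[E1, E2]} := brCo (oE2 S) (oE1 S).
have gN : {[E2, b]} - {[E1, a]} = - ({[E1, a]} - {[E2, b]}) by rewrite opprB.
have FC : {[F2, F1]} = {[F1, F2]} := brCo (oF2 S) (oF1 S).
case: V => pa pb F1a F2b F2a E2a E1b Qa Ra Qb Rb aw bw e3 A1 A2 A3.
split; rewrite ?Ee ?gN ?FC ?F2a //.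
- by move: e3; rewrite /= !lbrNr => ->; rewrite oppr0.
- by rewrite !lbrE; apply: (lincomb1 (c := -1) A2); rewrite !lbrE; lmod.
- by rewrite !lbrE; apply: (lincomb1 (c := -1) A1); rewrite !lbrE; lmod.
- by rewrite lbrNl !lbrNr opprK A3; lmod.
Qed.

Section Half.
Variables (mu kap : K) (E1 E2 F1 F2 a b : L).
Hypotheses (S : sl12 E1 E2 F1 F2) (V : level1 mu kap E1 E2 F1 F2 a b).
Let pE1 := oE1 S. Let pE2 := oE2 S. Let pF1 := oF1 S. Let pF2 := oF2 S.
Let pa := oa V. Let pb := ob V.

Local Notation R := {[E2, F2]}.
Local Notation e := {[E1, E2]}.
Local Notation w := {[F1, b]}.
Local Notation al := {[E1, a]}.
Local Notation be := {[E2, b]}.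

Lemma E1w : {[E1, w]} = - (2%:R *: b).
Proof. by rewrite (jacoo _ pE1 pF1) (E1b V) lbr0r subr0 (Qb V). Qed.
Lemma E2w : {[E2, w]} = - (2%:R *: a).
Proof. by rewrite -(F2a V) (jacoo _ pE2 pF2) (E2a V) lbr0r subr0 (Ra V). Qed.
Lemma F1w : {[F1, w]} = 0. Proof. exact: odd_sq_ad pF1 (F1F1 S). Qed.
Lemma F2w : {[F2, w]} = 0. Proof. rewrite -(F2a V); exact: odd_sq_ad pF2 (F2F2 S). Qed.
Lemma F1al : {[F1, al]} = - a.
Proof. by rewrite (jacoo _ pF1 pE1) (F1a V) lbr0r subr0 (F1E1 S) (Qa V). Qed.
Lemma F1be : {[F1, be]} = 2%:R *: a.
Proof. by rewrite (jacoo _ pF1 pE2) (F1E2 S) lbr0l E2w; lmod. Qed.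
Lemma F2al : {[F2, al]} = 2%:R *: b.
Proof. by rewrite (jacoo _ pF2 pE1) (F2E1 S) lbr0l (F2a V) E1w; lmod. Qed.
Lemma F2be : {[F2, be]} = - b.
Proof. by rewrite (jacoo _ pF2 pE2) (F2b V) lbr0r subr0 (F2E2 S) (Rb V). Qed.
Lemma E1al : {[E1, al]} = 0. Proof. exact: odd_sq_ad pE1 (E1E1 S). Qed.
Lemma E2be : {[E2, be]} = 0. Proof. exact: odd_sq_ad pE2 (E2E2 S). Qed.
Lemma E2al : {[E2, al]} = {[e, a]}.
Proof. by rewrite (ade S) (E2a V) lbr0r add0r. Qed.
Lemma E1be : {[E1, be]} = {[e, b]}.
Proof. by rewrite (ade S) (E1b V) lbr0r addr0. Qed.
Lemma ew : {[e, w]} = - (2%:R *: al) - 2%:R *: be.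
Proof. by rewrite (ade S) E1w E2w !lbrE; lmod. Qed.

Let pal : lpar false al. Proof. by par. Qed.
Let pea : lpar true {[e, a]}. Proof. by par. Qed.
Let Sw := sl12_swap S.

(** The chain from here to [ealw] starts with [aw]; each member is [aw] or an earlier member
    bracketed with [E1] or [E2]. *)
Lemma alw : {[al, w]} = - (2%:R *: {[a, b]}).
Proof.
have h := congr1 (lbr E1) (aw V); rewrite (jacoo _ pE1 pa) E1w lbr0r !lbrE in h.
by apply: (lincomb1 (c := 1) h); lmod.
Qed.

Lemma aa : {[a, a]} = 0.
Proof.
have h := congr1 (lbr E2) (aw V); rewrite (jacoo _ pE2 pa) E2w (E2a V) !lbrE in h.
by apply: (lincomb1 (c := 2%:R^-1) h); lmod.
Qed.

Lemma aal : {[a, al]} = 0.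
Proof.
have h := congr1 (lbr E1) aa; rewrite (jacoo _ pE1 pa) (brCe pal pa) lbr0r in h.
by apply: (lincomb1 (c := - 2%:R^-1) h); lmod.
Qed.

Lemma aea : {[a, {[e, a]}]} = 0.
Proof.
have h := congr1 (lbr E2) aal; rewrite (jacoo _ pE2 pa) E2al (E2a V) !lbrE in h.
by apply: (lincomb1 (c := - 1) h); lmod.
Qed.

Lemma alea : {[al, {[e, a]}]} = {[a, {[e, al]}]}.
Proof.
have h := congr1 (lbr E1) aea; rewrite (jacoo _ pE1 pa) (adE1e S) !lbrE in h.
by apply: (lincomb1 (c := 1) h); lmod.
Qed.

Lemma eaw : {[{[e, a]}, w]} = 2%:R *: {[a, be]}.
Proof.
have h := congr1 (lbr E2) alw; rewrite (jacoe _ pE2 pal) E2al E2w !lbrE in h.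
rewrite (jacoo _ pE2 pa) (E2a V) (brCe pal pa) aal !lbrE in h.
by apply: (lincomb1 (c := 1) h); lmod.
Qed.

Lemma ealw : {[{[e, al]}, w]} =
  2%:R *: {[al, be]} - 2%:R *: {[a, {[e, b]}]} - 2%:R *: {[b, {[e, a]}]}.
Proof.
have h := congr1 (lbr E1) eaw; rewrite (jacoo _ pE1 pea) (adE1e S) E1w !lbrE in h.
rewrite (jacoo _ pE1 pa) E1be (brCo pea pb) in h.
by apply: (lincomb1 (c := 1) h); lmod.
Qed.
End Half.

Section Level2.
Variables (mu kap : K) (E1 E2 F1 F2 a b : L).
Hypotheses (S : sl12 E1 E2 F1 F2) (V : level1 mu kap E1 E2 F1 F2 a b).
Let pE1 := oE1 S. Let pE2 := oE2 S. Let pF1 := oF1 S. Let pF2 := oF2 S.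
Let pa := oa V. Let pb := ob V.
Local Notation e := {[E1, E2]}.
Local Notation w := {[F1, b]}.
Local Notation al := {[E1, a]}.
Local Notation be := {[E2, b]}.
Let pw : lpar false w. Proof. by par. Qed.
Let pal : lpar false al. Proof. by par. Qed.
Let pbe : lpar false be. Proof. by par. Qed.
Let pea : lpar true {[e, a]}. Proof. by par. Qed.
Let peb : lpar true {[e, b]}. Proof. by par. Qed.
Let peal : lpar false {[e, al]}. Proof. by par. Qed.
Let pebe : lpar false {[e, be]}. Proof. by par. Qed.
Let Sw := sl12_swap S.
Let Vw := level1_swap S V.
Let Ee : {[E2, E1]} = e. Proof. exact: brCo. Qed.
Let adE2e x : {[E2, {[e, x]}]} = {[e, {[E2, x]}]}.
Proof. by rewrite -Ee (adE1e Sw). Qed.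
Let adF2e x : {[F2, {[e, x]}]} = {[E1, x]} + {[e, {[F2, x]}]}.
Proof. by rewrite -Ee (adF1e Sw). Qed.
Let alea' := alea S V.
Let ealw' := ealw S V.
Let ebew : {[{[e, be]}, w]} =
  2%:R *: {[be, al]} - 2%:R *: {[b, {[e, a]}]} - 2%:R *: {[a, {[e, b]}]}.
Proof. by have := ealw Sw Vw; rewrite Ee (F2a V). Qed.

(** The terms pairing [a] with [{[e, b]}] and [b] with [{[e, a]}] are invariant under the exchange
    of indices, so they cancel. *)
Lemma egw : {[{[e, al]}, w]} - {[{[e, be]}, w]} = 4%:R *: {[al, be]}.
Proof. by rewrite ealw' ebew (brCe pbe pal); lmod. Qed.

(** This is [A1] bracketed with [F2]; [egw] eliminates the brackets of [w] with [{[e, al]}] and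
    [{[e, be]}]. *)
Let star : {[b, {[e, a]}]} - {[a, {[e, b]}]} = 3%:R *: {[al, be]} + mu *: w.
Proof.
have := congr1 (lbr F2) (A1 V).
rewrite !lbrE (jacoo _ pF2 pa) (jacoo _ pF2 pa) (jacoe _ pF2 pal) (jacoe _ pF2 pbe).
rewrite !adF2e (F2al S V) (F2be S V) (F2a V) (ew S V) (E1al _ S) (E1be S V) !lbrE.
rewrite (brCe pw peal) (brCe pw pebe) (brCe pbe pal).
have alal : {[al, al]} = 0.
  by have h := brCe pal pal; apply: (lincomb1 (c := 2%:R^-1) h); lmod.
have bebe : {[be, be]} = 0.
  by have h := brCe pbe pbe; apply: (lincomb1 (c := 2%:R^-1) h); lmod.
rewrite alal bebe => h.
by apply: (lincomb2 (c := 6%:R^-1) (c' := 2%:R^-1) h egw); lmod.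
Qed.

(** Between [A1] and [star] bracketed with [E2], both the term in [mu] and [{[a, {[e, be]}]}] can be
    eliminated at once. *)
Lemma aeal : {[a, {[e, al]}]} = - (2%:R *: {[be, {[e, a]}]}).
Proof.
have := congr1 (lbr E2) star.
rewrite !lbrE (jacoo _ pE2 pb) (jacoo _ pE2 pa) (jacoe _ pE2 pal).
rewrite !adE2e (E2a V) (E2al S V) (E2be _ S) (E2w S V) !lbrE (brCe' pea pbe) => h.
have := A1 V; rewrite !lbrE alea' => h2.
by apply: (lincomb2 (c := 5%:R^-1) (c' := 3%:R / 5%:R) h2 h); lmod.
Qed.

Lemma aleal : {[al, {[e, al]}]} =
  - (2%:R *: ({[{[e, a]}, {[e, b]}]} + {[be, {[e, al]}]})).
Proof.
have := congr1 (lbr E1) aeal.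
rewrite !lbrE (jacoo _ pE1 pa) (jacoe _ pE1 pbe) !(adE1e S) (E1al _ S) (E1be S V) !lbrE.
by rewrite (brCo peb pea) => h; apply: (lincomb1 (c := 1) h); lmod.
Qed.
End Level2.

Section Commute.
Variables (mu kap : K) (E1 E2 F1 F2 a b : L).
Hypotheses (S : sl12 E1 E2 F1 F2) (V : level1 mu kap E1 E2 F1 F2 a b).
Let pE1 := oE1 S. Let pE2 := oE2 S. Let pF1 := oF1 S. Let pa := oa V. Let pb := ob V.
Local Notation e := {[E1, E2]}.
Local Notation w := {[F1, b]}.
Local Notation al := {[E1, a]}.
Local Notation be := {[E2, b]}.
Let pe : lpar false e. Proof. by par. Qed.
Let pal : lpar false al. Proof. by par. Qed.
Let pbe : lpar false be. Proof. by par. Qed.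
Let pea : lpar true {[e, a]}. Proof. by par. Qed.
Let peb : lpar true {[e, b]}. Proof. by par. Qed.
Let peal : lpar false {[e, al]}. Proof. by par. Qed.
Let pebe : lpar false {[e, be]}. Proof. by par. Qed.
Let Sw := sl12_swap S.
Let Vw := level1_swap S V.
Let Ee : {[E2, E1]} = e. Proof. exact: brCo. Qed.

(* Apply [ad e] twice to [egw], using [e^3 (al - be) = 0]. *)
Lemma eal_ebe : {[{[e, al]}, {[e, be]}]} = 0.
Proof.
have pe2al : lpar false {[e, {[e, al]}]} by par.
have pe2be : lpar false {[e, {[e, be]}]} by par.
have alC := aleal S V.
have beC : {[be, {[e, be]}]} = - (2%:R *: ({[{[e, b]}, {[e, a]}]} + {[al, {[e, be]}]})).
  by have := aleal Sw Vw; rewrite Ee.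
have ewE := ew S V.
have sq (x : L) : lpar false x -> {[x, x]} = 0.
  by move=> px; have h := brCe px px; apply: (lincomb1 (c := 2%:R^-1) h); lmod.
have e3 := e3g V; rewrite /= !lbrE in e3.
have e3b : {[e, {[e, {[e, al]}]}]} = {[e, {[e, {[e, be]}]}]}.
  by apply: (lincomb1 (c := 1) e3); lmod.
have := congr1 (lbr e) beC; have := congr1 (lbr e) alC.
have := congr1 (fun x => {[e, {[e, x]}]}) (egw S V).
rewrite /= !lbrE.
rewrite !(jace _ pe pal) !(jace _ pe pbe) !(jace _ pe pea) !(jace _ pe peb).
rewrite !(jace _ pe peal) !(jace _ pe pebe) ewE !lbrE.
rewrite !(jace _ pe peal) !(jace _ pe pebe) ?(jace _ pe pe2al) ?(jace _ pe pe2be).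
rewrite ?(jace _ pe pal) ?(jace _ pe pbe) ewE !lbrE e3b !(sq _ peal) !(sq _ pebe).
rewrite !(brCe pe2al pal) !(brCe pe2al pbe) !(brCe pe2be pal) !(brCe pe2be pbe).
rewrite !(brCe pebe peal).
have pe2a : lpar true {[e, {[e, a]}]} by par.
have pe2b : lpar true {[e, {[e, b]}]} by par.
rewrite (brCo pe2b pea) (brCo peb pe2a) => h0 h1 h2.
(* [h1] and [h2] are [ad e] applied to [alC] and [beC]; in their difference the image of
   [{[{[e, a]}, {[e, b]}]}], symmetric in the two odd factors, drops out. *)
have h3 : {[al, {[e, {[e, al]}]}]} - {[be, {[e, {[e, be]}]}]} =
    4%:R *: {[{[e, al]}, {[e, be]}]}
    + 2%:R *: ({[al, {[e, {[e, be]}]}]} - {[be, {[e, {[e, al]}]}]}).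
  by apply: (lincomb2 (c := 1) (c' := -1) h1 h2); lmod.
by apply: (lincomb2 (c := 4%:R^-1) (c' := -1) h0 h3); lmod.
Qed.
End Commute.
End Level1Theory.

(** * The elements r and q *)

Section Currents.
Variables (K : numFieldType) (L : lieSuperType K).

(* In the intended case [c1 = 1 - lam], [c2 = 0] and [s = 1]; the parameters make
   the conditions invariant under exchanging the indices 1 and 2. *)
Record currents (c1 c2 s : K) (E1 E2 F1 F2 r q : L) : Prop := Currents {
  cS : sl12 E1 E2 F1 F2;
  pr : lpar false r; pq : lpar false q;
  rE2 : {[r, E2]} = 0; rF2 : {[r, F2]} = 0; qE1 : {[q, E1]} = 0; qF1 : {[q, F1]} = 0;
  rQ : {[r, {[E1, F1]}]} = 0; qR : {[q, {[E2, F2]}]} = 0; rq : {[r, q]} = 0;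
  Q1 : {[{[r, E1]}, F1]} = 2%:R *: q + c1 *: {[E1, F1]};
  R1 : {[{[q, E2]}, F2]} = 2%:R *: r + c2 *: {[E2, F2]};
  s2 : s ^+ 2 = 1;
  DDY : {[q - r, {[q - r, {[F1, F2]}]}]} = s *: {[q - r, {[F1, F2]}]}
}.

(** [q - r] changes sign, and [s] with it. *)
Lemma currents_swap c1 c2 s E1 E2 F1 F2 r q : currents c1 c2 s E1 E2 F1 F2 r q ->
  currents c2 c1 (- s) E2 E1 F2 F1 q r.
Proof.
case=> S pr pq rE2 rF2 qE1 qF1 rQ qR rq Q1 R1 s2 D; split=> //.
- exact: sl12_swap.
- by rewrite (brCe pq pr) rq oppr0.
- by rewrite sqrrN.
- have FC : {[F2, F1]} = {[F1, F2]} := brCo (oF2 S) (oF1 S).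
  by rewrite FC -(opprB q r) !lbrNl lbrNr opprK D; lmod.
Qed.

Section FromLevel1.
Variables (lam : K) (E1 E2 F1 F2 a b : L).
Hypothesis S : sl12 E1 E2 F1 F2.
Hypothesis V : level1 (2%:R * lam + 1) (2%:R * (lam - 1) * (lam + 2%:R)) E1 E2 F1 F2 a b.
Let pE1 := oE1 S. Let pE2 := oE2 S. Let pF1 := oF1 S. Let pF2 := oF2 S.
Let pa := oa V. Let pb := ob V.
Local Notation Q := {[E1, F1]}.
Local Notation R := {[E2, F2]}.
Local Notation Y := {[F1, F2]}.
Local Notation e := {[E1, E2]}.
Local Notation w := {[F1, b]}.
Local Notation al := {[E1, a]}.
Local Notation be := {[E2, b]}.
Let pe : lpar false e. Proof. by par. Qed.
Let peal : lpar false {[e, al]}. Proof. by par. Qed.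
Let pebe : lpar false {[e, be]}. Proof. by par. Qed.
Let pQ : lpar false Q. Proof. by par. Qed.
Let pR : lpar false R. Proof. by par. Qed.
Let pY : lpar false Y. Proof. by par. Qed.
Let Sw := sl12_swap S.
Let Ee : {[E2, E1]} = e. Proof. exact: brCo. Qed.
Let adE2e x : {[E2, {[e, x]}]} = {[e, {[E2, x]}]}.
Proof. by rewrite -Ee (adE1e Sw). Qed.
Let adF2e x : {[F2, {[e, x]}]} = {[E1, x]} + {[e, {[F2, x]}]}.
Proof. by rewrite -Ee (adF1e Sw). Qed.

(* On [x^n] and [x^n theta], [cr] acts as [n (n - 1) / 2] and [n (n + 1) / 2], and
   [cq] acts as [(n - lam) (n + lam - 1) / 2]. *)
Definition cr := - (6%:R^-1 *: ({[e, be]} + (2%:R * (1 - lam)) *: R)).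
Definition cq := - (6%:R^-1 *: ({[e, al]} + (4%:R * (1 - lam)) *: Q)).

Let F2ebe : {[F2, {[e, be]}]} = 0.
Proof. by rewrite adF2e (E1be S V) (F2be S V) lbrNr subrr. Qed.
Let F1eal : {[F1, {[e, al]}]} = 0.
Proof. by rewrite (adF1e S) (E2al S V) (F1al S V) lbrNr subrr. Qed.
Let F1ebe : {[F1, {[e, be]}]} = 2%:R *: {[e, a]}.
Proof. by rewrite (adF1e S) (E2be _ S) (F1be S V) lbrZr add0r. Qed.
Let F2eal : {[F2, {[e, al]}]} = 2%:R *: {[e, b]}.
Proof. by rewrite adF2e (E1al _ S) (F2al S V) lbrZr add0r. Qed.
Let E1ebe : {[E1, {[e, be]}]} = {[e, {[e, b]}]}.
Proof. by rewrite (adE1e S) (E1be S V). Qed.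
Let E2eal : {[E2, {[e, al]}]} = {[e, {[e, a]}]}.
Proof. by rewrite adE2e (E2al S V). Qed.
Let Qal : {[Q, al]} = - al.
Proof. by rewrite (jace _ pQ pE1) (QE1 S) (Qa V) lbr0l lbrNr add0r. Qed.
Let Ral : {[R, al]} = - al.
Proof. by rewrite (jace _ pR pE1) (RE1 S) (Ra V) !lbrE; lmod. Qed.
Let Qbe : {[Q, be]} = - be.
Proof. by rewrite (jace _ pQ pE2) (QE2 S) (Qb V) !lbrE; lmod. Qed.
Let Rbe : {[R, be]} = - be.
Proof. by rewrite (jace _ pR pE2) (QE1 Sw) (Rb V) lbr0l lbrNr add0r. Qed.
Let Qe : {[Q, e]} = e.
Proof. by rewrite (jace _ pQ pE1) (QE1 S) (QE2 S) lbr0l add0r. Qed.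
Let Re : {[R, e]} = e.
Proof. by rewrite (jace _ pR pE1) (RE1 S) (QE1 Sw) lbr0r addr0. Qed.
Let Qebe : {[Q, {[e, be]}]} = 0.
Proof. by rewrite (jace _ pQ pe) Qe Qbe !lbrE; lmod. Qed.
Let R_eal : {[R, {[e, al]}]} = 0.
Proof. by rewrite (jace _ pR pe) Re Ral !lbrE; lmod. Qed.
Let QR : {[Q, R]} = 0.
Proof. by rewrite (jace _ pQ pE2) (QE2 S) (QF2 S) lbrNr subrr. Qed.
Let RF2 : {[R, F2]} = 0. Proof. exact: QF1 Sw. Qed.
Let RE2 : {[R, E2]} = 0. Proof. exact: QE1 Sw. Qed.

Let Yeal : {[Y, {[e, al]}]} = - (4%:R *: al) - 2%:R *: be.
Proof. by rewrite (adY S) F1eal F2eal !lbrE (adF1e S) (ew S V); lmod. Qed.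
Let Yebe : {[Y, {[e, be]}]} = - (2%:R *: al) - 4%:R *: be.
Proof. by rewrite (adY S) F2ebe F1ebe !lbrE adF2e (F2a V) (ew S V); lmod. Qed.
Let QY : {[Q, Y]} = - Y.
Proof. by rewrite (jace _ pQ pF1) (QF1 S) (QF2 S) lbr0l lbrNr add0r. Qed.
Let RY : {[R, Y]} = - Y.
Proof. by rewrite (jace _ pR pF1) (RF1 S) RF2 lbr0r lbrNl addr0. Qed.

Let rF1 : {[cr, F1]} = 3%:R^-1 *: ({[e, a]} + (1 - lam) *: F1).
Proof. by rewrite /cr !lbrE (brCe pebe pF1) F1ebe (RF1 S); lmod. Qed.
Let qF2 : {[cq, F2]} = 3%:R^-1 *: ({[e, b]} + (2%:R * (1 - lam)) *: F2).
Proof. by rewrite /cq !lbrE (brCe peal pF2) F2eal (QF2 S); lmod. Qed.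

Lemma Ya : {[Y, a]} = 0.
Proof. by rewrite (adY S) (F1a V) (F2a V) (F1w _ S) lbr0r addr0. Qed.
Lemma Yb : {[Y, b]} = 0.
Proof. by rewrite (adY S) (F2b V) (F2w S V) lbr0r addr0. Qed.

(** Together with [b_of_currents], this lets [{[cr, F1]}] and [{[cq, F2]}] replace [a] and [b] among
    the generators. *)
Lemma a_of_currents : a = - {[Y, {[cr, F1]}]}.
Proof.
by rewrite rF1 !lbrE (jace _ pY pe) (Ye S) Ya (YF1 S) !lbrE (Qa V) (Ra V); lmod.
Qed.

Lemma b_of_currents : b = - {[Y, {[cq, F2]}]}.
Proof.
by rewrite qF2 !lbrE (jace _ pY pe) (Ye S) Yb (YF2 S) !lbrE (Qb V) (Rb V); lmod.
Qed.

Lemma currents_of_level1 : currents (1 - lam) 0 1 E1 E2 F1 F2 cr cq.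
Proof.
have pcr : lpar false cr by rewrite /cr; par.
have pcq : lpar false cq by rewrite /cq; par.
have dY : {[cq - cr, Y]} = - (3%:R^-1 *: (al - be - (1 - lam) *: Y)).
  rewrite /cr /cq !lbrE (brCe peal pY) (brCe pebe pY) Yeal Yebe QY RY; lmod.
split=> //.
- by rewrite /cr !lbrE (brCe pebe pE2) adE2e (E2be _ S) RE2 !lbrE; lmod.
- by rewrite /cr !lbrE (brCe pebe pF2) F2ebe RF2; lmod.
- by rewrite /cq !lbrE (brCe peal pE1) (adE1e S) (E1al _ S) (QE1 S) !lbrE; lmod.
- by rewrite /cq !lbrE (brCe peal pF1) F1eal (QF1 S); lmod.
- by rewrite (brCe pcr pQ) /cr !lbrE Qebe QR; lmod.
- by rewrite (brCe pcq pR) /cq !lbrE R_eal (brCe pR pQ) QR; lmod.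
- rewrite /cr /cq !lbrE (brCe pebe peal) (eal_ebe S V) (brCe pebe pQ) Qebe R_eal.
  by rewrite (brCe pR pQ) QR; lmod.
- have -> : {[cr, E1]} = 6%:R^-1 *: ({[e, {[e, b]}]} - (2%:R * (1 - lam)) *: E1).
    by rewrite /cr !lbrE (brCe pebe pE1) E1ebe (RE1 S); lmod.
  rewrite !lbrE (brCo _ pF1); last by par.
  by rewrite !(adF1e S) !adE2e (ew S V) /cq !lbrE; lmod.
- have -> : {[cq, E2]} = 6%:R^-1 *: ({[e, {[e, a]}]} - (4%:R * (1 - lam)) *: E2).
    by rewrite /cq !lbrE (brCe peal pE2) E2eal (QE2 S); lmod.
  rewrite !lbrE (brCo _ pF2); last by par.
  by rewrite !adF2e !(adE1e S) (F2a V) (ew S V) /cr !lbrE; lmod.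
- by rewrite expr1n.
(* Written through [g], the double bracket with [q - r] needs only [A3] as quadratic input. The
   coefficients of [g] and [Y] match because [2 mu + 4 (1 - lam) = 6] and
   [2 (1 - lam)^2 - kap = 6 (1 - lam)]. *)
- have [g gE] : {g | g = al - be} by exists (al - be).
  have pg : lpar false g by rewrite gE; par.
  have peg : lpar false {[e, g]} by par.
  have dE : cq - cr = - (6%:R^-1 *: ({[e, g]} + (1 - lam) *: (4%:R *: Q - 2%:R *: R))).
    by rewrite /cq /cr gE !lbrE; lmod.
  have gg := A3 V; rewrite -gE in gg.
  have Qg : {[Q, g]} = - g by rewrite gE !lbrE Qal Qbe; lmod.
  have Rg : {[R, g]} = - g by rewrite gE !lbrE Ral Rbe; lmod.
  have egY : {[{[e, g]}, Y]} = 2%:R *: g.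
    by rewrite (brCe peg pY) gE !lbrE Yeal Yebe; lmod.
  rewrite dY dE -gE !lbrE (brCe peg pg) gg egY Qg Rg QY RY.
  by lmod.
Qed.
End FromLevel1.
End Currents.

(** * Brackets of weight zero *)

Section PolynomialAction.
Variables (K : numFieldType) (L : lieSuperType K).
Implicit Types (u v x y : L) (f g : {poly K}).

Lemma lbr_sumr I (s : seq I) (P : pred I) (F : I -> L) u :
  {[u, \sum_(i <- s | P i) F i]} = \sum_(i <- s | P i) {[u, F i]}.
Proof. exact: (big_morph (lbr u) (lbrDr u) (lbr0r u)). Qed.

Lemma lbr_suml I (s : seq I) (P : pred I) (F : I -> L) u :
  {[\sum_(i <- s | P i) F i, u]} = \sum_(i <- s | P i) {[F i, u]}.
Proof. exact: (big_morph (lbr^~ u) (fun x y => lbrDl x y u) (lbr0l u)). Qed.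

Definition ad u i x : L := iter i (lbr u) x.
(** This is [f(ad u)] applied to [x]. In the intended case [pact r f E1] is [E1] multiplied by the
    function [f(n)]. *)
Definition pact u f x : L := \sum_(i < size f) f`_i *: ad u i x.

Lemma adS u i x : ad u i.+1 x = {[u, ad u i x]}. Proof. by []. Qed.
Lemma adSr u i x : ad u i.+1 x = ad u i {[u, x]}. Proof. exact: iterSr. Qed.

Lemma pactE n u f x : (size f <= n)%N ->
  pact u f x = \sum_(i < n) f`_i *: ad u i x.
Proof.
move=> le_n; rewrite /pact (big_ord_widen n (fun i => f`_i *: ad u i x) le_n).
rewrite big_mkcond; apply: eq_bigr => i _; case: ltnP => // le_i.
by rewrite nth_default ?scale0r.
Qed.

Lemma pact0 u x : pact u 0 x = 0.
Proof. by rewrite /pact size_poly0 big_ord0. Qed.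

Lemma pactD u f g x : pact u (f + g) x = pact u f x + pact u g x.
Proof.
set n := maxn (size f) (size g).
rewrite (@pactE n _ (f + g)) ?size_polyD // !(@pactE n) ?leq_maxl ?leq_maxr //.
by rewrite -big_split; apply: eq_bigr => i _; rewrite coefD scalerDl.
Qed.

Lemma pactZ u c f x : pact u (c *: f) x = c *: pact u f x.
Proof.
rewrite (@pactE (size f)) ?size_scale_leq // scaler_sumr.
by apply: eq_bigr => i _; rewrite coefZ scalerA.
Qed.

Lemma pactN u f x : pact u (- f) x = - pact u f x.
Proof. by rewrite -scaleN1r pactZ scaleN1r. Qed.

Lemma pactXM u f x : pact u ('X * f) x = {[u, pact u f x]}.
Proof.
rewrite (@pactE (size f).+1) ?lbr_sumr; last first.
  by rewrite mulrC (leq_trans (size_polyMleq _ _)) // size_polyX addn2.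
rewrite big_ord_recl coefXM scale0r add0r; apply: eq_bigr => i _.
by rewrite coefXM lbrZr.
Qed.

Lemma pactXn u i x : pact u 'X^i x = ad u i x.
Proof.
rewrite (@pactE i.+1) ?size_polyXn // big_ord_recr /= coefXn eqxx scale1r.
rewrite big1 ?add0r // => j _.
by rewrite coefXn ltn_eqF ?scale0r ?ltn_ord.
Qed.

Lemma lbr_ad p u v i x : lpar false u -> lpar p v -> {[u, v]} = 0 ->
  {[v, ad u i x]} = ad u i {[v, x]}.
Proof.
move=> pu pv uv; elim: i => //= i IH; rewrite -IH (jace _ pu pv) uv lbr0l.
by rewrite add0r.
Qed.

Lemma lbr_pact p u v f x : lpar false u -> lpar p v -> {[u, v]} = 0 ->
  {[v, pact u f x]} = pact u f {[v, x]}.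
Proof.
move=> pu pv uv; rewrite lbr_sumr; apply: eq_bigr => i _.
by rewrite lbrZr (lbr_ad _ _ pu pv uv).
Qed.

Lemma adE u i c x : ad u i (c *: x) = c *: ad u i x.
Proof. by elim: i => //= i ->; rewrite lbrZr. Qed.
Lemma adN u i x : ad u i (- x) = - ad u i x.
Proof. by elim: i => //= i ->; rewrite lbrNr. Qed.
Lemma adD u i x y : ad u i (x + y) = ad u i x + ad u i y.
Proof. by elim: i => //= i ->; rewrite lbrDr. Qed.
Lemma ad0 u i : ad u i 0 = 0.
Proof. by elim: i => //= i ->; rewrite lbr0r. Qed.
Lemma adadD u i j x : ad u i (ad u j x) = ad u (i + j) x.
Proof. by rewrite /ad iterD. Qed.

Lemma pact_x0 u f : pact u f 0 = 0.
Proof. by rewrite /pact big1 // => i _; rewrite ad0 scaler0. Qed.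
Lemma pact_xN u f x : pact u f (- x) = - pact u f x.
Proof. by rewrite /pact -sumrN; apply: eq_bigr => i _; rewrite adN scalerN. Qed.

Lemma lpar_ad p u i x : lpar false u -> lpar p x -> lpar p (ad u i x).
Proof. by move=> pu px; elim: i => //= i IH; apply: (lpar_br' pu IH). Qed.

Lemma lpar_pact p u f x : lpar false u -> lpar p x -> lpar p (pact u f x).
Proof.
move=> pu px; rewrite /pact; elim/big_rec: _ => [|i y _ py]; first exact: lpar0.
by apply: lparD => //; apply: lparZ; apply: lpar_ad.
Qed.
End PolynomialAction.

(** * Trading [ad q] for [ad r]: brackets of weight-zero elements with [F1] *)

Section Shift.
Variables (K : numFieldType) (L : lieSuperType K).

(* [divd s k] is [('X^k - ('X - s)^k)] when [s ^+ 2 = 1]. *)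
Fixpoint divd (s : K) (k : nat) : {poly K} :=
  if k is k'.+1 then 'X * divd s k' + s *: ('X^k' - divd s k') else 0.

(** For [c = 0] and [s = 1] the value at n is [(n+1) n^k - n (n-1)^k]: the difference of the
    eigenvalues of [cartan E2 F2 q k] on x^n theta and on x^n, which is why it governs the brackets
    with [E1] and [F1]. *)
Definition eps (c s : K) (k : nat) : {poly K} := 'X^k + s *: (('X + c%:P) * divd s k).

Lemma size_divd s k : (size (divd s k) <= k)%N.
Proof.
elim: k => [|k IH]; first by rewrite size_poly0.
rewrite /= (leq_trans (size_polyD _ _)) // geq_max; apply/andP; split.
  by rewrite mulrC (leq_trans (size_polyMleq _ _)) // size_polyX addn2.
rewrite (leq_trans (size_scale_leq _ _)) // (leq_trans (size_polyD _ _)) //.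
by rewrite size_polyN geq_max size_polyXn leqnn (leq_trans IH).
Qed.

Lemma divd_lead s k : (divd s k.+1)`_k = s * k.+1%:R.
Proof.
elim: k => [|k IH].
  by rewrite /= mulr0 add0r subr0 coefZ expr0 coef1.
rewrite -[divd s k.+2]/('X * divd s k.+1 + s *: ('X^(k.+1) - divd s k.+1)).
rewrite coefD coefXM /= IH coefZ coefB coefXn eqxx.
by rewrite (nth_default _ (size_divd s k.+1)) subr0 -mulrDr natr1.
Qed.

Lemma size_eps c s k : (size (eps c s k) <= k.+1)%N.
Proof.
rewrite (leq_trans (size_polyD _ _)) // geq_max size_polyXn leqnn /=.
rewrite (leq_trans (size_scale_leq _ _)) // (leq_trans (size_polyMleq _ _)) //.
by rewrite size_XaddC add2n ltnS size_divd.
Qed.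

(** Source of the factor [k.+1] in [half_step]; it is the same for both index choices. *)
Lemma eps_lead c s k : s ^+ 2 = 1 -> (eps c s k)`_k = k.+1%:R.
Proof.
move=> s2; rewrite coefD coefXn eqxx coefZ mulrDl coefD coefXM coefCM.
rewrite (nth_default _ (size_divd s k)) mulr0 addr0.
case: k => [|k] /=; first by rewrite mulr0 addr0.
by rewrite divd_lead mulrA -expr2 s2 mul1r addrC natr1.
Qed.

Variables (c1 c2 s : K) (E1 E2 F1 F2 r q : L).
Hypothesis C : currents c1 c2 s E1 E2 F1 F2 r q.
Let S := cS C.
Let pE1 := oE1 S. Let pE2 := oE2 S. Let pF1 := oF1 S. Let pF2 := oF2 S.
Let pr' := pr C. Let pq' := pq C.
Local Notation Q := {[E1, F1]}.
Local Notation R := {[E2, F2]}.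
Local Notation Y := {[F1, F2]}.
Let pQ : lpar false Q. Proof. by par. Qed.
Let pR : lpar false R. Proof. by par. Qed.
Let Sw := sl12_swap S.
Let prN : lpar false (- r). Proof. exact: lparN. Qed.
Let pqN : lpar false (- q). Proof. exact: lparN. Qed.

(** Outside the section [E2 F2 q] become arguments, so that [cartan E1 F1 r k] denotes the mirror
    element. *)
Definition cartan k := {[E2, ad (- q) k F2]}.

Lemma lpar_cartan k : lpar false (cartan k).
Proof. by rewrite /cartan; have h := lpar_ad k pqN pF2; par. Qed.

Let rR : {[r, R]} = 0.
Proof. by rewrite (jace _ pr' pE2) (rE2 C) (rF2 C) lbr0l lbr0r addr0. Qed.
Let qQ : {[q, Q]} = 0.
Proof. by rewrite (jace _ pq' pE1) (qE1 C) (qF1 C) lbr0l lbr0r addr0. Qed.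

Let commQq : {[- q, Q]} = 0. Proof. by rewrite lbrNl qQ oppr0. Qed.
Let commRq : {[- q, R]} = 0. Proof. by rewrite lbrNl (qR C) oppr0. Qed.
Let commRr : {[- r, R]} = 0. Proof. by rewrite lbrNl rR oppr0. Qed.
Let commqF1 : {[- q, F1]} = 0. Proof. by rewrite lbrNl (qF1 C) oppr0. Qed.
Let commrE2 : {[- r, E2]} = 0. Proof. by rewrite lbrNl (rE2 C) oppr0. Qed.
Let commrF2 : {[- r, F2]} = 0. Proof. by rewrite lbrNl (rF2 C) oppr0. Qed.
Let commrq : {[- r, - q]} = 0. Proof. by rewrite lbrNl lbrNr (rq C) !oppr0. Qed.

Lemma F2_pact f : {[F2, pact (- r) f F1]} = pact (- r) f Y.
Proof. by rewrite (lbr_pact _ _ prN pF2 commrF2) (brCo pF2 pF1). Qed.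

(** With [d = q - r], [- q = - r - d], where [ad d] commutes with [ad r], and by [DDY] the operator
    [s ad d] is idempotent on the orbit of [Y]. Hence [(X - d)^k] collapses to
    [X^k - s d (X^k - (X - s)^k)]. *)
Lemma Y_shift k : ad (- q) k Y =
  ad (- r) k Y - s *: {[q - r, pact (- r) (divd s k) Y]}.
Proof.
have pd : lpar false (q - r) by par.
have commd : {[- r, q - r]} = 0.
  rewrite lbrDr !lbrNl lbrNr (rq C).
  have -> : {[r, r]} = 0.
    by have h := brCe pr' pr'; apply: (lincomb1 (c := 2%:R^-1) h); lmod.
  by rewrite !oppr0 addr0.
have DD f : {[q - r, {[q - r, pact (- r) f Y]}]} = s *: {[q - r, pact (- r) f Y]}.
  rewrite !(lbr_pact _ _ prN pd commd) (DDY C).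
  by rewrite /pact scaler_sumr; apply: eq_bigr => i _; rewrite adE !scalerA mulrC.
have ss := s2 C.
have sK (x : L) : s *: (s *: x) = x by rewrite scalerA -expr2 ss scale1r.
elim: k => [|k IH]; first by rewrite /= pact0 lbr0r scaler0 subr0.
rewrite adS IH -[divd s k.+1]/('X * divd s k + s *: ('X^k - divd s k)).
rewrite pactD pactXM pactZ pactD pactN pactXn adS.
set A := ad (- r) k Y; set H := pact _ _ _.
have -> : - q = - r - (q - r) by rewrite opprB addKr.
have rdH : {[- r, {[q - r, H]}]} = {[q - r, {[- r, H]}]}.
  by rewrite (jace _ prN pd) commd lbr0l add0r.
have := DD (divd s k); rewrite -/H; move: rdH.
move: (q - r) => d; move: (- r) => r'.
rewrite !lbrE => rdH DDH; rewrite rdH DDH !scalerDr !scalerN !sK.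
by lmod.
Qed.

Let E2Y : {[E2, Y]} = - F1.
Proof.
by rewrite (jacoo _ pE2 pF1) (E2F1 S) lbr0l (brCe' pF1 pR) (RF1 S) opprK add0r.
Qed.

Let R01 : {[E2, {[- q, F2]}]} = 2%:R *: r + c2 *: R.
Proof.
have h := qR C; rewrite (jace _ pq' pE2) (R1 C) in h.
by rewrite lbrNl lbrNr; apply: (lincomb1 (c := -1) h); lmod.
Qed.

(** As [{[E2, F1]} = 0], the left side is [{[E2, ad (- q) k Y]}]; [Y_shift] replaces [q] by [r],
    which commutes with [E2] and [F2]. *)
Lemma cartan_F1 k : {[cartan k, F1]} = - pact (- r) (eps c2 s k) F1.
Proof.
have pF2k := lpar_ad k pqN pF2.
have -> : {[cartan k, F1]} = {[E2, ad (- q) k Y]}.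
  have h := jacoo F1 pE2 pF2k.
  rewrite (E2F1 S) lbr0r subr0 (brCo pF2k pF1) (lbr_ad _ _ pqN pF1 commqF1) in h.
  by rewrite h.
rewrite Y_shift /eps; set h := divd s k.
set P := pact (- r) h F1.
have pP : lpar true P by apply: lpar_pact.
have E2P : {[E2, P]} = 0.
  by rewrite (lbr_pact _ _ prN pE2 commrE2) (E2F1 S) pact_x0.
have qP : {[- q, P]} = 0 by rewrite (lbr_pact _ _ prN pqN commrq) commqF1 pact_x0.
have qF2p : lpar true {[- q, F2]} by par.
have E2q : {[E2, {[- q, pact (- r) h Y]}]} = - (2%:R *: {[- r, P]}) - c2 *: P.
  rewrite -F2_pact -/P (jace _ pqN pF2) qP lbr0r addr0 (jacoo _ pE2 qF2p) E2P lbr0r.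
  rewrite R01 lbrDl !lbrZl lbrNl (lbr_pact _ _ prN pR commRr) (RF1 S) pact_xN.
  by rewrite -/P; lmod.
have E2r : {[E2, {[- r, pact (- r) h Y]}]} = - {[- r, P]}.
  by rewrite -pactXM (lbr_pact _ _ prN pE2 commrE2) E2Y pact_xN pactXM.
have -> : q - r = - r - (- q) by rewrite opprK addrC.
rewrite lbrDr lbrNr lbrZr (lbr_ad _ _ prN pE2 commrE2) E2Y adN.
rewrite lbrDl (lbrNl (- q)) (lbrDr E2) (lbrNr E2) E2q E2r.
rewrite pactD pactZ mulrDl pactD mul_polyC pactZ pactXM pactXn -/P.
by lmod.
Qed.

Lemma r_cartan k : {[r, cartan k]} = 0.
Proof.
have h : {[- q, r]} = 0 by rewrite lbrNl (brCe pq' pr') (rq C) !oppr0.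
rewrite /cartan (jace _ pr' pE2) (rE2 C) (lbr_ad _ _ pqN pr' h) (rF2 C) ad0.
by rewrite lbr0l lbr0r addr0.
Qed.

Lemma Q_cartan k : {[Q, cartan k]} = 0.
Proof.
rewrite /cartan (jace _ pQ pE2) (QE2 S) (lbr_ad _ _ pqN pQ commQq) (QF2 S) adN lbrNr.
by rewrite subrr.
Qed.

Lemma R_cartan k : {[R, cartan k]} = 0.
Proof.
rewrite /cartan (jace _ pR pE2) (QE1 Sw) (lbr_ad _ _ pqN pR commRq) (QF1 Sw) ad0.
by rewrite lbr0l lbr0r addr0.
Qed.

Lemma cartan_E2 k : {[cartan k, E2]} = 0.
Proof.
have pF2k := lpar_ad k pqN pF2.
by rewrite (brCe (lpar_cartan k) pE2) /cartan odd_sq_ad ?oppr0 ?(E2E2 S).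
Qed.
End Shift.

(** * Induction on the total degree of the currents *)

Section Induction.
Variables (K : numFieldType) (L : lieSuperType K).

Definition shiftable (r E F : L) k := forall i j, (i + j <= k)%N ->
  {[ad r i E, ad (- r) j F]} = {[E, ad (- r) (i + j) F]}.

Section HalfStep.
Variables (c1 c2 s : K) (E1 E2 F1 F2 r q : L).
Hypothesis C : currents c1 c2 s E1 E2 F1 F2 r q.
Local Notation Q := {[E1, F1]}.
Local Notation R := {[E2, F2]}.
(** Such an [x] has positive weight and is killed by [Y]. The property is established from the local
    nilpotency of [ad e] in section [Ideals]. *)
Hypothesis lowest : forall x, lpar true x -> {[Q + R, x]} = x ->
  {[F1, x]} = 0 -> {[F2, x]} = 0 -> x = 0.
Variable k : nat.
Hypotheses (H1 : shiftable r E1 F1 k) (H2 : shiftable q E2 F2 k).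
Let S := cS C.
Let pE1 := oE1 S. Let pE2 := oE2 S. Let pF1 := oF1 S. Let pF2 := oF2 S.
Let pr' := pr C. Let pq' := pq C.
Let pQ : lpar false Q. Proof. by par. Qed.
Let pR : lpar false R. Proof. by par. Qed.
Let prN : lpar false (- r). Proof. exact: lparN. Qed.
Local Notation H := (cartan E2 F2 q).
Let p_cartan := lpar_cartan C k.

Lemma cartan_alt : H k = {[ad q k E2, F2]}.
Proof. by have := @H2 k 0; rewrite addn0 => /(_ (leqnn _)). Qed.

Lemma cartan_F2 : {[H k, F2]} = 0.
Proof.
have pE2k := lpar_ad k pq' pE2.
by rewrite (brCe p_cartan pF2) cartan_alt (brCo pE2k pF2) odd_sq_ad ?oppr0 ?(F2F2 S).
Qed.

Lemma Q_pact (f : {poly K}) : (size f <= k.+1)%N ->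
  {[pact r f E1, F1]} = {[E1, pact (- r) f F1]}.
Proof.
move=> le_f; rewrite !(pactE (n := k.+1)) // lbr_suml lbr_sumr.
apply: eq_bigr => i _; rewrite lbrZl lbrZr; congr (_ *: _).
have := @H1 i 0; rewrite addn0 => -> //.
by rewrite -ltnS.
Qed.

(* The difference of the two sides is a lowest weight vector of weight 1. *)
Lemma cartan_E1 : {[H k, E1]} = pact r (eps c2 s k) E1.
Proof.
set f := eps c2 s k.
have pf : lpar true (pact r f E1) by apply: lpar_pact.
apply/eqP; rewrite -subr_eq0; apply/eqP; apply: lowest; first by par.
- have rRN : {[r, R]} = 0.
    by rewrite (jace _ pr' pE2) (rE2 C) (rF2 C) lbr0l lbr0r addr0.
  rewrite lbrDl !lbrDr !lbrNr !(jace _ pQ p_cartan) !(jace _ pR p_cartan).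
  rewrite (Q_cartan C) (R_cartan C) (QE1 S) (RE1 S) !lbr0l lbr0r.
  rewrite (lbr_pact _ _ pr' pQ (rQ C)) (lbr_pact _ _ pr' pR rRN).
  by rewrite (QE1 S) (RE1 S) pact_x0; lmod.
- rewrite lbrDr lbrNr (jacoe _ pF1 p_cartan) (brCe' pF1 p_cartan) (cartan_F1 C) opprK.
  have pf' : lpar true (pact (- r) f F1) by apply: lpar_pact.
  rewrite (F1E1 S) (brCe p_cartan pQ) (Q_cartan C) oppr0 addr0.
  rewrite (brCo pF1 pf) Q_pact ?size_eps // (brCo pf' pE1).
  by rewrite subrr.
- rewrite lbrDr lbrNr (jacoe _ pF2 p_cartan) (brCe' pF2 p_cartan) cartan_F2 oppr0 lbr0l.
  rewrite (F2E1 S) lbr0r (lbr_pact _ _ pr' pF2 (rF2 C)) (F2E1 S) pact_x0.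
  by rewrite addr0 subr0.
Qed.

(** The single obstruction to passing from [k] to [k.+1]: by [Q_shift], all brackets of total degree
    [k.+1] differ by multiples of [D]. *)
Let D := {[r, cartan E1 F1 r k]}.

Lemma Q_step i j : (i + j)%N = k ->
  {[ad r i.+1 E1, ad (- r) j F1]} - {[ad r i E1, ad (- r) j.+1 F1]} = D.
Proof.
move=> ijk; rewrite /D /cartan; have := @H1 i j; rewrite ijk => <- //.
rewrite (jace _ pr' (lpar_ad i pr' pE1)) !adS lbrNl lbrNr.
by rewrite opprK.
Qed.

Lemma Q_shift i : (i <= k.+1)%N ->
  {[ad r i E1, ad (- r) (k.+1 - i) F1]} = cartan E1 F1 r k.+1 + i%:R *: D.
Proof.
elim: i => [_|i IH]; first by rewrite subn0 scale0r addr0.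
rewrite ltnS => le_ik; have h := @Q_step i (k - i) (subnKC le_ik).
rewrite subSS; have := IH (leqW le_ik); rewrite subSn // => h'.
rewrite -natr1; apply: (lincomb2 (c := 1) (c' := 1) h h').
by lmod.
Qed.

Lemma rQ_low i : (i < k)%N -> {[ad r i E1, ad (- r) 1 F1]} = cartan E1 F1 r i.+1.
Proof. by move=> lt_ik; rewrite H1 addn1. Qed.

Lemma Q01 : {[E1, ad (- r) 1 F1]} = 2%:R *: q + c1 *: Q.
Proof.
have h := rQ C; rewrite (jace _ pr' pE1) (Q1 C) in h.
by rewrite /= lbrNl lbrNr; apply: (lincomb1 (c := -1) h); lmod.
Qed.

Lemma rQ1 : {[r, cartan E1 F1 r 1]} = 0.
Proof. by rewrite /cartan Q01 lbrDr !lbrZr (rq C) (rQ C) !scaler0 addr0. Qed.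

(* Both sides compute [{[cartan E2 F2 q k, {[E1, ad (- r) 1 F1]}]}]. *)
Lemma half_step : - (2%:R *: {[q, H k]}) = (k * k.+1)%:R *: D.
Proof.
have -> : - (2%:R *: {[q, H k]}) = {[H k, {[E1, ad (- r) 1 F1]}]}.
  rewrite Q01 lbrDr !lbrZr (brCe p_cartan pq') (brCe p_cartan pQ) (Q_cartan C).
  by lmod.
set f := eps c2 s k.
have cartan_F11 : {[H k, ad (- r) 1 F1]} = - {[- r, pact (- r) f F1]}.
  rewrite /= (jace _ p_cartan prN) (cartan_F1 C) lbrNr (brCe p_cartan pr') (r_cartan C) oppr0 oppr0.
  by rewrite lbr0l add0r lbrNr.
rewrite (jace _ p_cartan pE1) cartan_E1 cartan_F11 -/f lbrNr -pactXM.
have szX : (size ('X * f)%R <= k.+2)%N.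
  rewrite mulrC (leq_trans (size_polyMleq _ _)) // size_polyX addn2.
  by rewrite ltnS size_eps.
have -> : pact (- r) ('X * f) F1 = \sum_(i < k.+1) f`_i *: ad (- r) i.+1 F1.
  rewrite (pactE (n := k.+2)) // big_ord_recl coefXM scale0r add0r.
  by apply: eq_bigr => i _; rewrite coefXM.
rewrite (pactE (n := k.+1)) ?size_eps // lbr_suml lbr_sumr -sumrB.
(* Below the top degree the two sums agree by [H1]. The top term contributes the leading coefficient
   [k.+1] times [k%:R *: D]. *)
rewrite big_ord_recr big1 /= => [|i _]; last first.
  by rewrite lbrZl lbrZr (rQ_low (ltn_ord i)) subrr.
have := Q_shift (leqnSn k); rewrite subSnn => h.
rewrite eps_lead ?(s2 C) // lbrZl lbrZr natrM.
by apply: (lincomb1 (c := k.+1%:R) h); lmod.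
Qed.

Lemma shiftable_step : D = 0 -> shiftable r E1 F1 k.+1.
Proof.
move=> D0 i j; rewrite leq_eqVlt ltnS => /orP[/eqP ijk | /H1 //].
have := @Q_shift i; rewrite D0 scaler0 addr0 -ijk leq_addr addKn.
by move=> /(_ isT); rewrite ijk.
Qed.
End HalfStep.

Section Step.
Variables (c1 c2 s : K) (E1 E2 F1 F2 r q : L).
Hypothesis C : currents c1 c2 s E1 E2 F1 F2 r q.
Hypothesis lowest : forall x, lpar true x ->
  {[{[E1, F1]} + {[E2, F2]}, x]} = x -> {[F1, x]} = 0 -> {[F2, x]} = 0 -> x = 0.
Let Cw := currents_swap C.

Let lowest_swap x : lpar true x -> {[{[E2, F2]} + {[E1, F1]}, x]} = x ->
  {[F2, x]} = 0 -> {[F1, x]} = 0 -> x = 0.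
Proof. by move=> px wx f2 f1; apply: lowest => //; rewrite addrC. Qed.

(* With [D = {[r, cartan E1 F1 r k]}] and [D' = {[q, cartan E2 F2 q k]}], the half
   steps read [-2 D' = k (k + 1) D] and [-2 D = k (k + 1) D'], which force [D = 0]
   unless [k (k + 1) = 2]. *)
Lemma shiftable_all k : shiftable r E1 F1 k /\ shiftable q E2 F2 k.
Proof.
elim: k => [|k [H1 H2]].
  by split=> i j; rewrite leqn0 addn_eq0 => /andP[/eqP -> /eqP ->].
have h1 := half_step C lowest H1 H2.
have h2 := half_step Cw lowest_swap H2 H1.
rewrite /cartan in h1 h2.
set D := {[r, _]} in h1 h2; set D' := {[q, _]} in h1 h2.
have [D0 D'0] : D = 0 /\ D' = 0.
  (* In the degenerate degree, [cartan E1 F1 r 1] is a combination of [q] and [{[E1, F1]}], which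
     both commute with [r]; likewise for the mirror element. *)
  have [k1|k1] := eqVneq k 1%N.
    by rewrite /D /D' k1; split; [exact: (rQ1 C) | exact: (rQ1 Cw)].
  set m := (k * k.+1)%:R in h1 h2.
  have m0 : 4%:R - m ^+ 2 != 0.
    rewrite subr_eq0 /m -natrX eqr_nat; apply/eqP => m4.
    case: k k1 m4 {H1 H2 h1 h2 D D' m} => [|[|k]] //= _ m4.
    have : (2 ^ 2 < (k.+2 * k.+3) ^ 2)%N.
      by rewrite ltn_sqr (@leq_trans (2 * 3)) // leq_mul.
    by rewrite -m4.
  have e1 : (4%:R - m ^+ 2) *: D = 0.
    by apply: (lincomb2 (c := m) (c' := - 2%:R) h1 h2); lmod.
  have e2 : (4%:R - m ^+ 2) *: D' = 0.
    by apply: (lincomb2 (c := - 2%:R) (c' := m) h1 h2); lmod.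
  by split; apply/eqP; move/eqP: e1; move/eqP: e2;
     rewrite !scaler_eq0 (negPf m0) /=.
by split; [apply: (shiftable_step C) | apply: (shiftable_step Cw)].
Qed.
End Step.
End Induction.

(** * Triangular decomposition *)

Section Triangular.
Variables (K : numFieldType) (L : lieSuperType K).

Lemma span_br (P P' T : L -> Prop) :
  (forall x y, P x -> P' y -> span T {[x, y]}) ->
  forall x y, span P x -> span P' y -> span T {[x, y]}.
Proof.
move=> PT x y sx; elim: sx y => {x} [x Px||x x' _ IH _ IH'|c x _ IH] y sy.
- elim: sy => {y} [y Py||y y' _ IH _ IH'|c y _ IH].
  + exact: PT.
  + by rewrite lbr0r; apply: span0.
  + by rewrite lbrDr; apply: spanD.
  + by rewrite lbrZr; apply: spanZ.
- by rewrite lbr0l; apply: span0.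
- by rewrite lbrDl; apply: spanD; auto.
- by rewrite lbrZl; apply: spanZ; auto.
Qed.

Lemma lpar_span (P : L -> Prop) p : (forall x, P x -> lpar p x) ->
  forall x, span P x -> lpar p x.
Proof.
move=> Pp x; elim=> {x} [x /Pp //||x y _ px _ py|c x _ px].
- exact: lpar0.
- exact: lparD.
- exact: lparZ.
Qed.

Lemma span_pact (P : L -> Prop) u f x : (forall i, span P (ad u i x)) -> span P (pact u f x).
Proof.
move=> sP; rewrite /pact; elim/big_rec: _ => [|i y _ sy]; first exact: span0.
by apply: spanD => //; apply: spanZ.
Qed.

(* The index is off by one: [npow A n] consists of the elements of degree [n.+1]. *)
Inductive npow (A : L -> Prop) : nat -> L -> Prop :=
| npow1 x : span A x -> npow A 0 x
| npowS n a x : span A a -> npow A n x -> npow A n.+1 {[a, x]}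
| npow0 n : npow A n 0
| npowD n x y : npow A n x -> npow A n y -> npow A n (x + y)
| npowZ n c x : npow A n x -> npow A n (c *: x).

Section HalfTriangular.
Variables A B A0 : L -> Prop.
Hypotheses (parA : forall x, A x -> lpar true x) (parB : forall x, B x -> lpar true x)
  (parA0 : forall x, A0 x -> lpar false x).
Hypothesis A0A : forall h a, A0 h -> A a -> span A {[h, a]}.
Hypothesis BA : forall b a, B b -> A a -> span A0 {[b, a]}.
Let spanA := lpar_span parA.
Let spanB := lpar_span parB.
Let spanA0 := lpar_span parA0.

Lemma npow_A0 n x h : npow A n x -> span A0 h -> npow A n {[h, x]}.
Proof.
move=> nx sh; elim: nx => {n x}.
- by move=> x sx; apply: npow1; apply: (span_br A0A).
- move=> n a x sa nx IH; rewrite (jace _ (spanA0 sh) (spanA sa)).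
  by apply: npowD; apply: npowS => //; apply: (span_br A0A).
- by move=> n; rewrite lbr0r; apply: npow0.
- by move=> n x y _ nx _ ny; rewrite lbrDr; apply: npowD.
- by move=> n c x _ nx; rewrite lbrZr; apply: npowZ.
Qed.

Lemma A_A0 a h : span A a -> span A0 h -> span A {[a, h]}.
Proof.
move=> sa sh; rewrite (brCe' (spanA sa) (spanA0 sh)); apply: spanN.
exact: (span_br A0A).
Qed.

(** For [n = 0] the element has degree one and the bracket falls into the weight-zero part; in
    higher degree [ad b] moves past the first factor by the Jacobi identity. *)
Lemma npow_B n x b : npow A n x -> span B b ->
  if n is m.+1 then npow A m {[b, x]} else span A0 {[b, x]}.
Proof.
move=> nx sb; elim: nx => {n x}.
- by move=> x sx; apply: (span_br BA).
- move=> n a x sa nx IH; rewrite (jacoo _ (spanB sb) (spanA sa)).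
  apply: npowD; first by apply: npow_A0 => //; apply: (span_br BA).
  rewrite -scaleN1r; apply: npowZ; case: n nx IH => [|n] nx IH.
    by apply: npow1; apply: A_A0.
  exact: npowS.
- by case=> [|n]; rewrite lbr0r; [apply: span0 | apply: npow0].
- by case=> [|n] x y _ nx _ ny; rewrite lbrDr; [apply: spanD | apply: npowD].
- by case=> [|n] c x _ nx; rewrite lbrZr; [apply: spanZ | apply: npowZ].
Qed.

Lemma npow_weight (h : L) (c : K) n x : lpar false h ->
  (forall a, A a -> {[h, a]} = c *: a) -> npow A n x ->
  {[h, x]} = (n.+1%:R * c) *: x.
Proof.
move=> ph hA; have hA' a : span A a -> {[h, a]} = c *: a.
  elim=> {a} [a /hA //||x' y _ IH _ IH'|d x' _ IH].
  - by rewrite lbr0r scaler0.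
  - by rewrite lbrDr IH IH' scalerDr.
  - by rewrite lbrZr IH !scalerA mulrC.
elim=> {n x}.
- by move=> x /hA' ->; rewrite mul1r.
- move=> n a x sa _ IH; rewrite (jace _ ph (spanA sa)) IH hA' //.
  by rewrite lbrZl lbrZr -scalerDl -[n.+2%:R]natr1 [(_ + 1) * _]mulrDl mul1r addrC.
- by move=> n; rewrite lbr0r scaler0.
- by move=> n x y _ IH _ IH'; rewrite lbrDr IH IH' scalerDr.
- by move=> n d x _ IH; rewrite lbrZr IH !scalerA mulrC.
Qed.
End HalfTriangular.

Section Grading.
Variables A B A0 : L -> Prop.
Hypotheses (parA : forall x, A x -> lpar true x) (parB : forall x, B x -> lpar true x)
  (parA0 : forall x, A0 x -> lpar false x).
Hypothesis A0A : forall h a, A0 h -> A a -> span A {[h, a]}.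
Hypothesis A0B : forall h b, A0 h -> B b -> span B {[h, b]}.
Hypothesis AB : forall a b, A a -> B b -> span A0 {[a, b]}.

Let BA b a : B b -> A a -> span A0 {[b, a]}.
Proof. by move=> Bb Aa; rewrite (brCo (parB Bb) (parA Aa)); apply: AB. Qed.

(** [Negz n] is [-(n+1)], so its shift agrees with the off-by-one index of [npow]. *)
Definition graded (w : int) : L -> Prop :=
  match w with
  | Posz 0 => span A0
  | Posz n.+1 => npow A n
  | Negz n => npow B n
  end.

Lemma graded0 w : graded w 0.
Proof. by case: w => [[|n]|n]; [apply: span0 | apply: npow0 | apply: npow0]. Qed.
Lemma gradedD w x y : graded w x -> graded w y -> graded w (x + y).
Proof. by case: w => [[|n]|n]; [apply: spanD | apply: npowD | apply: npowD]. Qed.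
Lemma gradedZ w c x : graded w x -> graded w (c *: x).
Proof. by case: w => [[|n]|n]; [apply: spanZ | apply: npowZ | apply: npowZ]. Qed.

(** This property passes to brackets by the Jacobi identity, so it has to be checked on generators
    only; closure of the graded pieces under brackets is deduced from it without inspecting
    words. *)
Definition stable (s : int) (y : L) := forall w x, graded w x -> graded (w + s) {[y, x]}.

Lemma stableA a : span A a -> stable 1 a.
Proof.
move=> sa [[|n]|[|n]] x gx.
- by apply: npow1; apply: (A_A0 parA parA0 A0A).
- by rewrite -PoszD addn1; apply: npowS.
- exact: (npow_B parB parA parA0 A0B AB gx sa).
- have -> : Negz n.+1 + 1 = Negz n by rewrite !NegzE -addn1 PoszD opprD subrK.
  exact: (npow_B parB parA parA0 A0B AB gx sa).
Qed.

Lemma stableB b : span B b -> stable (-1) b.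
Proof.
move=> sb [[|[|n]]|n] x gx.
- by apply: npow1; apply: (A_A0 parB parA0 A0B).
- exact: (npow_B parA parB parA0 A0A BA gx sb).
- have -> : Posz n.+2 - 1 = n.+1 by rewrite -[n.+2]addn1 PoszD addrK.
  exact: (npow_B parA parB parA0 A0A BA gx sb).
- have -> : Negz n - 1 = Negz n.+1 by rewrite !NegzE -[n.+2]addn1 PoszD opprD.
  exact: npowS.
Qed.

Lemma stable_br p q s t y z : lpar p y -> lpar q z -> stable s y -> stable t z ->
  stable (s + t) {[y, z]}.
Proof.
move=> py pz sy sz w x gx.
have -> : {[{[y, z]}, x]} = {[y, {[z, x]}]} - (-1) ^+ (p && q) *: {[z, {[y, x]}]}.
  by rewrite (jac _ py pz) addrK.
apply: gradedD; first by rewrite (addrC s) addrA; apply: sy; apply: sz.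
by rewrite -scaleNr; apply: gradedZ; rewrite addrA; apply: sz; apply: sy.
Qed.

Lemma stableZ s c y : stable s y -> stable s (c *: y).
Proof. by move=> sy w x gx; rewrite lbrZl; apply: gradedZ; apply: sy. Qed.

(** Stability and membership are carried together: in [dec_br] the stability of one factor places
    the bracket in a graded piece. *)
Inductive decomposable (p : bool) : L -> Prop :=
| dec_hom w x : stable w x -> graded w x -> lpar p x -> decomposable p x
| dec0 : decomposable p 0
| decD x y : decomposable p x -> decomposable p y -> decomposable p (x + y).

Lemma decZ p c x : decomposable p x -> decomposable p (c *: x).
Proof.
elim=> {x} [w x sx gx px||x y _ dx _ dy].
- by apply: (@dec_hom _ w); [apply: stableZ | apply: gradedZ | apply: lparZ].
- by rewrite scaler0; apply: dec0.
- by rewrite scalerDr; apply: decD.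
Qed.

Lemma dec_br p q x y : decomposable p x -> decomposable q y ->
  decomposable (addb p q) {[x, y]}.
Proof.
move=> dx; elim: dx y => {x} [w x sx gx px||x x' _ IH _ IH'] y dy.
- elim: dy => {y} [v y sy gy py||y y' _ IH _ IH'].
  + apply: (@dec_hom _ (w + v)); first exact: (stable_br px py).
      by rewrite addrC; apply: sx.
    exact: lpar_br.
  + by rewrite lbr0r; apply: dec0.
  + by rewrite lbrDr; apply: decD.
- by rewrite lbr0l; apply: dec0.
- by rewrite lbrDl; apply: decD; auto.
Qed.

Definition graded_sum (x : L) := exists (f : int -> L) (ws : seq int),
  [/\ uniq ws, forall w, graded w (f w), forall w, w \notin ws -> f w = 0
    & x = \sum_(w <- ws) f w].

Lemma big_support (f : int -> L) (ws vs : seq int) : uniq ws -> uniq vs ->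
  {subset ws <= vs} -> (forall w, w \notin ws -> f w = 0) ->
  \sum_(w <- vs) f w = \sum_(w <- ws) f w.
Proof.
move=> uw uv sub f0; rewrite (bigID (mem ws)) /= [X in _ + X]big1 => [|w /f0 //].
rewrite addr0 -big_filter; apply: perm_big; apply: uniq_perm => //.
  exact: filter_uniq.
by move=> w; rewrite mem_filter andb_idr // => /sub.
Qed.

Lemma graded_sumD x y : graded_sum x -> graded_sum y -> graded_sum (x + y).
Proof.
move=> [f [ws [uw gf f0 ->]]] [g [vs [uv gg g0 ->]]].
exists (fun w => f w + g w), (undup (ws ++ vs)); split.
- exact: undup_uniq.
- by move=> w; apply: gradedD.
- by move=> w; rewrite mem_undup mem_cat negb_or => /andP[/f0 -> /g0 ->]; rewrite addr0.
- rewrite big_split /=; congr (_ + _); apply: esym; apply: big_support => //.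
  + exact: undup_uniq.
  + by move=> w wws; rewrite mem_undup mem_cat wws.
  + exact: undup_uniq.
  + by move=> w wvs; rewrite mem_undup mem_cat wvs orbT.
Qed.

Lemma dec_graded p x : decomposable p x -> graded_sum x.
Proof.
elim=> {x} [w x _ gx _||x y _ IH _ IH']; last exact: graded_sumD.
- exists (fun v => if v == w then x else 0), [:: w]; split=> //.
  + by move=> v; case: eqP => [->|_] //; apply: graded0.
  + by move=> v; rewrite inE => /negPf ->.
  + by rewrite big_seq1 eqxx.
- exists (fun=> 0), [::]; split=> //; first by move=> w; apply: graded0.
  by rewrite big_nil.
Qed.

Section Weight.
Variable H : L.
Hypothesis pH : lpar false H.
Hypotheses (HA : forall a, A a -> {[H, a]} = a) (HB : forall b, B b -> {[H, b]} = - b)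
  (HA0 : forall h, A0 h -> {[H, h]} = 0).

Lemma graded_weight w x : graded w x -> {[H, x]} = w%:~R *: x.
Proof.
case: w => [[|n]|n] /= gx.
- rewrite scale0r; elim: gx => {x} [x /HA0 //||x y _ IH _ IH'|c x _ IH].
  + by rewrite lbr0r.
  + by rewrite lbrDr IH IH' addr0.
  + by rewrite lbrZr IH scaler0.
- have HA1 a : A a -> {[H, a]} = 1 *: a by rewrite scale1r; apply: HA.
  by rewrite (npow_weight parA pH HA1 gx) mulr1.
- have HB1 b : B b -> {[H, b]} = (- 1) *: b by rewrite scaleN1r; apply: HB.
  by rewrite (npow_weight parB pH HB1 gx) mulrN1 NegzE mulrNz.
Qed.

Variable I : L -> Prop.
Hypotheses (ID : forall x y, I x -> I y -> I (x + y)) (IZ : forall c x, I x -> I (c *: x))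
  (IB : forall y x, I x -> I {[y, x]}).

(** Vandermonde elimination: [ad H - v] removes the component of weight [v] and multiplies each
    other one by the nonzero scalar [w - v]; then induct on the number of components. *)
Lemma ideal_components (f : int -> L) (ws : seq int) : uniq ws ->
  (forall w, graded w (f w)) -> I (\sum_(w <- ws) f w) ->
  forall w, w \in ws -> I (f w).
Proof.
elim: ws f => // v ws IH f /andP[vws uw] gf; rewrite big_cons => If.
have Iws w : w \in ws -> I (f w).
  move=> wws; have wv : w%:~R - v%:~R != 0 :> K.
    by rewrite subr_eq0 eqr_int; apply: contraNneq vws => <-.
  have /IZ : I ((w%:~R - v%:~R) *: f w).
    apply: (IH (fun w => (w%:~R - v%:~R) *: f w)) => // [u|].
      exact/gradedZ/gf.
    have -> : \sum_(u <- ws) (u%:~R - v%:~R) *: f u =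
        {[H, f v + \sum_(u <- ws) f u]} + (- v%:~R) *: (f v + \sum_(u <- ws) f u).
      rewrite lbrDr lbr_sumr (graded_weight (gf v)) scalerDr.
      rewrite addrACA -scalerDl subrr scale0r add0r scaler_sumr -big_split.
      by apply: eq_bigr => u _; rewrite /= (graded_weight (gf u)) scalerDl.
    by apply: ID; [apply: IB | apply: IZ].
  by move=> /(_ (w%:~R - v%:~R)^-1); rewrite scalerA mulVf // scale1r.
move=> w; rewrite inE => /predU1P[-> {w}|/Iws //].
have -> : f v = (f v + \sum_(w <- ws) f w) + (-1) *: \sum_(w <- ws) f w.
  by rewrite scaleN1r addrK.
apply: ID => //; apply: IZ; rewrite big_seq.
elim/big_rec: _ => [|w x wws Ix]; last by apply: ID => //; apply: Iws.
by rewrite -(scale0r (f v + \sum_(w <- ws) f w)); apply: IZ.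
Qed.
End Weight.
End Grading.
End Triangular.

(** * Ideals *)

Section Sl2.
Variables (K : numFieldType) (L : lieSuperType K).

(** On a vector killed by [f], [f e^(k+1) x = (k+1)(w+k) e^k x]. For [w > 0] the factor never
    vanishes, so the vanishing of a power of [ad e] on [x] descends to [x] itself. *)
Lemma sl2_injective (e f h x : L) (w : K) :
  lpar false e -> lpar false f -> lpar false h ->
  {[f, e]} = h -> {[h, e]} = 2%:R *: e ->
  0 < w -> {[h, x]} = w *: x -> {[f, x]} = 0 ->
  (exists n, ad e n x = 0) -> x = 0.
Proof.
move=> pe pf ph fe he w0 hx fx [n en].
have hn k : {[h, ad e k x]} = (w + (2 * k)%:R) *: ad e k x.
  elim: k => [|k IH]; first by rewrite addr0.
  rewrite adS (jace _ ph pe) he IH lbrZl lbrZr.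
  by rewrite [(2 * k.+1)%N]mulnS natrD; lmod.
have fn k : {[f, ad e k.+1 x]} = (k.+1%:R * (w + k%:R)) *: ad e k x.
  elim: k => [|k IH].
    by rewrite /= (jace _ pf pe) fe fx lbr0r hx; lmod.
  rewrite adS (jace _ pf pe) fe hn IH lbrZr -adS.
  rewrite -scalerDl; congr (_ *: _).
  by rewrite natrM -!natr1; ring.
elim: n en => // k IH en; apply: IH.
have := fn k; rewrite en lbr0r => /esym/eqP; rewrite scaler_eq0 mulf_eq0.
have wk : w + k%:R != 0 by rewrite gt_eqF // ltr_wpDr ?ler0n.
by rewrite pnatr_eq0 (negPf wk) /= => /eqP.
Qed.
End Sl2.

Section IdealTheory.
Variables (K : numFieldType) (L : lieSuperType K).

Lemma ad_pact (u : L) j f x : ad u j (pact u f x) = pact u ('X^j * f) x.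
Proof.
elim: j => [|j IH]; first by rewrite expr0 mul1r.
by rewrite adS IH -pactXM mulrA exprS.
Qed.

Definition ad_orbit (u x y : L) := exists k, y = ad u k x.

Section HalfLocal.
Variables (c1 c2 s : K) (E1 E2 F1 F2 r q : L).
Hypothesis C : currents c1 c2 s E1 E2 F1 F2 r q.
Hypothesis lowest : forall x, lpar true x ->
  {[{[E1, F1]} + {[E2, F2]}, x]} = x -> {[F1, x]} = 0 -> {[F2, x]} = 0 -> x = 0.
Let S := cS C.
Let pE2 := oE2 S. Let pF1 := oF1 S. Let pr' := pr C. Let pq' := pq C.
Let prN : lpar false (- r). Proof. exact: lparN. Qed.
Let pqN : lpar false (- q). Proof. exact: lparN. Qed.
Local Notation R k := (cartan E2 F2 q k).
Let p_cartan := lpar_cartan C.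

Let H2 i j : {[ad q i E2, ad (- q) j F2]} = {[E2, ad (- q) (i + j) F2]}.
Proof. by have [_ h] := shiftable_all C lowest (i + j); apply: h. Qed.

Lemma q_cartan k : {[q, R k]} = 0.
Proof.
rewrite /cartan (jace _ pq' pE2); have := H2 1 k; rewrite /= => ->.
have -> : {[q, ad (- q) k F2]} = - ad (- q) k.+1 F2 by rewrite adS lbrNl opprK.
by rewrite lbrNr subrr.
Qed.

Let Nr k : {[- r, R k]} = 0. Proof. by rewrite lbrNl (r_cartan C) oppr0. Qed.
Let Nq k : {[- q, R k]} = 0. Proof. by rewrite lbrNl q_cartan oppr0. Qed.

Lemma cartan_adE1 k j : {[R k, ad r j E1]} = pact r ('X^j * eps c2 s k) E1.
Proof.
have [h1 h2] := shiftable_all C lowest k.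
rewrite (lbr_ad _ _ pr' (p_cartan k) (r_cartan C k)) (cartan_E1 C lowest h1 h2).
exact: ad_pact.
Qed.

Lemma cartan_adE2 k j : {[R k, ad q j E2]} = 0.
Proof. by rewrite (lbr_ad _ _ pq' (p_cartan k) (q_cartan k)) (cartan_E2 C) ad0. Qed.

Lemma cartan_adF1 k j : {[R k, ad (- r) j F1]} = - pact (- r) ('X^j * eps c2 s k) F1.
Proof. by rewrite (lbr_ad _ _ prN (p_cartan k) (Nr k)) (cartan_F1 C) adN ad_pact. Qed.

Lemma cartan_adF2 k j : {[R k, ad (- q) j F2]} = 0.
Proof.
have [_ h2] := shiftable_all C lowest k.
by rewrite (lbr_ad _ _ pqN (p_cartan k) (Nq k)) (cartan_F2 C h2) ad0.
Qed.

Lemma adE2_adF1 i j : {[ad q i E2, ad (- r) j F1]} = 0.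
Proof.
have pE2i := lpar_ad i pq' pE2.
have E2i : {[- r, ad q i E2]} = 0.
  have qr : {[q, - r]} = 0 by rewrite lbrNr (brCe pq' pr') (rq C) !oppr0.
  by rewrite (lbr_ad _ _ pq' prN qr) lbrNl (rE2 C) oppr0 ad0.
rewrite (lbr_ad _ _ prN pE2i E2i) (brCo pE2i pF1) (lbr_ad _ _ pq' pF1 (qF1 C)).
by rewrite (F1E2 S) !ad0.
Qed.
End HalfLocal.

Section Ideals.
Variables (c1 c2 s : K) (E1 E2 F1 F2 r q : L).
Hypothesis C : currents c1 c2 s E1 E2 F1 F2 r q.
Local Notation Q := {[E1, F1]}.
Local Notation R := {[E2, F2]}.
Local Notation e := {[E1, E2]}.
Local Notation Y := {[F1, F2]}.
Hypotheses (nile : forall x, exists n, ad e n x = 0) (nilY : forall x, exists n, ad Y n x = 0).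
Let S := cS C.
Let Sw := sl12_swap S.
Let Cw := currents_swap C.
Let pE1 := oE1 S. Let pE2 := oE2 S. Let pF1 := oF1 S. Let pF2 := oF2 S.
Let pr' := pr C. Let pq' := pq C.
Let prN : lpar false (- r). Proof. exact: lparN. Qed.
Let pqN : lpar false (- q). Proof. exact: lparN. Qed.
Let pe : lpar false e. Proof. by par. Qed.
Let pY : lpar false Y. Proof. by par. Qed.
Let pH : lpar false (Q + R). Proof. by par. Qed.

Let HE1 : {[Q + R, E1]} = E1. Proof. by rewrite lbrDl (QE1 S) (RE1 S) add0r. Qed.
Let HE2 : {[Q + R, E2]} = E2. Proof. by rewrite lbrDl (QE2 S) (QE1 Sw) addr0. Qed.
Let HF1 : {[Q + R, F1]} = - F1. Proof. by rewrite lbrDl (QF1 S) (RF1 S) add0r. Qed.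
Let HF2 : {[Q + R, F2]} = - F2. Proof. by rewrite lbrDl (QF2 S) (QF1 Sw) addr0. Qed.
Let He : {[Q + R, e]} = 2%:R *: e.
Proof. by rewrite (jace _ pH pE1) HE1 HE2; lmod. Qed.
Let HY : {[Q + R, Y]} = - (2%:R *: Y).
Proof. by rewrite (jace _ pH pF1) HF1 HF2 lbrNl lbrNr; lmod. Qed.

Lemma injective_Y x (w : K) : 0 < w -> {[Q + R, x]} = w *: x -> {[Y, x]} = 0 -> x = 0.
Proof. by move=> w0 Hx Yx; apply: (sl2_injective pe pY pH (Ye S) He w0 Hx Yx). Qed.

Lemma injective_e x (w : K) : 0 < w -> {[Q + R, x]} = - w *: x -> {[e, x]} = 0 -> x = 0.
Proof.
move=> w0 Hx ex; apply: (sl2_injective (h := - (Q + R)) pY pe _ _ _ w0 _ ex (nilY x)).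
- exact: lparN.
- by rewrite (brCe pe pY) (Ye S).
- by rewrite lbrNl HY opprK.
- by rewrite lbrNl Hx scaleNr opprK.
Qed.

Let lowest x : lpar true x -> {[Q + R, x]} = x -> {[F1, x]} = 0 -> {[F2, x]} = 0 -> x = 0.
Proof.
move=> _ Hx f1 f2; apply: (@injective_Y _ 1); rewrite ?scale1r //.
by rewrite (adY S) f1 f2 !lbr0r addr0.
Qed.
Let lowest_swap x : lpar true x -> {[R + Q, x]} = x -> {[F2, x]} = 0 -> {[F1, x]} = 0 -> x = 0.
Proof. by move=> px wx f2 f1; apply: lowest => //; rewrite addrC. Qed.

Definition up x := ad_orbit r E1 x \/ ad_orbit q E2 x.
Definition down x := ad_orbit (- r) F1 x \/ ad_orbit (- q) F2 x.
Definition diag x := (exists k, x = cartan E1 F1 r k) \/ (exists k, x = cartan E2 F2 q k).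

Lemma lpar_up x : up x -> lpar true x.
Proof. by case=> -[k ->]; apply: lpar_ad. Qed.
Lemma lpar_down x : down x -> lpar true x.
Proof. by case=> -[k ->]; apply: lpar_ad. Qed.
Lemma lpar_diag x : diag x -> lpar false x.
Proof. by case=> -[k ->]; [apply: (lpar_cartan Cw) | apply: (lpar_cartan C)]. Qed.

Lemma diag_up h a : diag h -> up a -> span up {[h, a]}.
Proof.
case=> -[k ->] [|] [j ->].
- rewrite (cartan_adE2 Cw lowest_swap); exact: span0.
- rewrite (cartan_adE1 Cw lowest_swap); apply: span_pact => i.
  by apply: span_gen; right; exists i.
- rewrite (cartan_adE1 C lowest); apply: span_pact => i.
  by apply: span_gen; left; exists i.
- rewrite (cartan_adE2 C lowest); exact: span0.
Qed.

Lemma diag_down h a : diag h -> down a -> span down {[h, a]}.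
Proof.
case=> -[k ->] [|] [j ->].
- rewrite (cartan_adF2 Cw lowest_swap); exact: span0.
- rewrite (cartan_adF1 Cw); apply: spanN; apply: span_pact => i.
  by apply: span_gen; right; exists i.
- rewrite (cartan_adF1 C); apply: spanN; apply: span_pact => i.
  by apply: span_gen; left; exists i.
- rewrite (cartan_adF2 C lowest); exact: span0.
Qed.

Lemma up_down a b : up a -> down b -> span diag {[a, b]}.
Proof.
case=> -[i ->] [|] [j ->].
- have [h _] := shiftable_all C lowest (i + j).
  by rewrite h //; apply: span_gen; left; exists (i + j)%N.
- rewrite (adE2_adF1 Cw); exact: span0.
- rewrite (adE2_adF1 C); exact: span0.
- have [_ h] := shiftable_all C lowest (i + j).
  by rewrite h //; apply: span_gen; right; exists (i + j)%N.
Qed.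

Lemma weight_up a : up a -> {[Q + R, a]} = a.
Proof.
have rH : {[r, Q + R]} = 0.
  by rewrite lbrDr (rQ C) (r_cartan C 0) addr0.
have qH : {[q, Q + R]} = 0.
  by rewrite lbrDr (qR C) (r_cartan Cw 0) addr0.
by case=> -[k ->]; rewrite (lbr_ad _ _ _ pH) // ?HE1 ?HE2.
Qed.

Lemma weight_down a : down a -> {[Q + R, a]} = - a.
Proof.
have rH : {[- r, Q + R]} = 0.
  by rewrite lbrNl lbrDr (rQ C) (r_cartan C 0) addr0 oppr0.
have qH : {[- q, Q + R]} = 0.
  by rewrite lbrNl lbrDr (qR C) (r_cartan Cw 0) addr0 oppr0.
by case=> -[k ->]; rewrite (lbr_ad _ _ _ pH) // ?HF1 ?HF2 adN.
Qed.

Lemma weight_diag h : diag h -> {[Q + R, h]} = 0.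
Proof.
case=> -[k ->]; rewrite lbrDl; last by rewrite (Q_cartan C) (R_cartan C) addr0.
by rewrite (Q_cartan Cw) (R_cartan Cw) addr0.
Qed.

Definition cartan_sum (f g : {poly K}) : L :=
  {[E1, pact (- r) f F1]} + {[E2, pact (- q) g F2]}.

Lemma span_diag h : span diag h -> exists f g, h = cartan_sum f g.
Proof.
elim=> {h} [h [[k ->]|[k ->]]||x y _ [f [g ->]] _ [f' [g' ->]]|c x _ [f [g ->]]].
- by exists 'X^k, 0; rewrite /cartan_sum pactXn pact0 lbr0r addr0.
- by exists 0, 'X^k; rewrite /cartan_sum pactXn pact0 lbr0r add0r.
- by exists 0, 0; rewrite /cartan_sum !pact0 !lbr0r addr0.
- by exists (f + f'), (g + g'); rewrite /cartan_sum !pactD !lbrDr addrACA.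
- by exists (c *: f), (c *: g); rewrite /cartan_sum !pactZ !lbrZr scalerDr.
Qed.

(** Generation of [L], as an induction principle that carries parity along; [{[r, F1]}] and
    [{[q, F2]}] take the place of the generator [Z]. *)
Hypothesis gen : forall P : bool -> L -> Prop,
  P true E1 -> P true E2 -> P true F1 -> P true F2 ->
  P true {[r, F1]} -> P true {[q, F2]} ->
  (forall p, P p 0) -> (forall p x y, P p x -> P p y -> P p (x + y)) ->
  (forall p c x, P p x -> P p (c *: x)) ->
  (forall p p' x y, P p x -> P p' y -> P (addb p p') {[x, y]}) ->
  forall p x, lpar p x -> P p x.

Lemma all_graded_sum x : graded_sum up down diag x.
Proof.
have sA := stableA lpar_up lpar_down lpar_diag diag_up diag_down up_down.
have sB := stableB lpar_up lpar_down lpar_diag diag_up diag_down up_down.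
have dA a : up a -> decomposable up down diag true a.
  move=> ua; apply: (@dec_hom _ _ _ _ _ _ 1); last exact: lpar_up.
    by apply: sA; apply: span_gen.
  by apply: npow1; apply: span_gen.
have dB b : down b -> decomposable up down diag true b.
  move=> db; apply: (@dec_hom _ _ _ _ _ _ (-1)); last exact: lpar_down.
    by apply: sB; apply: span_gen.
  by apply: npow1; apply: span_gen.
have dec p y : lpar p y -> decomposable up down diag p y.
  apply: (gen (P := decomposable up down diag)) => {p y}.
  - by apply: dA; left; exists 0.
  - by apply: dA; right; exists 0.
  - by apply: dB; left; exists 0.
  - by apply: dB; right; exists 0.
  - rewrite -[{[r, F1]}]opprK -lbrNl -scaleN1r; apply: decZ.
    by apply: dB; left; exists 1.
  - rewrite -[{[q, F2]}]opprK -lbrNl -scaleN1r; apply: decZ.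
    by apply: dB; right; exists 1.
  - by move=> p; apply: dec0.
  - by move=> p y z; apply: decD.
  - by move=> p c y; apply: decZ.
  - by move=> p p' y z; apply: dec_br.
have [x0 [x1 [p0 p1 ->]]] := lpar_split x.
by apply: graded_sumD; [apply: dec_graded (dec _ _ p0) | apply: dec_graded (dec _ _ p1)].
Qed.

Variable I : L -> Prop.
Hypotheses (ID : forall x y, I x -> I y -> I (x + y)) (IZ : forall c x, I x -> I (c *: x))
  (IB : forall y x, I x -> I {[y, x]}).
Hypothesis I0 : forall f g, I (cartan_sum f g) -> cartan_sum f g = 0.

(** Bracketing with the odd element [F1 + F2] moves a positive weight one step towards 0, where
    induction applies. The square of [ad (F1 + F2)] is [ad Y], injective on positive weights, so
    [x = 0]. Negative weights use [E1 + E2] and [e]. *)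
Lemma ideal_graded w x : graded up down diag w x -> I x -> x = 0.
Proof.
have gw := graded_weight lpar_up lpar_down pH weight_up weight_down weight_diag.
have sA := stableA lpar_up lpar_down lpar_diag diag_up diag_down up_down.
have sB := stableB lpar_up lpar_down lpar_diag diag_up diag_down up_down.
have base y : graded up down diag 0 y -> I y -> y = 0.
  by move=> /span_diag [f [g ->]]; apply: I0.
have sq a b y : lpar true a -> lpar true b -> {[a, a]} = 0 -> {[b, b]} = 0 ->
    {[a + b, y]} = 0 -> {[{[a, b]}, y]} = 0.
  move=> pa pb aa bb y0; have pab : lpar true (a + b) by par.
  have := jacoo y pab pab; rewrite y0 lbr0r !lbrE aa bb (brCo pb pa) => h.
  by apply: (lincomb1 (c := - 2%:R^-1) h); rewrite ?lbrE; lmod.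
case: w => n; elim: n x => [|n IH] x gx Ix; first exact: base.
- apply: (@injective_Y x n.+1%:R); first by rewrite ltr0n.
    by rewrite (gw _ _ gx).
  apply: sq => //; try exact: (F1F1 S); try exact: (F2F2 S).
  apply: IH; last exact: IB.
  have -> : Posz n = Posz n.+1 + (-1) by rewrite -addn1 PoszD addrK.
  by apply: sB => //; apply: spanD; apply: span_gen; [left | right]; exists 0.
- apply: (@injective_e x 1); rewrite ?ltr01 //; first by rewrite (gw _ _ gx) NegzE.
  apply: sq => //; try exact: (E1E1 S); try exact: (E2E2 S).
  apply: base; last exact: IB.
  have -> : 0 = Negz 0 + 1 by [].
  by apply: sA => //; apply: spanD; apply: span_gen; [left | right]; exists 0.
- apply: (@injective_e x n.+2%:R); rewrite ?ltr0n //.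
    by rewrite (gw _ _ gx) NegzE mulrNz.
  apply: sq => //; try exact: (E1E1 S); try exact: (E2E2 S).
  apply: IH; last exact: IB.
  have -> : Negz n = Negz n.+1 + 1 by rewrite !NegzE -[n.+2]addn1 PoszD opprD subrK.
  by apply: sA => //; apply: spanD; apply: span_gen; [left | right]; exists 0.
Qed.

Lemma ideal_trivial x : I x -> x = 0.
Proof.
have gw := graded_weight lpar_up lpar_down pH weight_up weight_down weight_diag.
have [f [ws [uw gf f0 ->]]] := all_graded_sum x.
move=> If; rewrite big_seq big1 // => w wws.
apply: (ideal_graded (gf w)).
exact: (ideal_components lpar_up lpar_down pH weight_up weight_down weight_diag ID IZ IB
  uw gf If).
Qed.
End Ideals.
End IdealTheory.

(** * Local nilpotency of [ad e] and [ad Y] *)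

Section Nilpotency.
Variables (K : numFieldType) (L : lieSuperType K).

Definition ad_nil (u x : L) := exists n, ad u n x = 0.

Lemma ad_leq (u x : L) n m : (n <= m)%N -> ad u n x = 0 -> ad u m x = 0.
Proof. by move=> /subnK <- u0; rewrite -adadD u0 ad0. Qed.

Lemma ad_nil0 (u : L) : ad_nil u 0. Proof. by exists 0. Qed.

Lemma ad_nilD (u x y : L) : ad_nil u x -> ad_nil u y -> ad_nil u (x + y).
Proof.
move=> [n ux] [m uy]; exists (n + m)%N.
by rewrite adD (ad_leq (leq_addr m n) ux) (ad_leq (leq_addl n m) uy) addr0.
Qed.

Lemma ad_nilZ (u x : L) c : ad_nil u x -> ad_nil u (c *: x).
Proof. by move=> [n ux]; exists n; rewrite adE ux scaler0. Qed.

(** By the Leibniz rule each application of [ad u] lowers one of the two nilpotency orders. *)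
Lemma ad_nil_br p (u x y : L) : lpar false u -> lpar p x -> ad_nil u x -> ad_nil u y ->
  ad_nil u {[x, y]}.
Proof.
move=> pu px [n ux] [m uy]; exists (n + m)%N.
suff nil k : forall n m x y, (n + m <= k)%N -> lpar p x -> ad u n x = 0 ->
    ad u m y = 0 -> ad u k {[x, y]} = 0 by exact: (nil _ n m).
elim: k => [|k IH] {}n {}m {ux uy px}x {}y.
  by rewrite leqn0 addn_eq0 => /andP[/eqP -> /eqP ->] _ /= -> _; rewrite lbr0l.
move=> nm px; case: n nm => [|n] nm ux; first by rewrite [x]ux lbr0l ad0.
case: m nm => [|m] nm uy; first by rewrite [y]uy lbr0r ad0.
rewrite adSr (jace _ pu px) adD.
have nm1 : (n + m.+1 <= k)%N by rewrite -ltnS -addSn.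
have nm2 : (n.+1 + m <= k)%N by rewrite addSnnS.
have uSx : ad u n {[u, x]} = 0 by rewrite -adSr.
have uSy : ad u m {[u, y]} = 0 by rewrite -adSr.
by rewrite (IH _ _ _ _ nm1 (lpar_br' pu px _) uSx uy) // (IH _ _ _ _ nm2 px ux uSy) addr0.
Qed.

Section Generated.
Variables (mu kap : K) (E1 E2 F1 F2 a b : L).
Hypotheses (S : sl12 E1 E2 F1 F2) (V : level1 mu kap E1 E2 F1 F2 a b).
Hypothesis gen : forall P : bool -> L -> Prop,
  P true E1 -> P true E2 -> P true F1 -> P true F2 -> P true a -> P true b ->
  (forall p, P p 0) -> (forall p x y, P p x -> P p y -> P p (x + y)) ->
  (forall p c x, P p x -> P p (c *: x)) ->
  (forall p p' x y, P p x -> P p' y -> P (addb p p') {[x, y]}) ->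
  forall p x, lpar p x -> P p x.
Local Notation e := {[E1, E2]}.
Local Notation Y := {[F1, F2]}.

Lemma ad_nil_gen u : lpar false u -> ad_nil u E1 -> ad_nil u E2 -> ad_nil u F1 ->
  ad_nil u F2 -> ad_nil u a -> ad_nil u b -> forall x, ad_nil u x.
Proof.
move=> pu nE1 nE2 nF1 nF2 na nb x.
have nil p y : lpar p y -> ad_nil u y.
  move=> py; suff [] : lpar p y /\ ad_nil u y by [].
  apply: (gen (P := fun p y => lpar p y /\ ad_nil u y)) py => {p y}.
  - by split; first exact: oE1 S.
  - by split; first exact: oE2 S.
  - by split; first exact: oF1 S.
  - by split; first exact: oF2 S.
  - by split; first exact: oa V.
  - by split; first exact: ob V.
  - by move=> p; split; [apply: lpar0 | apply: ad_nil0].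
  - by move=> p y z [py ny] [pz nz]; split; [apply: lparD | apply: ad_nilD].
  - by move=> p c y [py ny]; split; [apply: lparZ | apply: ad_nilZ].
  - move=> p p' y z [py ny] [pz nz]; split; first exact: lpar_br.
    exact: (ad_nil_br pu py).
have [x0 [x1 [p0 p1 ->]]] := lpar_split x.
by apply: ad_nilD; [apply: (nil false) | apply: (nil true)].
Qed.

Lemma ad_e_nil x : ad_nil e x.
Proof.
have pE1 := oE1 S; have pE2 := oE2 S; have pa := oa V; have pb := ob V.
have pe : lpar false e by par.
apply: ad_nil_gen => //.
- by exists 1; rewrite /= (eE1 S).
- by exists 1; rewrite /= (eE2 S).
- by exists 2; rewrite /= (eF1 S) lbrNr (eE2 S) oppr0.
- by exists 2; rewrite /= (eF2 S) lbrNr (eE1 S) oppr0.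
(* [ad E2] commutes with [ad e] and turns the element in [e3g] into [{[e, a]}], so the fourth power
   of [ad e] kills [a]. *)
- exists 4; have := congr1 (lbr E2) (e3g V).
  rewrite -/(ad _ _ _) (lbr_ad _ _ pe pE2 (eE2 S)) lbrDr lbrNr (E2al S V) (E2be _ S).
  by rewrite subr0 lbr0r -adSr.
- exists 4; have := congr1 (lbr E1) (e3g V).
  rewrite -/(ad _ _ _) (lbr_ad _ _ pe pE1 (eE1 S)) lbrDr lbrNr (E1be S V) (E1al _ S).
  by rewrite sub0r lbr0r adN -adSr => /eqP; rewrite oppr_eq0 => /eqP.
Qed.

Lemma ad_Y_nil x : ad_nil Y x.
Proof.
have pF1 := oF1 S; have pF2 := oF2 S.
apply: ad_nil_gen; first by par.
- by exists 2; rewrite /= (YE1 S) (YF2 S).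
- by exists 2; rewrite /= (YE2 S) (YF1 S).
- by exists 1; rewrite /= (YF1 S).
- by exists 1; rewrite /= (YF2 S).
- by exists 1; rewrite /= (adY S) (F1a V) (F2a V) (F1w _ S) lbr0r addr0.
- by exists 1; rewrite /= (adY S) (F2b V) (F2w S V) lbr0r addr0.
Qed.
End Generated.
End Nilpotency.

(** * Ideals meeting weight zero trivially, in terms of the original generators *)

Section Presented.
Variables (K : numFieldType) (L : lieSuperType K) (lam t : K) (X Y Z U : L).
Hypothesis t0 : t != 0.
Hypotheses (pX : lpar true X) (pY : lpar false Y) (pZ : lpar true Z) (pU : lpar true U).
Local Notation E1 := (gE1 X U).
Local Notation E2 := (gE2 X U).
Local Notation F1 := (gF1 X Y U).
Local Notation F2 := (gF2 X Y U).
Local Notation a := (ga t X Z U).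
Local Notation b := (gb t X Z U).
Hypothesis S : sl12 E1 E2 F1 F2.
Hypothesis V : level1 (2%:R * lam + 1) (2%:R * (lam - 1) * (lam + 2%:R)) E1 E2 F1 F2 a b.
Hypothesis FF : {[F1, F2]} = Y.
Hypothesis gen : forall P : bool -> L -> Prop,
  P true X -> P false Y -> P true Z -> P true U ->
  (forall p, P p 0) -> (forall p x y, P p x -> P p y -> P p (x + y)) ->
  (forall p c x, P p x -> P p (c *: x)) ->
  (forall p p' x y, P p x -> P p' y -> P (addb p p') {[x, y]}) ->
  forall p x, lpar p x -> P p x.

Let gen6 (P : bool -> L -> Prop) :
  P true E1 -> P true E2 -> P true F1 -> P true F2 -> P true a -> P true b ->
  (forall p, P p 0) -> (forall p x y, P p x -> P p y -> P p (x + y)) ->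
  (forall p c x, P p x -> P p (c *: x)) ->
  (forall p p' x y, P p x -> P p' y -> P (addb p p') {[x, y]}) ->
  forall p x, lpar p x -> P p x.
Proof.
move=> PE1 PE2 PF1 PF2 Pa Pb P0 PD PZ PB.
have XE : X = E1 + E2 by rewrite /gE1 /gE2; lmod.
have UE : U = F1 + (-1) *: F2 by rewrite /gF1 /gF2; lmod.
have ZE : Z = t *: (a + (-1) *: b) by rewrite /ga /gb; lmod.
apply: gen => //.
- by rewrite XE; apply: PD.
- by rewrite -FF; apply: (PB true true).
- by rewrite ZE; apply: (PZ); apply: PD => //; apply: (PZ).
- by rewrite UE; apply: PD => //; apply: PZ.
Qed.

Variable I : L -> Prop.
Hypotheses (ID : forall x y, I x -> I y -> I (x + y)) (IZ : forall c x, I x -> I (c *: x))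
  (IB : forall y x, I x -> I {[y, x]}).
Hypothesis I0 : forall f g, I (cartan_sum E1 E2 F1 F2 (cr lam E1 E2 F2 b) (cq lam E1 E2 F1 a) f g) ->
  cartan_sum E1 E2 F1 F2 (cr lam E1 E2 F2 b) (cq lam E1 E2 F1 a) f g = 0.

Lemma presented_ideal_trivial x : I x -> x = 0.
Proof.
have C := currents_of_level1 S V.
apply: (ideal_trivial C (ad_e_nil S V gen6) (ad_Y_nil S V gen6) _ ID IZ IB I0).
move=> P PE1 PE2 PF1 PF2 Pr Pq P0 PD PZ PB.
apply: gen6 => //.
- rewrite (a_of_currents S V) -scaleN1r; apply: PZ.
  by apply: (PB false true) => //; apply: (PB true true).
- rewrite (b_of_currents S V) -scaleN1r; apply: PZ.
  by apply: (PB false true) => //; apply: (PB true true).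
Qed.
End Presented.

(** * The presented Lie superalgebra *)

HB.instance Definition _ := gen_eqMixin LT.
HB.instance Definition _ := gen_choiceMixin LT.

Section Quotient.
Variable rel : LT -> LT -> Prop.

Definition lcongb (a b : LT) : bool := `[< lcong rel a b >].

Lemma lcongb_refl : reflexive lcongb.
Proof. by move=> a; apply/asboolP; apply: lc_refl. Qed.
Lemma lcongb_sym : symmetric lcongb.
Proof. by move=> a b; apply: asbool_equiv_eq; split; apply: lc_sym. Qed.
Lemma lcongb_trans : transitive lcongb.
Proof.
move=> b a c /asboolP ab /asboolP bc; apply/asboolP.
exact: lc_trans ab bc.
Qed.

Canonical lcong_equiv := EquivRel lcongb lcongb_refl lcongb_sym lcongb_trans.

Definition lquot : Type := {eq_quot lcong_equiv}.
HB.instance Definition _ := Choice.on lquot.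
HB.instance Definition _ := EqQuotient.on lquot.

Definition cls (a : LT) : lquot := \pi_lquot a.

Lemma clsP a b : cls a = cls b <-> lcong rel a b.
Proof.
split=> [/eqP|ab]; first by rewrite eqmodE => /asboolP.
by apply/eqP; rewrite eqmodE; apply/asboolP.
Qed.

Lemma cls_repr (x : lquot) : cls (repr x) = x. Proof. exact: reprK. Qed.
Lemma repr_cls a : lcong rel (repr (cls a)) a. Proof. by apply/clsP; rewrite cls_repr. Qed.

Definition qadd (x y : lquot) := cls (Add (repr x) (repr y)).
Definition qscale (c : C) (x : lquot) := cls (Scale c (repr x)).
Definition qbr (x y : lquot) := cls (Br (repr x) (repr y)).

Lemma qaddE a b : qadd (cls a) (cls b) = cls (Add a b).
Proof. by apply/clsP; apply: lc_Add; apply: repr_cls. Qed.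
Lemma qscaleE c a : qscale c (cls a) = cls (Scale c a).
Proof. by apply/clsP; apply: lc_Scale; apply: repr_cls. Qed.
Lemma qbrE a b : qbr (cls a) (cls b) = cls (Br a b).
Proof. by apply/clsP; apply: lc_Br; apply: repr_cls. Qed.

Lemma cls_ind (P : lquot -> Prop) : (forall a, P (cls a)) -> forall x, P x.
Proof. by move=> Pa x; rewrite -(cls_repr x). Qed.

Lemma qaddA : associative qadd.
Proof.
elim/cls_ind=> a; elim/cls_ind=> b; elim/cls_ind=> c; rewrite !qaddE.
exact/clsP/lc_addA.
Qed.
Lemma qaddC : commutative qadd.
Proof. by elim/cls_ind=> a; elim/cls_ind=> b; rewrite !qaddE; apply/clsP/lc_addC. Qed.
Lemma qadd0 : left_id (cls Zero) qadd.
Proof. by elim/cls_ind=> a; rewrite !qaddE; apply/clsP/lc_add0. Qed.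
Lemma qaddN : left_inverse (cls Zero) (qscale (-1)) qadd.
Proof.
by elim/cls_ind=> a; rewrite qaddC !qscaleE !qaddE; apply/clsP/lc_addN.
Qed.

HB.instance Definition _ := GRing.isZmodule.Build lquot qaddA qaddC qadd0 qaddN.

Lemma qscaleA c d x : qscale c (qscale d x) = qscale (c * d) x.
Proof. by elim/cls_ind: x => a; rewrite !qscaleE; apply/clsP/lc_scaleA. Qed.
Lemma qscale1 : left_id 1 qscale.
Proof. by elim/cls_ind=> a; rewrite !qscaleE; apply/clsP/lc_scale1. Qed.
Lemma qscaleDr : right_distributive qscale +%R.
Proof.
move=> c; elim/cls_ind=> a; elim/cls_ind=> b.
by rewrite /GRing.add /= !(qaddE, qscaleE); apply/clsP/lc_scaleDr.
Qed.
Lemma qscaleDl x : {morph qscale^~ x : c d / c + d}.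
Proof.
move=> c d; elim/cls_ind: x => a.
by rewrite {2}/GRing.add /= !(qaddE, qscaleE); apply/clsP/lc_scaleDl.
Qed.

HB.instance Definition _ :=
  GRing.Zmodule_isLmodule.Build C lquot qscaleA qscale1 qscaleDr qscaleDl.

Lemma clsD a b : cls (Add a b) = cls a + cls b. Proof. by rewrite -qaddE. Qed.
Lemma clsZ c a : cls (Scale c a) = c *: cls a. Proof. by rewrite -qscaleE. Qed.
Lemma cls0 : cls Zero = 0. Proof. by []. Qed.

(** [mpar] assigns a parity to bracket monomials only, so the parity subspaces are spanned by their
    classes. *)
Definition homog (p : bool) (y : lquot) := exists2 a, mpar a = Some p & y = cls a.
Definition qpar (p : bool) : lquot -> Prop := span (homog p).

Lemma qbrDl x y z : qbr (x + y) z = qbr x z + qbr y z.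
Proof.
elim/cls_ind: x => a; elim/cls_ind: y => b; elim/cls_ind: z => c.
by rewrite -clsD !qbrE -clsD; apply/clsP/lc_brDl.
Qed.
Lemma qbrDr x y z : qbr x (y + z) = qbr x y + qbr x z.
Proof.
elim/cls_ind: x => a; elim/cls_ind: y => b; elim/cls_ind: z => c.
by rewrite -clsD !qbrE -clsD; apply/clsP/lc_brDr.
Qed.
Lemma qbrZl k x y : qbr (k *: x) y = k *: qbr x y.
Proof.
elim/cls_ind: x => a; elim/cls_ind: y => b.
by rewrite -clsZ !qbrE -clsZ; apply/clsP/lc_brZl.
Qed.
Lemma qbrZr k x y : qbr x (k *: y) = k *: qbr x y.
Proof.
elim/cls_ind: x => a; elim/cls_ind: y => b.
by rewrite -clsZ !qbrE -clsZ; apply/clsP/lc_brZr.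
Qed.
Lemma qbr0l x : qbr 0 x = 0.
Proof. by have := qbrZl 0 0 x; rewrite !scale0r. Qed.
Lemma qbr0r x : qbr x 0 = 0.
Proof. by have := qbrZr 0 x 0; rewrite !scale0r. Qed.

Lemma ssignE p q : ssign p q = (-1) ^+ (p && q).
Proof. by rewrite /ssign; case: (p && q). Qed.

Lemma homog_br p q x y : homog p x -> homog q y -> homog (addb p q) (qbr x y).
Proof.
by move=> [a pa ->] [b pb ->]; exists (Br a b); rewrite ?qbrE //= pa pb.
Qed.

Lemma qpar_br p q x y : qpar p x -> qpar q y -> qpar (addb p q) (qbr x y).
Proof.
move=> px py; elim: px => {x} [x hx||x x' _ IH _ IH'|c x _ IH].
- elim: py => {y} [y hy||y y' _ IH _ IH'|c y _ IH].
  + by apply: span_gen; apply: homog_br.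
  + by rewrite qbr0r; apply: span0.
  + by rewrite qbrDr; apply: spanD.
  + by rewrite qbrZr; apply: spanZ.
- by rewrite qbr0l; apply: span0.
- by rewrite qbrDl; apply: spanD.
- by rewrite qbrZl; apply: spanZ.
Qed.

Lemma qbr_anti p q x y : qpar p x -> qpar q y ->
  qbr x y = - ((-1) ^+ (p && q) *: qbr y x).
Proof.
rewrite -ssignE => px py; elim: px => {x} [x [a pa ->]||x x' _ IH _ IH'|c x _ IH].
- elim: py => {y} [y [b pb ->]||y y' _ IH _ IH'|c y _ IH].
  + by rewrite !qbrE -scaleNr -clsZ; apply/clsP/lc_anti.
  + by rewrite qbr0l qbr0r scaler0 oppr0.
  + by rewrite qbrDr qbrDl IH IH' scalerDr opprD.
  + by rewrite qbrZr qbrZl IH scalerN !scalerA mulrC.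
- by rewrite qbr0l qbr0r scaler0 oppr0.
- by rewrite qbrDr qbrDl IH IH' scalerDr opprD.
- by rewrite qbrZr qbrZl IH scalerN !scalerA mulrC.
Qed.

Lemma qbr_jacobi p q r x y z : qpar p x -> qpar q y -> qpar r z ->
  qbr x (qbr y z) = qbr (qbr x y) z + (-1) ^+ (p && q) *: qbr y (qbr x z).
Proof.
rewrite -ssignE => px py pz; elim: px => {x} [x [a pa ->]||x x' _ IH _ IH'|c x _ IH].
- elim: py => {y} [y [b pb ->]||y y' _ IH _ IH'|c y _ IH].
  + elim: pz => {z} [z [c pc ->]||z z' _ IH _ IH'|c z _ IH].
    * by rewrite !qbrE -clsZ -clsD; apply/clsP/(lc_jacobi _ pa pb pc).
    * by rewrite !qbr0r scaler0 addr0.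
    * by rewrite !qbrDr IH IH' scalerDr addrACA.
    * by rewrite !qbrZr IH scalerDr !scalerA mulrC.
  + by rewrite !(qbr0r, qbr0l) scaler0 addr0.
  + by rewrite !(qbrDr, qbrDl) IH IH' scalerDr addrACA.
  + by rewrite !(qbrZr, qbrZl) IH scalerDr !scalerA mulrC.
- by rewrite !(qbr0r, qbr0l) scaler0 addr0.
- by rewrite !(qbrDr, qbrDl) IH IH' scalerDr addrACA.
- by rewrite !(qbrZr, qbrZl) IH scalerDr !scalerA mulrC.
Qed.

Lemma qpar_split x : exists x0 x1, [/\ qpar false x0, qpar true x1 & x = x0 + x1].
Proof.
elim/cls_ind: x => a; elim: a => [g||a [a0 [a1 [p0 p1 ea]]] b [b0 [b1 [q0 q1 eb]]]
  |c a [a0 [a1 [p0 p1 ea]]]|a [a0 [a1 [p0 p1 ea]]] b [b0 [b1 [q0 q1 eb]]]].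
- case: (boolP (gpar g)) => pg.
    exists 0, (cls (Gen g)); split; rewrite ?add0r //; first exact: span0.
    by apply: span_gen; exists (Gen g) => //=; rewrite pg.
  exists (cls (Gen g)), 0; split; rewrite ?addr0 //; last exact: span0.
  by apply: span_gen; exists (Gen g) => //=; rewrite (negPf pg).
- by exists 0, 0; split; rewrite ?addr0 //; apply: span0.
- exists (a0 + b0), (a1 + b1); split; [exact: spanD|exact: spanD|].
  by rewrite clsD ea eb addrACA.
- exists (c *: a0), (c *: a1); split; [exact: spanZ|exact: spanZ|].
  by rewrite clsZ ea scalerDr.
- exists (qbr a0 b0 + qbr a1 b1), (qbr a0 b1 + qbr a1 b0); split.
  + by apply: spanD; [apply: (qpar_br p0 q0) | apply: (qpar_br p1 q1)].
  + by apply: spanD; [apply: (qpar_br p0 q1) | apply: (qpar_br p1 q0)].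
  + rewrite -qbrE ea eb !(qbrDl, qbrDr) -!addrA; congr (_ + _).
    by rewrite [RHS]addrC -addrA.
Qed.

HB.instance Definition _ := isLieSuper.Build C lquot qbrDl qbrDr qbrZl qbrZr
  (fun p => span0 (homog p)) (fun p => @spanD _ _ (homog p)) (fun p => @spanZ _ _ (homog p))
  qpar_br qbr_anti qbr_jacobi qpar_split.

End Quotient.

(** * Differential operators *)

Definition op_linear (A : op) := forall c u v, A (c *: u + v) = c *: A u + A v.

Definition flip (v : V) : V := (v.1, - v.2).
(** Homogeneity is tested against the automorphism sending theta to [- theta]; [op_par_evod] relates
    this to the components [ev] and [od] used by [sbr]. *)
Definition op_par (p : bool) (A : op) := forall v, A (flip v) = (-1) ^+ p *: flip (A v).

Lemma opaddE A B v : opadd A B v = A v + B v. Proof. by []. Qed.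
Lemma opscaleE c A v : opscale c A v = c *: A v. Proof. by []. Qed.
Lemma sbrE A B v : sbr A B v = A (B v) -
  (ev B (ev A v) + od B (ev A v) + ev B (od A v) - od B (od A v)).
Proof. by []. Qed.

Section Linear.
Variable A : op.
Hypothesis lA : op_linear A.
Lemma op_linD u v : A (u + v) = A u + A v.
Proof. by have := lA 1 u v; rewrite !scale1r. Qed.
Lemma op_lin0 : A 0 = 0.
Proof. by apply: (@addrI _ (A 0)); rewrite -op_linD !addr0. Qed.
Lemma op_linZ c u : A (c *: u) = c *: A u.
Proof. by have := lA c u 0; rewrite op_lin0 !addr0. Qed.
Lemma op_linN u : A (- u) = - A u.
Proof. by rewrite -scaleN1r op_linZ scaleN1r. Qed.

Lemma ev_lin : op_linear (ev A).
Proof.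
move=> c u v; rewrite /ev /mkV.
have -> : ((c *: u + v).1, 0) = c *: ((u.1, 0) : V) + (v.1, 0).
  by congr pair; rewrite /= scaler0 addr0.
have -> : (0, (c *: u + v).2) = c *: ((0, u.2) : V) + (0, v.2).
  by congr pair; rewrite /= scaler0 addr0.
by rewrite !lA.
Qed.

Lemma od_lin : op_linear (od A).
Proof.
move=> c u v; rewrite /od /mkV.
have -> : ((c *: u + v).1, 0) = c *: ((u.1, 0) : V) + (v.1, 0).
  by congr pair; rewrite /= scaler0 addr0.
have -> : (0, (c *: u + v).2) = c *: ((0, u.2) : V) + (0, v.2).
  by congr pair; rewrite /= scaler0 addr0.
by rewrite !lA.
Qed.

Lemma ev_od v : A v = ev A v + od A v.
Proof.
have -> : A v = A (v.1, 0) + A (0, v.2).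
  by rewrite -op_linD; congr A; rewrite [v in LHS]surjective_pairing; congr pair;
     rewrite /= ?addr0 ?add0r.
by rewrite /ev /od [LHS]surjective_pairing /mkV; congr pair => //=; rewrite addrC.
Qed.

Lemma half0 (p : {poly C}) : p = - p -> p = 0.
Proof.
move/eqP; rewrite -subr_eq0 opprK -mulr2n -scaler_nat scaler_eq0 pnatr_eq0 /=.
by move/eqP.
Qed.

(** The component of the wrong parity equals its own negative. *)
Lemma op_par_evod p : op_par p A -> forall v,
  ev A v = (if p then 0 else A v) /\ od A v = (if p then A v else 0).
Proof.
move=> pA v.
have h1 : A (v.1, 0) = (-1) ^+ p *: flip (A (v.1, 0)).
  by rewrite -pA /flip oppr0.
have h2 : A (0, v.2) = - ((-1) ^+ p *: flip (A (0, v.2))).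
  by rewrite -pA -op_linN; congr A; rewrite /flip /=; congr pair; rewrite ?opprK ?oppr0.
have := ev_od v; case: p pA h1 h2 => pA; rewrite ?scaleN1r ?scale1r ?opprK => h1 h2 ->.
  have e0 : ev A v = 0.
    rewrite /ev /mkV; congr pair; apply: half0.
      by rewrite {1}h1.
    by rewrite {1}h2.
  by rewrite e0 add0r.
have e0 : od A v = 0.
  rewrite /od /mkV; congr pair; apply: half0.
    by rewrite {1}h2.
  by rewrite {1}h1.
by rewrite e0 addr0.
Qed.
End Linear.

Lemma sbr_par p q A B v : op_linear A -> op_linear B -> op_par p A -> op_par q B ->
  sbr A B v = A (B v) - ssign p q *: B (A v).
Proof.
move=> lA lB pA pB; rewrite sbrE.
have eA u := (op_par_evod lA pA u).1; have oA u := (op_par_evod lA pA u).2.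
have eB u := (op_par_evod lB pB u).1; have oB u := (op_par_evod lB pB u).2.
rewrite !(eA, oA, eB, oB).
by case: (p); case: (q); rewrite /ssign /= ?(op_lin0 lA) ?(op_lin0 lB) ?addr0 ?add0r ?subr0
  ?scale1r ?scaleN1r.
Qed.

Lemma sbr_lin A B : op_linear A -> op_linear B -> op_linear (sbr A B).
Proof.
move=> lA lB c u v; rewrite !sbrE.
rewrite lB lA !(ev_lin lA) !(od_lin lA) !(ev_lin lB) !(od_lin lB).
by lmod_over C.
Qed.

Lemma flipB c u v : flip (u - c *: v) = flip u - c *: flip v.
Proof. by congr pair => /=; rewrite scalerN opprD. Qed.

Lemma sbr_op_par p q A B : op_linear A -> op_linear B -> op_par p A -> op_par q B ->
  op_par (addb p q) (sbr A B).
Proof.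
move=> lA lB pA pB v; rewrite !(sbr_par _ lA lB pA pB).
rewrite pA pB (op_linZ lA) (op_linZ lB) pA pB flipB scalerBr signr_addb !scalerA.
by congr (_ *: _ - _ *: _); ring.
Qed.

Lemma deriv_one : (1 : {poly C})^`() = 0.
Proof. exact: derivC. Qed.

Ltac poly_op :=
  congr pair; rewrite /ssign /=;
  repeat rewrite !(derivB, derivD, derivN, derivZ, derivM, derivX, derivXn, deriv0,
    deriv_one) /=;
  rewrite -?mul_polyC ?(polyCN, polyCB, polyCD, polyCM, polyC_exp, polyC_natr, polyC1);
  ring.

(** * Soundness: the operators satisfy the Lie superalgebra axioms and the relations *)

Section Evaluation.
Variables lam t : C.
Local Notation eval := (eval lam t).

Lemma eval_X v : eval tX v = ('X * v.2, 'X * v.1^`() - lam *: v.1).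
Proof.
by congr pair; rewrite /= ?scaler0 ?mulr0 ?addr0 // add0r scaleNr.
Qed.
Lemma eval_Y v : eval tY v = (v.1^`(), v.2^`()). Proof. by []. Qed.
Lemma eval_Z v : eval tZ v = (t *: v.2^`(), - (t *: v.1^`()^`())).
Proof.
by congr pair; rewrite /= ?deriv0 ?scaler0 ?addr0 ?add0r // scaleN1r scalerN.
Qed.
Lemma eval_U v : eval tU v = (v.2, - v.1^`()).
Proof. by congr pair; rewrite /= ?scaler0 ?addr0 ?add0r // scaleN1r. Qed.

Lemma eval_lin a : op_linear (eval a).
Proof.
elim: a => [[]||a la b lb|k a la|a la b lb].
- move=> c u v; rewrite !eval_X; congr pair; rewrite /= ?derivD ?derivZ.
    by rewrite mulrDr -scalerAr.
  by rewrite mulrDr -scalerAr; lmod_over C.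
- by move=> c u v; rewrite !eval_Y; congr pair; rewrite /= derivD derivZ.
- move=> c u v; rewrite !eval_Z; congr pair; rewrite /= !(derivD, derivZ) scalerDr !scalerA.
    by rewrite mulrC.
  by rewrite opprD scalerN scalerA mulrC.
- move=> c u v; rewrite !eval_U; congr pair; rewrite /= ?derivD ?derivZ //.
  by rewrite opprD scalerN.
- by move=> c u v; rewrite /= /op0 /mkV scaler0 addr0.
- by move=> c u v; rewrite /= !opaddE la lb scalerDr addrACA.
- by move=> c u v; rewrite /= !opscaleE la scalerDr !scalerA mulrC.
- exact: sbr_lin.
Qed.

Lemma gpar_eval g : op_par (gpar g) (eval (Gen g)).
Proof.
case: g => v; rewrite /gpar ?expr1 ?expr0 ?scaleN1r ?scale1r /flip.
- rewrite !eval_X; congr pair; rewrite /= ?opprK //.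
  by rewrite mulrN.
- by rewrite !eval_Y; congr pair; rewrite /= derivN.
- rewrite !eval_Z; congr pair; rewrite /= ?opprK //.
  by rewrite derivN scalerN.
- by rewrite !eval_U; congr pair; rewrite /= ?opprK.
Qed.

Lemma mpar_eval a p : mpar a = Some p -> op_par p (eval a).
Proof.
elim: a p => //= [g|a IHa b IHb] p.
  by case=> <-; apply: gpar_eval.
case pa: (mpar a) => [pa'|] //; case pb: (mpar b) => [pb'|] // [<-].
by apply: sbr_op_par; [apply: eval_lin | apply: eval_lin | apply: IHa | apply: IHb].
Qed.

Lemma eval_Br p q a b v : mpar a = Some p -> mpar b = Some q ->
  eval (Br a b) v = eval a (eval b v) - ssign p q *: eval b (eval a v).
Proof.
move=> pa pb; apply: sbr_par; try exact: eval_lin; exact: mpar_eval.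
Qed.

Lemma ev_add A B v : ev (opadd A B) v = ev A v + ev B v. Proof. by []. Qed.
Lemma od_add A B v : od (opadd A B) v = od A v + od B v. Proof. by []. Qed.
Lemma ev_scale c A v : ev (opscale c A) v = c *: ev A v. Proof. by []. Qed.
Lemma od_scale c A v : od (opscale c A) v = c *: od A v. Proof. by []. Qed.

Lemma lcong_sound (rel : LT -> LT -> Prop) :
  (forall l r, rel l r -> eval l = eval r) ->
  forall a b, lcong rel a b -> eval a = eval b.
Proof.
move=> rel_sound a b; elim=> {a b} //=.
- by move=> a b c _ -> _ ->.
- by move=> a a' b b' _ -> _ ->.
- by move=> k a a' _ ->.
- by move=> a a' b b' _ -> _ ->.
- by move=> a b c; apply: funext => v; rewrite !opaddE addrA.
- by move=> a b; apply: funext => v; rewrite !opaddE addrC.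
- by move=> a; apply: funext => v; rewrite !opaddE add0r.
- by move=> a; apply: funext => v; rewrite !opaddE opscaleE scaleN1r subrr.
- by move=> a; apply: funext => v; rewrite opscaleE scale1r.
- by move=> k l a; apply: funext => v; rewrite !opscaleE scalerA.
- by move=> k l a; apply: funext => v; rewrite !(opaddE, opscaleE) scalerDl.
- by move=> k a b; apply: funext => v; rewrite !(opaddE, opscaleE) scalerDr.
- move=> a b c; apply: funext => v; rewrite !(opaddE, sbrE).
  rewrite !(ev_add, od_add) !(op_linD (ev_lin (eval_lin c))) !(op_linD (od_lin (eval_lin c))).
  by lmod_over C.
- move=> a b c; apply: funext => v; rewrite !(opaddE, sbrE).
  by rewrite !(ev_add, od_add) !(op_linD (eval_lin a)); lmod_over C.
- move=> k a b; apply: funext => v; rewrite !(opscaleE, sbrE).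
  rewrite !(ev_scale, od_scale) !(op_linZ (ev_lin (eval_lin b))) !(op_linZ (od_lin (eval_lin b))).
  by lmod_over C.
- move=> k a b; apply: funext => v; rewrite !(opscaleE, sbrE).
  by rewrite !(ev_scale, od_scale) !(op_linZ (eval_lin a)); lmod_over C.
- move=> a b p q pa pb; apply: funext => v; rewrite opscaleE.
  rewrite -/(eval (Br a b)) -/(eval (Br b a)) (eval_Br _ pa pb) (eval_Br _ pb pa).
  by rewrite /ssign andbC; case: (q && p); lmod_over C.
- move=> a b c p q r pa pb pc; apply: funext => v.
  have pbc : mpar (Br b c) = Some (addb q r) by rewrite /= pb pc.
  have pac : mpar (Br a c) = Some (addb p r) by rewrite /= pa pc.
  have pab : mpar (Br a b) = Some (addb p q) by rewrite /= pa pb.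
  rewrite !(opaddE, opscaleE).
  rewrite -/(eval (Br a (Br b c))) -/(eval (Br (Br a b) c)) -/(eval (Br b (Br a c))).
  rewrite (eval_Br _ pa pbc) (eval_Br _ pab pc) (eval_Br _ pb pac).
  rewrite !(eval_Br _ pa pb) !(eval_Br _ pb pc) !(eval_Br _ pa pc).
  rewrite !(op_linD (eval_lin _)) !(op_linN (eval_lin _)) !(op_linZ (eval_lin _)).
  by rewrite /ssign; case: p q r {pa pb pc pab pac pbc} => [] [] []; rewrite /=;
     lmod_over C.
Qed.

(** The parities are computed from the terms, so rewriting with a concrete bracket leaves a side
    condition that holds by reduction. *)
Lemma eval_BrE a b v : mpar a && mpar b ->
  eval (Br a b) v = eval a (eval b v)
    - ssign (odflt false (mpar a)) (odflt false (mpar b)) *: eval b (eval a v).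
Proof.
case pa: (mpar a) => [p|] //; case pb: (mpar b) => [q|] // _.
exact: eval_Br.
Qed.

(** The closed forms of [tZi i] are obtained one from another by a single bracket with [X]; the
    chain ends with [eval_Z7]. *)
Lemma eval_Z1 v : eval (tZi 1) v =
  (t *: (- (lam - 1) *: v.1^`()),
   t *: (- (lam + 2%:R) *: v.2^`())).
Proof. by rewrite eval_BrE // !(eval_Z, eval_X); poly_op. Qed.

Lemma eval_Z2 v : eval (tZi 2) v =
  (t *: (- 3%:R *: ('X * v.2^`()) + (lam - 1) *: v.2),
   t *: (3%:R *: ('X * v.1^`()^`()) - (2%:R * (lam - 1)) *: v.1^`())).
Proof. by rewrite eval_BrE // !(eval_Z1, eval_X); poly_op. Qed.

Lemma eval_Z3 v : eval (tZi 3) v =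
  (t *: ((2%:R * (lam - 1)) *: ('X * v.1^`()) - (lam * (lam - 1)) *: v.1),
   t *: ((2%:R * (lam + 2%:R)) *: ('X * v.2^`()) - ((lam + 2%:R) * (lam - 1)) *: v.2)).
Proof. by rewrite eval_BrE // !(eval_Z2, eval_X); poly_op. Qed.

Lemma eval_Z4 v : eval (tZi 4) v =
  (t *: (6%:R *: ('X^2 * v.2^`()) - (4%:R * (lam - 1)) *: ('X * v.2)),
   t *: (- 6%:R *: ('X^2 * v.1^`()^`()) + (8%:R * (lam - 1)) *: ('X * v.1^`())
     - (2%:R * lam * (lam - 1)) *: v.1)).
Proof. by rewrite eval_BrE // !(eval_Z3, eval_X); poly_op. Qed.

Lemma eval_Z5 v : eval (tZi 5) v =
  (t *: (- (2%:R * (lam - 1)) *: ('X^2 * v.1^`()) + (2%:R * lam * (lam - 1)) *: ('X * v.1)),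
   t *: (- (2%:R * (lam + 2%:R)) *: ('X^2 * v.2^`())
     + (2%:R * (lam + 2%:R) * (lam - 1)) *: ('X * v.2))).
Proof. by rewrite eval_BrE // !(eval_Z4, eval_X); poly_op. Qed.

Lemma eval_Z6 v : eval (tZi 6) v =
  (t *: (- 6%:R *: ('X^3 * v.2^`()) + (6%:R * (lam - 1)) *: ('X^2 * v.2)),
   t *: (6%:R *: ('X^3 * v.1^`()^`()) - (12%:R * (lam - 1)) *: ('X^2 * v.1^`())
     + (6%:R * lam * (lam - 1)) *: ('X * v.1))).
Proof. by rewrite eval_BrE // !(eval_Z5, eval_X); poly_op. Qed.

Lemma eval_Z7 v : eval (tZi 7) v = 0.
Proof. by rewrite eval_BrE // !(eval_Z6, eval_X); poly_op. Qed.

Lemma eval_Y1 v : eval (tYi 1) v =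
  (- v.2, - v.1^`()).
Proof. by rewrite eval_BrE // !(eval_Y, eval_X); poly_op. Qed.

Lemma eval_Y2 v : eval (tYi 2) v =
  (- 2%:R *: ('X * v.1^`()) + lam *: v.1, - 2%:R *: ('X * v.2^`()) + (lam - 1) *: v.2).
Proof. by rewrite eval_BrE // !(eval_Y1, eval_X); poly_op. Qed.

Lemma eval_XX v : eval (Br tX tX) v =
  (2%:R *: ('X^2 * v.1^`()) - (2%:R * lam) *: ('X * v.1),
   2%:R *: ('X^2 * v.2^`()) - (2%:R * (lam - 1)) *: ('X * v.2)).
Proof. by rewrite eval_BrE // !eval_X; poly_op. Qed.

Lemma eval_XU v : eval (Br tX tU) v =
  (- lam *: v.1, - (lam + 1) *: v.2).
Proof. by rewrite eval_BrE // !(eval_X, eval_U); poly_op. Qed.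

Lemma eval_UZ v : eval (Br tU tZ) v =
  (t *: (- 2%:R *: v.1^`()^`()),
   t *: (- 2%:R *: v.2^`()^`())).
Proof. by rewrite eval_BrE // !(eval_U, eval_Z); poly_op. Qed.

Lemma eval_ZZ v : eval (Br tZ tZ) v =
  (t ^+ 2 *: (- 2%:R *: v.1^`()^`()^`()),
   t ^+ 2 *: (- 2%:R *: v.2^`()^`()^`())).
Proof. by rewrite eval_BrE // !eval_Z; poly_op. Qed.

Lemma eval_ZZ3 v : eval (Br tZ (tZi 3)) v =
  (t ^+ 2 *: (6%:R *: ('X * v.2^`()^`()) + 6%:R *: v.2^`()),
   t ^+ 2 *: (6%:R *: ('X * v.1^`()^`()^`()) - (6%:R * (lam - 1)) *: v.1^`()^`())).
Proof. by rewrite eval_BrE // !(eval_Z, eval_Z3); poly_op. Qed.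

Lemma eval_Z1Z2 v : eval (Br (tZi 1) (tZi 2)) v =
  (t ^+ 2 *: (- 9%:R *: ('X * v.2^`()^`()) + (6%:R * (lam - 1)) *: v.2^`()),
   t ^+ 2 *: (- 9%:R *: ('X * v.1^`()^`()^`()) + (3%:R * (lam - 4%:R)) *: v.1^`()^`())).
Proof. by rewrite eval_BrE // !(eval_Z1, eval_Z2); poly_op. Qed.

Lemma relations_sound l r : rels lam t l r -> eval l = eval r.
Proof.
have evA a b v : eval (Add a b) v = eval a v + eval b v by [].
have evZ c a v : eval (Scale c a) v = c *: eval a v by [].
have ev0 v : eval Zero v = 0 by [].
pose evE := (evA, evZ, ev0, eval_Y1, eval_Y2, eval_XU, eval_X, eval_Y, eval_Z, eval_U,
  eval_Z1, eval_Z2, eval_Z3, eval_UZ, eval_ZZ, eval_XX).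
suff sound : List.Forall (fun p => forall v, eval p.1 v = eval p.2 v) (relations lam t).
  by move=> /(proj1 (List.Forall_forall _ _) sound) lr; apply: funext => v; apply: lr.
rewrite /relations; repeat apply: List.Forall_cons; last exact: List.Forall_nil.
all: move=> v; rewrite [X in eval X v]/fst [X in _ = eval X v]/snd.
- by rewrite eval_BrE // !evE; poly_op.
- by rewrite eval_BrE // !evE; poly_op.
- by rewrite eval_BrE // !evE; poly_op.
- by rewrite eval_BrE // !evE; poly_op.
- by rewrite eval_BrE // !evE; poly_op.
- by rewrite eval_BrE // !evE; poly_op.
- by rewrite eval_BrE // !evE; poly_op.
- by rewrite eval_BrE // !evE; poly_op.
- by rewrite eval_BrE // !evE; poly_op.
- by rewrite eval_BrE // !evE; poly_op.
- by rewrite eval_Z7.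
- by rewrite eval_BrE // !evE; poly_op.
- by rewrite !evE !eval_BrE // !evE; poly_op.
- by rewrite eval_BrE // !evE; poly_op.
- by rewrite evA !evZ eval_ZZ3 eval_Z1Z2 eval_Z; poly_op.
- by rewrite eval_BrE // !evE; poly_op.
- by rewrite eval_BrE // !evE; poly_op.
- by rewrite eval_BrE // !evE; poly_op.
- by rewrite eval_BrE // !evE; poly_op.
Qed.
End Evaluation.

(** * Faithfulness *)

Section Representation.
Variables lam t : C.
Local Notation L := (lquot (rels lam t)).
Local Notation eval := (eval lam t).

Definition rho (x : L) : op := eval (repr x).

Lemma rho_cls a : rho (cls (rels lam t) a) = eval a.
Proof.
rewrite /rho; apply: (@lcong_sound lam t (rels lam t)); last exact: repr_cls.
exact: relations_sound.
Qed.

Lemma rhoD x y v : rho (x + y) v = rho x v + rho y v.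
Proof. by elim/cls_ind: x => a; elim/cls_ind: y => b; rewrite -clsD !rho_cls. Qed.
Lemma rhoZ c x v : rho (c *: x) v = c *: rho x v.
Proof. by elim/cls_ind: x => a; rewrite -clsZ !rho_cls. Qed.
Lemma rho0 v : rho 0 v = 0.
Proof. by rewrite -(cls0 (rels lam t)) rho_cls. Qed.
Lemma rhoN x v : rho (- x) v = - rho x v.
Proof. by rewrite -scaleN1r rhoZ scaleN1r. Qed.
Lemma rho_sum I (s : seq I) (P : pred I) (F : I -> L) v :
  rho (\sum_(i <- s | P i) F i) v = \sum_(i <- s | P i) rho (F i) v.
Proof. exact: (big_morph (fun x => rho x v) (fun x y => rhoD x y v) (rho0 v)). Qed.

Lemma lbr_cls a b : {[cls (rels lam t) a, cls (rels lam t) b]} = cls (rels lam t) (Br a b).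
Proof. exact: qbrE. Qed.

Lemma rho_lbr x y : rho {[x, y]} = sbr (rho x) (rho y).
Proof. by elim/cls_ind: x => a; elim/cls_ind: y => b; rewrite lbr_cls !rho_cls. Qed.

Lemma rho_lin x : op_linear (rho x). Proof. exact: eval_lin. Qed.

Lemma rho_par p (x : L) : lpar p x -> op_par p (rho x).
Proof.
move=> px; elim: px => {x} [x [a pa ->]||x y _ IHx _ IHy|c x _ IH] v.
- by rewrite rho_cls; apply: mpar_eval.
- by rewrite !rho0 /flip oppr0 scaler0.
- by rewrite !rhoD IHx IHy -scalerDr; congr (_ *: _); congr pair; rewrite /= opprD.
- by rewrite !rhoZ IH !scalerA mulrC -scalerA; congr (_ *: _); congr pair; rewrite /= scalerN.
Qed.

Lemma rho_br p q (x y : L) v : lpar p x -> lpar q y ->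
  rho {[x, y]} v = rho x (rho y v) - ssign p q *: rho y (rho x v).
Proof.
move=> px py; rewrite rho_lbr; apply: sbr_par; try exact: rho_lin; exact: rho_par.
Qed.

Local Notation X := (cls (rels lam t) tX).
Local Notation Y := (cls (rels lam t) tY).
Local Notation Z := (cls (rels lam t) tZ).
Local Notation U := (cls (rels lam t) tU).

Lemma lpar_gen g : lpar (gpar g) (cls (rels lam t) (Gen g)).
Proof. by apply: span_gen; exists (Gen g). Qed.

Lemma lquot_gen (P : bool -> L -> Prop) :
  P true X -> P false Y -> P true Z -> P true U ->
  (forall p, P p 0) -> (forall p x y, P p x -> P p y -> P p (x + y)) ->
  (forall p c x, P p x -> P p (c *: x)) ->
  (forall p p' x y, P p x -> P p' y -> P (addb p p') {[x, y]}) ->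
  forall p x, lpar p x -> P p x.
Proof.
move=> PX PY PZ PU P0 PD PSc PB p x px.
elim: px => {x} [x [a pa ->]||x y _ IHx _ IHy|c x _ IH]; last 3 first.
- exact: P0.
- exact: PD.
- exact: PSc.
elim: a p pa => //= [g|a IHa b IHb] p.
  by case=> <-; case: g.
case pa: (mpar a) => [pa'|] //; case pb: (mpar b) => [pb'|] // [<-].
by rewrite -lbr_cls; apply: PB; [apply: IHa | apply: IHb].
Qed.

Section ClosedForms.
Hypothesis t0 : t != 0.

Let pX : lpar true X := lpar_gen gX.
Let pY : lpar false Y := lpar_gen gY.
Let pZ : lpar true Z := lpar_gen gZ.
Let pU : lpar true U := lpar_gen gU.

(** The default pair makes the statement true for every index, so [quot_rel] needs no bound; its
    argument is a position in [relations], counted from 0. *)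
Lemma cls_rel i : let lr := List.nth i (relations lam t) (Zero, Zero) in
  cls (rels lam t) lr.1 = cls (rels lam t) lr.2.
Proof.
move=> lr; apply/clsP.
have [lt_i|le_i] := ltnP i (List.length (relations lam t)).
  by apply: lc_rel; rewrite /rels -surjective_pairing; apply: List.nth_In; apply/ssrnat.ltP.
by rewrite /lr List.nth_overflow; [apply: lc_refl | apply/ssrnat.leP].
Qed.

Ltac quot_rel i := rewrite /= ?lbr_cls -?clsZ -?clsD -?cls0; exact: (cls_rel i).

Lemma quot_sl12 : sl12 (gE1 X U) (gE2 X U) (gF1 X Y U) (gF2 X Y U).
Proof.
apply: sl12_of_relations => //.
- quot_rel 0%N.
- quot_rel 1%N.
- quot_rel 2%N.
- quot_rel 4%N.
- quot_rel 5%N.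
- quot_rel 6%N.
- quot_rel 7%N.
Qed.

Lemma quot_FF : {[gF1 X Y U, gF2 X Y U]} = Y.
Proof.
apply: gFF => //.
- quot_rel 0%N.
- quot_rel 1%N.
- quot_rel 4%N.
- quot_rel 5%N.
Qed.

Lemma quot_level1 : level1 (2%:R * lam + 1) (2%:R * (lam - 1) * (lam + 2%:R))
  (gE1 X U) (gE2 X U) (gF1 X Y U) (gF2 X Y U) (ga t X Z U) (gb t X Z U).
Proof.
apply: level1_of_relations => //.
- quot_rel 0%N.
- quot_rel 1%N.
- quot_rel 2%N.
- quot_rel 4%N.
- quot_rel 5%N.
- quot_rel 6%N.
- quot_rel 7%N.
- quot_rel 8%N.
- quot_rel 9%N.
- quot_rel 10%N.
- quot_rel 11%N.
- quot_rel 12%N.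
- quot_rel 13%N.
- quot_rel 14%N.
- quot_rel 15%N.
- quot_rel 16%N.
Qed.

Local Notation E1 := (gE1 X U).
Local Notation E2 := (gE2 X U).
Local Notation F1 := (gF1 X Y U).
Local Notation F2 := (gF2 X Y U).
Local Notation a := (ga t X Z U).
Local Notation b := (gb t X Z U).

Let S := quot_sl12.
Let V := quot_level1.
Let pE1 := oE1 S. Let pE2 := oE2 S. Let pF1 := oF1 S. Let pF2 := oF2 S.
Let pa := oa V. Let pb := ob V.

(** In contrast to [poly_op], products of ['X] with derivatives are kept as atoms of a linear
    combination, so that inverse scalars such as [t^-1] are settled by [field]. *)
Ltac poly_lin :=
  congr pair; rewrite /ssign /=;
  repeat rewrite !(derivB, derivD, derivN, derivZ, derivM, derivX, derivXn, deriv0,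
    deriv_one) /=;
  repeat rewrite !(mulrDr, mulrN, mulNr, scaler0, mul0r, mulr0, mul1r, mulr1,
    =^~ scalerAr, =^~ scalerAl, =^~ mulrA, expr2);
  lmod_over C.

Lemma rho_E1 v : rho E1 v = (0, 'X * v.1^`() - lam *: v.1).
Proof.
rewrite /gE1 rhoZ rhoD rhoN !lbr_cls !rho_cls eval_BrE // !(eval_XU, eval_X).
by poly_lin.
Qed.

Lemma rho_E2 v : rho E2 v = ('X * v.2, 0).
Proof.
rewrite /gE2 rhoZ rhoD !lbr_cls !rho_cls eval_BrE // !(eval_XU, eval_X).
by poly_lin.
Qed.

Lemma rho_F1 v : rho F1 v = (v.2, 0).
Proof. by rewrite /gF1 rhoZ rhoD rhoN !lbr_cls !rho_cls !(eval_Y1, eval_U); poly_lin. Qed.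

Lemma rho_F2 v : rho F2 v = (0, v.1^`()).
Proof. by rewrite /gF2 rhoN rhoZ rhoD !lbr_cls !rho_cls !(eval_Y1, eval_U); poly_lin. Qed.

Lemma rho_a v : rho a v = (v.2^`(), 0).
Proof.
rewrite /ga rhoZ rhoD !lbr_cls !rho_cls eval_BrE // !(eval_XU, eval_Z).
by poly_lin.
Qed.

Lemma rho_b v : rho b v = (0, v.1^`()^`()).
Proof.
rewrite /gb rhoZ rhoD rhoN !lbr_cls !rho_cls eval_BrE // !(eval_XU, eval_Z).
by poly_lin.
Qed.

Lemma rho_e v : rho {[E1, E2]} v =
  ('X * ('X * v.1^`()) - lam *: ('X * v.1), 'X * ('X * v.2^`()) + (1 - lam) *: ('X * v.2)).
Proof. by rewrite (rho_br _ pE1 pE2) !(rho_E1, rho_E2); poly_lin. Qed.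

Lemma rho_al v : rho {[E1, a]} v =
  ((1 - lam) *: v.1^`() + 'X * v.1^`()^`(), 'X * v.2^`()^`() - lam *: v.2^`()).
Proof. by rewrite (rho_br _ pE1 pa) !(rho_E1, rho_a); poly_lin. Qed.

Lemma rho_be v : rho {[E2, b]} v =
  ('X * v.1^`()^`(), 2%:R *: v.2^`() + 'X * v.2^`()^`()).
Proof. by rewrite (rho_br _ pE2 pb) !(rho_E2, rho_b); poly_lin. Qed.

Let pe : lpar false {[E1, E2]} := pe S.
Let pal : lpar false {[E1, a]}. Proof. by par. Qed.
Let pbe : lpar false {[E2, b]}. Proof. by par. Qed.

Local Notation r := (cr lam E1 E2 F2 b).
Local Notation q := (cq lam E1 E2 F1 a).

Lemma rho_r v : rho r v = (2%:R^-1 *: ('X * ('X * v.1^`()^`())),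
  2%:R^-1 *: ('X * ('X * v.2^`()^`())) + 'X * v.2^`()).
Proof.
rewrite /cr rhoN rhoZ rhoD rhoZ (rho_br _ pe pbe) (rho_br _ pE2 pF2).
by rewrite !(rho_e, rho_be, rho_E2, rho_F2); poly_lin.
Qed.

Lemma rho_q v : rho q v =
  (2%:R^-1 *: ('X * ('X * v.1^`()^`()) + (lam - lam ^+ 2) *: v.1),
   2%:R^-1 *: ('X * ('X * v.2^`()^`()) + (lam - lam ^+ 2) *: v.2)).
Proof.
rewrite /cq rhoN rhoZ rhoD rhoZ (rho_br _ pe pal) (rho_br _ pE1 pF1).
by rewrite !(rho_e, rho_al, rho_E1, rho_F1); poly_lin.
Qed.

Definition en n : Defs.V := ('X^n, 0).
Definition on n : Defs.V := (0, 'X^n).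

Lemma XderivXn n : 'X * ('X^n)^`() = n%:R *: 'X^n :> {poly C}.
Proof.
case: n => [|n]; first by rewrite derivXn mulr0n mulr0 scale0r.
by rewrite derivXn /= mulrnAr -exprS scaler_nat.
Qed.

Lemma XXderivXn n : 'X * ('X * ('X^n)^`()^`()) = (n%:R * (n%:R - 1)) *: 'X^n :> {poly C}.
Proof.
have h : 'X * ('X^n)^`()^`() = ('X * ('X^n)^`())^`() - ('X^n)^`() :> {poly C}.
  by rewrite derivM derivX mul1r addrAC subrr add0r.
by rewrite h XderivXn derivZ mulrBr -scalerAr XderivXn scalerA -scalerBl mulrBr mulr1.
Qed.

Lemma E1_en n : rho E1 (en n) = (n%:R - lam) *: on n.
Proof. by rewrite rho_E1; congr pair; rewrite /= ?scaler0 // XderivXn scalerBl. Qed.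
Lemma E1_on n : rho E1 (on n) = 0.
Proof. by rewrite rho_E1 /= deriv0 mulr0 scaler0 subr0. Qed.
Lemma E2_en n : rho E2 (en n) = 0.
Proof. by rewrite rho_E2 /= mulr0. Qed.
Lemma E2_on n : rho E2 (on n) = en n.+1.
Proof. by rewrite rho_E2 /= -exprS. Qed.
Lemma F1_en n : rho F1 (en n) = 0. Proof. by rewrite rho_F1. Qed.
Lemma F1_on n : rho F1 (on n) = en n. Proof. by rewrite rho_F1. Qed.
Lemma F2_e0 : rho F2 (en 0) = 0.
Proof. by rewrite rho_F2 /= expr0 deriv_one. Qed.
Lemma F2_en n : rho F2 (en n.+1) = n.+1%:R *: on n.
Proof. by rewrite rho_F2; congr pair; rewrite /= ?scaler0 // derivXn scaler_nat. Qed.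
Lemma F2_on n : rho F2 (on n) = 0.
Proof. by rewrite rho_F2 /= deriv0. Qed.
Lemma r_en n : rho r (en n) = (2%:R^-1 * (n%:R * (n%:R - 1))) *: en n.
Proof.
rewrite rho_r; congr pair; rewrite /= ?XXderivXn ?scalerA //.
by rewrite !deriv0 !mulr0 !scaler0 addr0.
Qed.
Lemma r_on n : rho r (on n) = (2%:R^-1 * (n%:R * (n%:R + 1))) *: on n.
Proof.
rewrite rho_r; congr pair; rewrite /= ?deriv0 ?mulr0 ?scaler0 // XXderivXn XderivXn.
by lmod_over C.
Qed.
Lemma q_en n : rho q (en n) = (2%:R^-1 * (n%:R * (n%:R - 1) + (lam - lam ^+ 2))) *: en n.
Proof.
rewrite rho_q; congr pair; rewrite /= ?deriv0 ?mulr0 ?scaler0 ?addr0 ?scaler0 //.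
by rewrite XXderivXn; lmod_over C.
Qed.
Lemma q_on n : rho q (on n) = (2%:R^-1 * (n%:R * (n%:R - 1) + (lam - lam ^+ 2))) *: on n.
Proof.
rewrite rho_q; congr pair; rewrite /= ?deriv0 ?mulr0 ?scaler0 ?addr0 ?scaler0 //.
by rewrite XXderivXn; lmod_over C.
Qed.

Let pr : lpar false r. Proof. by rewrite /cr; par. Qed.
Let pq : lpar false q. Proof. by rewrite /cq; par. Qed.
Let prN : lpar false (- r). Proof. exact: lparN. Qed.
Let pqN : lpar false (- q). Proof. exact: lparN. Qed.

(** The eigenvalues of [r] on [on n] and [en n] differ by [n], so each [ad (- r)] contributes a
    factor [n]. *)
Lemma adF1_act k n : rho (ad (- r) k F1) (on n) = n%:R ^+ k *: en n /\
  rho (ad (- r) k F1) (en n) = 0.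
Proof.
elim: k n => [|k IH] n; first by rewrite F1_on F1_en expr0 scale1r.
have [IHo IHe] := IH n; have pk := lpar_ad k prN pF1.
have lin := op_linZ (rho_lin _); have linN := op_linN (rho_lin _).
rewrite adS !(rho_br _ prN pk) !(rhoN r) r_on IHo IHe (op_lin0 (rho_lin r)) oppr0 sub0r.
rewrite r_en !linN !lin IHo IHe r_en scaler0 !oppr0 scaler0 oppr0; split=> //.
by rewrite /ssign /= exprS; lmod_over C.
Qed.

(** The factor [n] is now the difference of the eigenvalues of [q] on [en n.+1] and [on n]; [en 0]
    is separate because [F2] kills it. *)
Lemma adF2_act k n : [/\ rho (ad (- q) k F2) (on n) = 0,
  rho (ad (- q) k F2) (en n.+1) = (n.+1%:R * n%:R ^+ k) *: on n
  & rho (ad (- q) k F2) (en 0) = 0].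
Proof.
elim: k n => [|k IH] n; first by rewrite F2_on F2_en F2_e0 expr0 mulr1.
have [IHo IHe IH0] := IH n; have pk := lpar_ad k pqN pF2.
have lin := op_linZ (rho_lin _); have linN := op_linN (rho_lin _).
rewrite adS !(rho_br _ pqN pk) !(rhoN q) !q_en q_on IHo IHe IH0 (op_lin0 (rho_lin q)) oppr0 !sub0r.
rewrite !linN !lin IHo IHe IH0 q_on !scaler0 !oppr0 !scaler0 oppr0; split=> //.
by rewrite /ssign /= -(natr1 n) [_ ^+ k.+1]exprS; lmod_over C.
Qed.

Lemma pF1k k : lpar true (ad (- r) k F1). Proof. exact: lpar_ad. Qed.
Lemma pF2k k : lpar true (ad (- q) k F2). Proof. exact: lpar_ad. Qed.

Lemma cartan1_act k n : rho (cartan E1 F1 r k) (on n) = ((n%:R - lam) * n%:R ^+ k) *: on n /\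
  rho (cartan E1 F1 r k) (en n) = ((n%:R - lam) * n%:R ^+ k) *: en n.
Proof.
have lin := op_linZ (rho_lin _); have [aF eF] := adF1_act k n.
rewrite /cartan !(rho_br _ pE1 (pF1k k)) E1_on E1_en aF eF !(op_lin0 (rho_lin _)) !lin aF E1_en.
by rewrite /ssign /=; split; lmod_over C.
Qed.

Lemma cartan2_act k n : [/\ rho (cartan E2 F2 q k) (on n) = (n.+1%:R * n%:R ^+ k) *: on n,
  rho (cartan E2 F2 q k) (en n.+1) = (n.+1%:R * n%:R ^+ k) *: en n.+1
  & rho (cartan E2 F2 q k) (en 0) = 0].
Proof.
have lin := op_linZ (rho_lin _); have [aF eF zF] := adF2_act k n.
rewrite /cartan !(rho_br _ pE2 (pF2k k)) E2_on !E2_en aF eF zF !(op_lin0 (rho_lin _)) !lin E2_on.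
by rewrite /ssign /=; split; lmod_over C.
Qed.

Lemma cartan_sum_act f g n : let D := cartan_sum E1 E2 F1 F2 r q f g in
  [/\ rho D (on n) = ((n%:R - lam) * f.[n%:R] + n.+1%:R * g.[n%:R]) *: on n,
   rho D (en n.+1) = ((n.+1%:R - lam) * f.[n.+1%:R] + n.+1%:R * g.[n%:R]) *: en n.+1
   & rho D (en 0) = ((0 - lam) * f.[0]) *: en 0].
Proof.
have sumE (p : {poly C}) c x (G : nat -> L) v w :
    (forall k, rho (G k) v = (c * x ^+ k) *: w) ->
    rho (\sum_(i < size p) p`_i *: G i) v = (c * p.[x]) *: w.
  move=> Gv; rewrite rho_sum horner_coef mulr_sumr scaler_suml; apply: eq_bigr => i _.
  by rewrite rhoZ Gv scalerA; congr (_ *: _); ring.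
have pactS u (p : {poly C}) (E F : L) :
    {[E, pact (- u) p F]} = \sum_(i < size p) p`_i *: cartan E F u i.
  by rewrite lbr_sumr; apply: eq_bigr => i _; rewrite lbrZr.
move=> D; rewrite /D /cartan_sum !pactS; split; rewrite rhoD.
- rewrite (sumE _ _ _ _ _ _ (fun k => (cartan1_act k n).1)) scalerDl; congr (_ + _).
  by apply: sumE => k; have [] := cartan2_act k n.
- rewrite (sumE _ _ _ _ _ _ (fun k => (cartan1_act k n.+1).2)) scalerDl; congr (_ + _).
  by apply: sumE => k; have [] := cartan2_act k n.
- rewrite (sumE _ _ _ _ _ _ (fun k => (cartan1_act k 0).2)) rho_sum big1 ?addr0 // => i _.
  by have [_ _ z] := cartan2_act i 0; rewrite rhoZ z scaler0.
Qed.

Lemma nat_roots (p : {poly C}) : (forall n : nat, p.[n%:R] = 0) -> p = 0.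
Proof.
move=> p0; apply: (@roots_geq_poly_eq0 _ p [seq i%:R | i <- iota 0 (size p)]).
- by apply/allP => _ /mapP[i _ ->]; apply/eqP/p0.
- by rewrite map_inj_uniq ?iota_uniq // => i j /eqP; rewrite eqr_nat => /eqP.
- by rewrite size_map size_iota.
Qed.

(** The eigenvalues on [en n.+1] and on [on n] share the term in [g], so [(n - lam) f(n)] does not
    depend on [n]; the action on [en 0] shows that it is 0. Polynomials vanishing at all naturals
    are zero, first for [g], then for [f] after cancelling ['X - lam]. *)
Lemma cartan_sum_faithful f g :
  (forall v, rho (cartan_sum E1 E2 F1 F2 r q f g) v = 0) -> cartan_sum E1 E2 F1 F2 r q f g = 0.
Proof.
move=> D0; have scal0 c (p : {poly C}) : p != 0 -> c *: p = 0 -> c = 0.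
  by move=> pn0 /eqP; rewrite scaler_eq0 (negPf pn0) orbF => /eqP.
have Xn0 n : 'X^n != 0 :> {poly C} by rewrite monic_neq0 ?monicXn.
have ev n : (n.+1%:R - lam) * f.[n.+1%:R] + n.+1%:R * g.[n%:R] = 0.
  have [_ h _] := cartan_sum_act f g n; rewrite D0 in h.
  exact: (scal0 _ _ (Xn0 n.+1) (esym (congr1 fst h))).
have od n : (n%:R - lam) * f.[n%:R] + n.+1%:R * g.[n%:R] = 0.
  have [h _ _] := cartan_sum_act f g n; rewrite D0 in h.
  exact: (scal0 _ _ (Xn0 n) (esym (congr1 snd h))).
have hf n : (n%:R - lam) * f.[n%:R] = 0.
  elim: n => [|n IH].
    have [_ _ h] := cartan_sum_act f g 0; rewrite D0 in h.
    exact: (scal0 _ _ (Xn0 0) (esym (congr1 fst h))).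
  by have := ev n; have := od n; rewrite IH add0r => ->; rewrite addr0.
have g0 : g = 0.
  apply: nat_roots => n; have := od n; rewrite hf add0r => /eqP.
  by rewrite mulf_eq0 pnatr_eq0 => /eqP.
have f0 : f = 0.
  have : ('X - lam%:P) * f = 0 by apply: nat_roots => n; rewrite hornerM hornerXsubC.
  by move/eqP; rewrite mulf_eq0 polyXsubC_eq0 => /eqP.
by rewrite /cartan_sum f0 g0 !pact0 !lbr0r addr0.
Qed.

Lemma rho_injective x : (forall v, rho x v = 0) -> x = 0.
Proof.
apply: (presented_ideal_trivial t0 S V quot_FF lquot_gen (I := fun x => forall v, rho x v = 0)).
- by move=> y z y0 z0 v; rewrite rhoD y0 z0 addr0.
- by move=> c y y0 v; rewrite rhoZ y0 scaler0.
- move=> y z z0 v; rewrite rho_lbr sbrE z0 (op_lin0 (rho_lin y)).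
  have e0 u : ev (rho z) u = 0 by rewrite /ev !z0.
  have o0 u : od (rho z) u = 0 by rewrite /od !z0.
  by rewrite !e0 !o0 !addr0 !subr0.
- by move=> f g /cartan_sum_faithful.
Qed.
End ClosedForms.
End Representation.

Theorem theorem4p3 (lam t : C)
    (hlam : forall n : int, lam != n%:~R) (ht : t != 0) :
  (* the natural map F -> End(C[x,theta]) is a well-defined map on F = LT/lcong norel *)
  (forall a b, lcong norel a b -> forall v, eval lam t a v = eval lam t b v) /\
  (* it lands in sl(lam|lam+1) and is surjective onto it *)
  (forall a, in_sl lam t (eval lam t a)) /\
  (forall A, in_sl lam t A -> exists a, forall v, eval lam t a v = A v) /\
  (* its kernel is the ideal generated by the relations (0.1)-(3.1) *)
  (forall a, (forall v, eval lam t a v = 0) <-> lcong (rels lam t) a Zero).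
Proof.
split; last split; last split.
- move=> a b ab v; have norel_sound l r : norel l r -> eval lam t l = eval lam t r by [].
  by rewrite (lcong_sound norel_sound ab).
- by elim=> [[]||a IHa b IHb|c a IHa|a IHa b IHb]; constructor.
- move=> A slA; suff [a <-] : exists a, eval lam t a = A by exists a.
  elim: slA => {A} [||||| A B _ [a <-] _ [b <-]|c A _ [a <-]|A B _ [a <-] _ [b <-]].
  + by exists tX.
  + by exists tY.
  + by exists tZ.
  + by exists tU.
  + by exists Zero.
  + by exists (Add a b).
  + by exists (Scale c a).
  + by exists (Br a b).
(* Congruence to [Zero] means vanishing in the presented algebra, where [rho] is injective; the
   converse is soundness. *)
- move=> a; split=> [a0|a0 v].
    by apply/clsP; rewrite cls0; apply: (rho_injective ht) => v; rewrite rho_cls.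
  by rewrite (lcong_sound (@relations_sound lam t) a0).
Qed.
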